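(* Let $w=(w(i);i\ge1)$ be a sequence of nonnegative weights such that $w(k)>0$ for some $k\ge2$, set $w(0)=1$, and assume that $(w(i);i\ge0)$ is equivalent to a probability distribution $\pi$ on $\mathbb{Z}_+$ which is critical (its mean equals $1$) and has finite positive variance $\sigma^2$. For every $n\ge1$ such that $\mathbb{P}^w_n$ is well defined, let $P_n$ be a random non-crossing partition of $[n]$ with law $\mathbb{P}^w_n$, and for $A\subset\mathbb{N}=\{1,2,\dots\}$ let $\zeta_A(P_n)$ be the number of blocks of $P_n$ whose size belongs to $A$. Fix an integer $k\ge1$ and let $A_1,\dots,A_k$ be non-empty subsets of $\mathbb{N}$. Then there exists a centered Gaussian vector $(X_{A_1},\dots,X_{A_k})$ such that the convergence $$\left(\frac{\zeta_{A_1}(P_n)-\pi(A_1)n}{\sqrt n},\dots,\frac{\zeta_{A_k}(P_n)-\pi(A_k)n}{\sqrt n}\right)\ \xrightarrow[n\to\infty]{(d)}\ (X_{A_1},\dots,X_{A_k})$$ holds in distribution (along the $n$ for which $\mathbb{P}^w_n$ is well defined). In addition, $$\mathbb{E}[X_{A_i}^2]=\pi(A_i)(1-\pi(A_i))-\frac1{\sigma^2}\sum_{r\in A_i}(r-1)^2\pi(r)\qquad\text{for }1\le i\le k,$$ and $$\operatorname{Cov}(X_{A_i},X_{A_j})=-\pi(A_i)\pi(A_j)-\frac1{\sigma^2}\sum_{r\in A_i}(r-1)^2\pi(r)\cdot\sum_{s\in A_j}(s-1)^2\pi(s)$$ if $1\le i\ne j\le k$ are such that $A_i\cap A_j=\e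mptyset$.
   Context: A partition of $[n]=\{1,\dots,n\}$ is non-crossing if, when $1,\dots,n$ are placed in clockwise order at the vertices of a regular $n$-gon, the convex hulls of its blocks are pairwise disjoint; $\mathbb{NC}_n$ is the set of these. $\mathbb{P}^w_n$ is the probability measure on $\mathbb{NC}_n$ with $\mathbb{P}^w_n(P)=\Omega^w(P)/\sum_{Q\in\mathbb{NC}_n}\Omega^w(Q)$, where $\Omega^w(P)=\prod_{B\text{ block of }P}w(|B|)$; it is well defined when $\sum_{Q\in\mathbb{NC}_n}\Omega^w(Q)>0$. Two sequences $(w(i);i\ge0)$ and $(\widetilde w(i);i\ge0)$ are equivalent if there exist $a,b>0$ such that $\widetilde w(i)=ab^iw(i)$ for every $i\ge0$. $\mathbb{Z}_+=\{0,1,2,\dots\}$.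
   Formalization: The printed variance can be negative (w(0)=w(2)=1, A={2} gives -1/4), so the sum over A of (r-1)^2 pi(r) is replaced by the square of the sum of (r-1)pi(r) in E[X_A^2], and by the sum of (r-1)pi(r) for each set in the covariance. *)

(* Defs.v *)
From HB Require Import structures.
From mathcomp Require Import all_boot all_order all_algebra.
From mathcomp Require Import all_classical all_reals all_analysis.

Set Implicit Arguments.
Unset Strict Implicit.
Unset Printing Implicit Defensive.

Import Order.TTheory GRing.Theory Num.Theory.
Import numFieldNormedType.Exports.

Local Open Scope classical_set_scope.
Local Open Scope ring_scope.

(* The elements 1, ..., n of [n] are represented by 0, ..., n - 1 in 'I_n. *)

(* The minus sign makes the numbering of the vertices clockwise. *)
Definition ngon_vertex (R : realType) (n : nat) (j : 'I_n) : R^o * R^o :=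
  (cos (2 * pi * j%:R / n%:R), - sin (2 * pi * j%:R / n%:R)).
Arguments ngon_vertex R {n} j.

Definition convex_hull (R : realType) (M : lmodType R) (S : set M) : set M :=
  smallest (@convex_set R M) S.

Definition block_hull (R : realType) (n : nat) (B : {set 'I_n}) :
    set (R^o * R^o) :=
  convex_hull (ngon_vertex R @` [set` B]).
Arguments block_hull R {n} B.

Definition noncrossing (R : realType) (n : nat) (P : {set {set 'I_n}}) : Prop :=
  forall B C : {set 'I_n}, B \in P -> C \in P -> B != C ->
    block_hull R B `&` block_hull R C = set0.
Arguments noncrossing R {n} P.

Definition NC (R : realType) (n : nat) : {set {set {set 'I_n}}} :=
  [set P | finset.partition P [set: 'I_n]%SET && `[< noncrossing R P >]]%SET.

Definition Omega (R : realType) (w : nat -> R) (n : nat)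
    (P : {set {set 'I_n}}) : R :=
  \prod_(B in P) w #|B|.

Definition partition_function (R : realType) (w : nat -> R) (n : nat) : R :=
  \sum_(Q in NC R n) Omega w Q.

Definition well_defined (R : realType) (w : nat -> R) : set nat :=
  [set n | (0 < n)%N /\ 0 < partition_function w n].

Definition sg_prob (R : realType) (w : nat -> R) (n : nat)
    (P : {set {set 'I_n}}) : R :=
  Omega w P / partition_function w n.

Definition has_sg_law (R : realType) (w : nat -> R) (n : nat)
    (d : measure_display) (T : measurableType d) (Pr : probability T R)
    (Pn : T -> {set {set 'I_n}}) : Prop :=
  (forall t, Pn t \in NC R n) /\
  forall Q, Q \in NC R n ->
    measurable (Pn @^-1` [set Q]) /\
    Pr (Pn @^-1` [set Q]) = (sg_prob w Q)%:E.

Definition zeta (A : set nat) (n : nat) (P : {set {set 'I_n}}) : nat :=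
  #|[set B in P | #|B| \in A]%SET|.

Definition equivalent_seq (R : realType) (w v : nat -> R) : Prop :=
  exists a b : R, [/\ 0 < a, 0 < b & forall i, v i = a * b ^+ i * w i].

Definition mass (R : realType) (p : probability nat R) (i : nat) : R :=
  fine (p [set i]).

(* For A a set of positive integers all the terms are nonnegative.  Since p has
   mean 1, this sum is the covariance under p of the indicator of A and of the
   increment xi - 1.  Conditioning on the sum of the increments subtracts its
   square, divided by the variance of p, from p(A) (1 - p(A)).  For example, if
   p charges 0 and 2 only, every block has size 2, the number of blocks is
   deterministic, and for A = {2} the difference is 1/4 - (1/2)^2 = 0. *)
Definition drift_sum (R : realType) (p : probability nat R) (A : set nat) :
    \bar R :=
  (\sum_(0 <= r <oo | r \in A) ((r%:R - 1) * mass p r)%:E)%E.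

Definition scaled_counts (R : realType) (p : probability nat R) (k : nat)
    (A : 'I_k -> set nat) (n : nat) (P : {set {set 'I_n}}) : 'rV[R]_k :=
  \row_i (((zeta (A i) P)%:R - fine (p (A i)) * n%:R) / Num.sqrt n%:R).

(* Convergence in distribution along the filter F of random vectors V n, each
   defined on its own probability space. *)
Definition cvg_in_law (R : realType) (k : nat) (F : set_system nat)
    (d : nat -> measure_display) (T : forall n, measurableType (d n))
    (Pr : forall n, probability (T n) R) (V : forall n, T n -> 'rV[R]_k)
    (d' : measure_display) (T' : measurableType d') (Pr' : probability T' R)
    (X : T' -> 'rV[R]_k) : Prop :=
  forall f : 'rV[R]_k -> R,
    continuous f -> (exists M : R, forall x, `|f x| <= M) ->
    ('E_(Pr n)[f \o V n] @[n --> F] --> 'E_Pr'[f \o X])%E.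

(* Point masses count as (degenerate) Gaussian laws; they are treated separately
   because normal_prob m 0 is not the point mass at m. *)
Definition gaussian (R : realType) (d : measure_display) (T : measurableType d)
    (Pr : probability T R) (Y : T -> R) : Prop :=
  exists m s : R, forall B : set R, measurable B ->
    Pr (Y @^-1` B) = if s == 0 then dirac m B else normal_prob m s B.

Definition gaussian_vector (R : realType) (d : measure_display)
    (T : measurableType d) (Pr : probability T R) (k : nat)
    (X : 'I_k -> T -> R) : Prop :=
  forall c : 'I_k -> R, gaussian Pr (fun t => \sum_i c i * X i t).

Definition centered_gaussian_vector (R : realType) (d : measure_display)
    (T : measurableType d) (Pr : probability T R) (k : nat)
    (X : 'I_k -> T -> R) : Prop :=
  gaussian_vector Pr X /\ forall i, 'E_Pr[X i]%E = 0%E.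

(* Main.v *)
Require Import Defs.
From HB Require Import structures.
From mathcomp Require Import all_boot all_order all_algebra.
From mathcomp Require Import all_classical all_reals all_analysis.
From mathcomp Require Import measurable_realfun complex.
From mathcomp Require Import zify ring lra.

(* The sequence of block sizes, placed at the minima of the blocks and completed
   by zeros, encodes a noncrossing partition of [n] as a Lukasiewicz word of n + 1
   letters with sum n, and by the cycle lemma exactly one rotation out of n + 1 of
   any word with that sum is such a word.  Hence the letters of the word of P_n
   are, up to rotation, n + 1 independent variables of law p conditioned on their
   sum being n, and zeta_A counts the letters in A.

   The conditioning is removed by Fourier inversion: the characteristic function
   of the rescaled counts is a quotient of two integrals over the frequency dual
   to the sum, and both converge by dominated convergence.  Only the residuals of
   the indicators of the sets A_i after regression on xi - 1 survive, so the limit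
   is Gaussian with the covariances of these residuals.  Convergence in law
   follows from that of the characteristic functions through a Bernstein
   approximation by trigonometric polynomials and a tightness estimate. *)

(** Characteristic functions appear as expectations of a cosine with an arbitrary phase [b]: this
    carries real and imaginary parts at once and keeps the limits and integrals real. A word with
    sum n has no letter above n, so the polynomial raised to the power n + 1 is the characteristic
    function of p truncated at n; the finite mean of p pays for the truncation. The support of p may
    lie in a proper sublattice. With h its span, the integral runs over one period 2 pi / h of the
    frequency, and P_n is well defined only when h divides n; the constants depending on h cancel in
    the quotient. Since the increments add up to -1, any multiple of their sum may be subtracted
    from a count at the price of a deterministic shift. The regression coefficient is the multiple
    that kills the cross term of the variance, so that the limit of the integrand factors into a
    function of theta and a fixed Gaussian function of the frequency. *)

Set Implicit Arguments.
Unset Strict Implicit.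
Unset Printing Implicit Defensive.

Import Order.TTheory GRing.Theory Num.Theory.
Import numFieldNormedType.Exports.

Local Open Scope classical_set_scope.
Local Open Scope ring_scope.

(** * Labelled words and noncrossing partitions *)

(* Reading the word from left to right, the label of a position is the position
   itself when a block opens there, and otherwise the last opened block that is
   not yet complete. *)
Fixpoint stack_labels (s : nat -> nat) (i : nat) : seq nat :=
  if i is i'.+1 then
    let t := stack_labels s i' in
    rcons t (if (0 < s i')%N then i'
             else last 0%N [seq j <- iota 0 i' | (count_mem j t < s j)%N])
  else [::].

Lemma iota0_rcons i : iota 0 i.+1 = rcons (iota 0 i) i.
Proof. by rewrite -addn1 iotaD cats1. Qed.

Lemma size_stack_labels s i : size (stack_labels s i) = i.
Proof. by elim: i => //= i IH; rewrite size_rcons IH. Qed.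

Definition stack_label s i := nth 0%N (stack_labels s i.+1) i.

Lemma stack_labelsE s i : stack_labels s i = map (stack_label s) (iota 0 i).
Proof.
elim: i => // i IH; rewrite iota0_rcons map_rcons -IH /stack_label /=.
by rewrite nth_rcons size_stack_labels ltnn eqxx.
Qed.

Definition label_count (l : nat -> nat) i j := count (fun m => l m == j) (iota 0 i).

Lemma label_countS l i j :
  label_count l i.+1 j = (label_count l i j + (l i == j))%N.
Proof. by rewrite /label_count iota0_rcons -cats1 count_cat /= addn0. Qed.

Lemma leq_label_count l i k j :
  (i <= k)%N -> (label_count l i j <= label_count l k j)%N.
Proof.
move=> /subnK <-; elim: (k - i)%N => // m IH.
by rewrite addSn label_countS (leq_trans IH) // leq_addr.
Qed.

Lemma label_count_lt l i k m :
  (i <= m < k)%N -> (label_count l i (l m) < label_count l k (l m))%N.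
Proof.
move=> /andP[im mk]; apply: leq_trans (leq_label_count l (l m) mk).
by rewrite label_countS eqxx addn1 ltnS leq_label_count.
Qed.

(** The filtered list is increasing, so its last element, the top of the stack, is the largest index
    satisfying [P]; the default 0 of [last] is not reached. *)
Lemma last_filter_iota (P : pred nat) i j :
  (j < i)%N -> P j ->
  let k := last 0%N [seq j <- iota 0 i | P j] in [/\ (k < i)%N, P k & (j <= k)%N].
Proof.
elim: i j => // i IH j; rewrite iota0_rcons -cats1 filter_cat /= ltnS => ji Pj.
have [Pi|nPi] := boolP (P i); first by rewrite last_cat /=; split.
rewrite cats0; have {}ji : (j < i)%N.
  by rewrite ltn_neqAle ji andbT; apply: contraNneq nPi => <-.
by have [ki Pk jk] := IH j ji Pj; split => //; exact: ltnW.
Qed.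

Lemma sum_label_count l i N :
  (forall m, (m < i)%N -> (l m < N)%N) ->
  (\sum_(0 <= j < N) label_count l i j)%N = i.
Proof.
elim: i => [_|i IH lN]; first by rewrite big1.
rewrite (eq_bigr _ (fun j _ => label_countS l i j)) big_split /= IH => [|m mi]; last first.
  by apply: lN; exact: ltnW.
rewrite (bigD1_seq (l i)) ?mem_index_iota ?iota_uniq ?lN//= eqxx.
by rewrite big1 ?addn0 ?addn1// => j; rewrite eq_sym => /negbTE ->.
Qed.

Section stack_labelling.
Variables (n : nat) (s : nat -> nat).
Hypothesis s_luk : forall i, (i < n)%N -> (i < \sum_(0 <= j < i.+1) s j)%N.
Hypothesis s_sum : (\sum_(0 <= j < n) s j)%N = n.

Let l := stack_label s.
Let c := label_count l.

Lemma stack_labelE i : l i = if (0 < s i)%N then i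
  else last 0%N [seq j <- iota 0 i | (c i j < s j)%N].
Proof.
rewrite /l /stack_label /= nth_rcons size_stack_labels ltnn eqxx.
case: ifP => // _; congr last; apply: eq_filter => j.
by rewrite stack_labelsE count_map.
Qed.

(** Both bounds go through one induction: the first makes the count of a newly opened block start at
    0, the second lets a zero letter find an unfinished block. *)
Lemma stack_label_inv i : (i <= n)%N ->
  (forall m, (m < i)%N -> (l m <= m)%N) /\ (forall j, (c i j <= s j)%N).
Proof.
elim: i => // i IH iN; have [lm cs] := IH (ltnW iN).
have key : (l i <= i)%N /\ (c i (l i) < s (l i))%N.
  rewrite stack_labelE; case: ifP => [si|/negbT]; last rewrite -leqNgt leqn0 => /eqP si0.
    split=> //; suff -> : c i i = 0%N by [].
    apply/eqP; rewrite eqn0Ngt -has_count -all_predC; apply/allP => m.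
    by rewrite mem_iota /= add0n => mi; rewrite ltn_eqF// (leq_ltn_trans (lm _ mi)).
  (* If all blocks opened before [i] were complete, their sizes would add up to the [i] positions
     already labelled, whereas the partial sum up to the zero letter [s i] exceeds [i]. *)
  have [j ji cj] : exists2 j, (j < i)%N & (c i j < s j)%N.
    apply: contrapT => H0.
    have H j : (j < i)%N -> (s j <= c i j)%N.
      by move=> ji; rewrite leqNgt; apply/negP => cj; apply: H0; exists j.
    have := s_luk iN; rewrite big_nat_recr //= si0 addn0.
    suff -> : (\sum_(0 <= j < i) s j)%N = i by rewrite ltnn.
    rewrite -[RHS](@sum_label_count l i i); last first.
      by move=> m mi; exact: leq_ltn_trans (lm _ mi) mi.
    apply: eq_big_nat => j /andP[_ ji]; apply/eqP.
    by rewrite eqn_leq cs H.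
  have [ki ck _] := @last_filter_iota (fun j => c i j < s j)%N i j ji cj.
  by split=> //; exact: ltnW.
split=> [m|j].
  by rewrite ltnS leq_eqVlt => /predU1P[->|/lm//]; case: key.
rewrite /c label_countS -/(c i j); case: eqP => [<-|_]; last by rewrite addn0.
by rewrite addn1; case: key.
Qed.

Lemma stack_label_le i : (i < n)%N -> (l i <= i)%N.
Proof. by move=> iN; have [H _] := stack_label_inv iN; exact: H. Qed.

Lemma stack_label_count_le i j : (i <= n)%N -> (c i j <= s j)%N.
Proof. by move=> iN; have [_ H] := stack_label_inv iN; exact: H. Qed.

(** The counts never exceed the sizes and both families have total [n], so no count can fall
    short. *)
Lemma stack_label_count j : (j < n)%N -> c n j = s j.
Proof.
have ltl m : (m < n)%N -> (l m < n)%N.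
  by move=> mn; exact: leq_ltn_trans (stack_label_le mn) mn.
move=> jn; apply/eqP; rewrite eqn_leq stack_label_count_le //= leqNgt; apply/negP => cj.
have := s_sum; rewrite -[RHS](sum_label_count ltl) => /eqP; apply/negP.
rewrite gtn_eqF// (bigD1_seq j) ?mem_index_iota ?iota_uniq//=.
rewrite [X in (_ < X)%N](bigD1_seq j) ?mem_index_iota ?iota_uniq//=.
by rewrite -addSn leq_add// leq_sum// => k _; exact: stack_label_count_le.
Qed.

Lemma stack_label_open i : (i < n)%N -> (c i (l i) < s (l i))%N.
Proof.
move=> iN; have := @stack_label_count_le i.+1 (l i) iN.
by rewrite /c label_countS eqxx addn1.
Qed.

Lemma stack_label_idem i : (i < n)%N -> l (l i) = l i.
Proof.
move=> iN; rewrite [in LHS]stack_labelE; case: ifP => // /negbT.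
by rewrite -leqNgt leqn0 => /eqP s0; have := stack_label_open iN; rewrite s0.
Qed.

Lemma stack_label_max i j : (i < n)%N -> l i != i -> (j < i)%N ->
  (c i j < s j)%N -> (j <= l i)%N.
Proof.
move=> iN; rewrite stack_labelE; case: ifP => [|_ _ ji cj]; first by rewrite eqxx.
by have [] := @last_filter_iota (fun j => c i j < s j)%N i j ji cj.
Qed.

(** At [d] the block of [b] still waits for [e], and at [b] the block of [a] still waits for [d]. A
    label is the largest unfinished opening, so [l b <= l a] at the first moment and [l a <= l b] at
    the second. *)
Lemma stack_label_nc a b d e : (a < b < d)%N -> (d < e < n)%N ->
  l a = l d -> l b = l e -> l a = l b.
Proof.
move=> /andP[ab bd] /andP[de en] lad lbe.
have dn : (d < n)%N by exact: ltn_trans en.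
have bn : (b < n)%N by exact: ltn_trans dn.
have an : (a < n)%N by exact: ltn_trans bn.
have la := stack_label_le an; have lb := stack_label_le bn.
have op i m : (i <= m < n)%N -> (c i (l m) < s (l m))%N.
  move=> /andP[im mn]; apply: leq_trans (@stack_label_count_le n _ (leqnn _)).
  by apply: label_count_lt; rewrite im.
have h1 : (l b <= l a)%N.
  rewrite lad; apply: stack_label_max => //.
  - by rewrite -lad neq_ltn (leq_ltn_trans la (ltn_trans ab bd)).
  - exact: leq_ltn_trans lb bd.
  - by rewrite lbe; apply: op; rewrite en (ltnW de).
apply/eqP; rewrite eqn_leq h1 andbT.
apply: stack_label_max => //.
- by rewrite neq_ltn (leq_ltn_trans h1 (leq_ltn_trans la ab)).
- exact: leq_ltn_trans la ab.
- by rewrite lad; apply: op; rewrite dn (ltnW bd).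
Qed.

End stack_labelling.

Definition label_noncrossing n (l : 'I_n -> 'I_n) := forall a b c d : 'I_n,
  (a < b)%N -> (b < c)%N -> (c < d)%N -> l a = l c -> l b = l d -> l a = l b.

(** Openings are the indices of nonempty fibres, so both labellings share them. At the first
    disagreement [i], the labelling with the smaller label would have to complete the other block
    after [i], across the block to which it assigns [i]. *)
Lemma label_inj n (l l' : 'I_n -> 'I_n) :
  (forall i, (l i <= i)%N) -> (forall i, l (l i) = l i) -> label_noncrossing l ->
  (forall i, (l' i <= i)%N) -> (forall i, l' (l' i) = l' i) -> label_noncrossing l' ->
  (forall j, #|[set i | l i == j]%SET| = #|[set i | l' i == j]%SET|) -> l =1 l'.
Proof.
move=> lle lid lnc l'le l'id l'nc card_ll'.
suff H k : forall i : 'I_n, (i < k)%N -> l i = l' i by move=> i; apply: (H i.+1).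
elim: k => // k IH i; rewrite ltnS leq_eqVlt => /predU1P[ik|]; last exact: IH.
have fix_transfer (u v : 'I_n -> 'I_n) : (forall i, u (u i) = u i) ->
    (forall j, #|[set i | v i == j]%SET| = #|[set i | u i == j]%SET|) ->
    v i = i -> u i = i.
  move=> uid e vi; have : (0 < #|[set m | v m == i]%SET|)%N.
    by apply/card_gt0P; exists i; rewrite inE vi.
  by rewrite e => /card_gt0P[m]; rewrite inE => /eqP <-; rewrite uid.
have not_lt (u v : 'I_n -> 'I_n) : (forall i, u (u i) = u i) -> label_noncrossing u ->
    (forall i, (v i <= i)%N) ->
    (forall j, #|[set i | u i == j]%SET| = #|[set i | v i == j]%SET|) ->
    (forall m : 'I_n, (m < i)%N -> u m = v m) -> v i != i -> ~~ (u i < v i)%N.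
  move=> uid unc vle e uv vi; apply/negP => uvi.
  have vii : (v i < i)%N by rewrite ltn_neqAle vle andbT.
  (* Before [i] the fibres over [v i] agree, and [i] lies in the fibre of [v]; equal cardinality
     forces an element from [i] on into that of [u]. *)
  have [m im um] : exists2 m : 'I_n, (i <= m)%N & u m = v i.
    apply: contrapT => H0.
    have : (#|[set m | u m == v i]%SET| < #|[set m | v m == v i]%SET|)%N.
      apply: proper_card; apply/properP; split.
        apply/fintype.subsetP => m; rewrite !inE => /eqP um.
        by rewrite -uv ?um// ltnNge; apply/negP => im; apply: H0; exists m.
      by exists i; rewrite inE // neq_ltn uvi.
    by rewrite e ltnn.
  have im' : (i < m)%N.
    rewrite ltn_neqAle im andbT; apply/eqP => /val_inj E.
    by move: uvi; rewrite -um -E ltnn.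
  have uvE : u (v i) = v i by rewrite -um uid.
  have := unc (u i) (v i) i m uvi vii im'; rewrite uid uvE => /(_ erefl (esym um)) uE.
  by rewrite uE ltnn in uvi.
have [lii|lii] := eqVneq (l i) i; first by rewrite lii (fix_transfer l' l).
have l'ii : l' i != i.
  by apply: contra_neq lii => l'ii; apply: (fix_transfer l l').
have IHi (m : 'I_n) : (m < i)%N -> l m = l' m by rewrite ik; exact: IH.
apply/val_inj/eqP; rewrite eqn_leq; apply/andP; split; rewrite leqNgt.
  by apply: (not_lt l' l l'id l'nc lle) => // m /IHi.
exact: (not_lt l l' lid lnc l'le).
Qed.

(** * Noncrossing partitions as Lukasiewicz words *)

Definition comb_noncrossing n (P : {set {set 'I_n}}) := forall B C (a b c d : 'I_n),
  B \in P -> C \in P -> a \in B -> c \in B -> b \in C -> d \in C ->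
  (a < b)%N -> (b < c)%N -> (c < d)%N -> B = C.

Definition comb_NC n : {set {set {set 'I_n}}} :=
  [set P | finset.partition P [set: 'I_n]%SET && `[< comb_noncrossing P >]]%SET.

Definition block_min n (P : {set {set 'I_n}}) (i : 'I_n) : 'I_n :=
  [arg min_(j < i | j \in finset.pblock P i) (j : nat)]%N.

Section block_min.
Variables (n : nat) (P : {set {set 'I_n}}).
Hypothesis P_part : finset.partition P [set: 'I_n]%SET.

Let mem_cover i : i \in finset.cover P.
Proof. by rewrite (finset.cover_partition P_part) finset.in_setT. Qed.

Let trivP : finset.trivIset P.
Proof. exact: finset.partition_trivIset P_part. Qed.

Lemma block_minP i : block_min P i \in finset.pblock P i /\
  forall j, j \in finset.pblock P i -> (block_min P i <= j)%N.
Proof.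
rewrite /block_min; case: arg_minnP => //.
by rewrite finset.mem_pblock mem_cover.
Qed.

Lemma block_min_le i : (block_min P i <= i)%N.
Proof. by have [_ ->] := block_minP i; rewrite ?finset.mem_pblock. Qed.

Lemma block_min_eq i j :
  (block_min P i == block_min P j) = (finset.pblock P i == finset.pblock P j).
Proof.
have [mi mini] := block_minP i; have [mj minj] := block_minP j.
apply/eqP/eqP => [e|e].
  rewrite -(finset.same_pblock trivP mi) e.
  exact: finset.same_pblock.
apply/val_inj/eqP; rewrite eqn_leq mini; last by rewrite e.
by rewrite minj // -e.
Qed.

Lemma block_min_idem i : block_min P (block_min P i) = block_min P i.
Proof.
apply/eqP; rewrite block_min_eq; apply/eqP.
by apply: finset.same_pblock => //; have [] := block_minP i.
Qed.

Lemma preim_block_min : finset.preim_partition (block_min P) [set: 'I_n]%SET = P.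
Proof.
rewrite -[RHS](finset.preim_partition_pblock P_part) /finset.preim_partition.
by rewrite /finset.equivalence_partition; apply: eq_imset => x; apply/setP => y;
  rewrite !inE block_min_eq.
Qed.

Lemma label_noncrossing_block_min :
  comb_noncrossing P -> label_noncrossing (block_min P).
Proof.
move=> ncP a b c d ab bc cd /eqP; rewrite block_min_eq => /eqP eac.
move=> /eqP; rewrite block_min_eq => /eqP ebd.
apply/eqP; rewrite block_min_eq; apply/eqP.
apply: (ncP _ _ a b c d); rewrite ?finset.pblock_mem ?finset.mem_pblock//.
- by rewrite eac finset.mem_pblock.
- by rewrite ebd finset.mem_pblock.
Qed.

Lemma card_block_min_lt j : (#|[set i | block_min P i == j :> nat]%SET| < n.+1)%N.
Proof. by rewrite ltnS -[X in (_ <= X)%N](card_ord n); exact: max_card. Qed.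

(** Positions that are not block minima have an empty fibre and contribute [x 0 = 1], as does the
    extra position [n]. *)
Lemma prod_block_min (C : comPzRingType) (x : nat -> C) : x 0%N = 1 ->
  \prod_(B in P) x #|B| = \prod_(j < n.+1) x #|[set i | block_min P i == j :> nat]%SET|.
Proof.
move=> x0; rewrite big_ord_recr /= [X in _ * x X](_ : _ = 0%N) ?x0 ?mulr1; last first.
  apply/eqP; rewrite cards_eq0; apply/eqP/setP => i; rewrite !inE.
  by rewrite ltn_eqF.
transitivity (\prod_(j in [set: 'I_n]%SET) x #|[set i | block_min P i == j]%SET|);
  last by apply: eq_big => // j; rewrite finset.in_setT.
rewrite (finset.set_partition_big _ P_part) /=; apply: eq_bigr => B BP.
have [i iB] : exists i, i \in B.
  apply/finset.set0Pn; apply: contraTneq BP => ->.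
  by rewrite (finset.partition0 P_part).
have pb j : j \in B -> finset.pblock P j = B by exact: finset.def_pblock.
have mB : block_min P i \in B by have [] := block_minP i; rewrite pb.
rewrite (bigD1 (block_min P i)) //= big1 ?mulr1 => [|j /andP[jB jm]].
  congr (x _); apply: eq_card => j; rewrite inE block_min_eq (pb i)//.
  apply/idP/eqP => [|<-]; first exact: pb.
  by rewrite finset.mem_pblock.
rewrite [X in x X](_ : _ = 0%N) //; apply/eqP; rewrite cards_eq0.
apply/eqP/setP => i'; rewrite !inE; apply/negbTE; apply: contraNN jm => /eqP e.
rewrite -e -(block_min_idem i') e block_min_eq -e.
by rewrite (pb i iB) e pb.
Qed.

End block_min.

(** After 1 is subtracted from each letter, the partial sums stay nonnegative until the last step,
    where they reach -1. Letters summing to [n] are at most [n], so the alphabet can be finite. *)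
Definition luk_words n : {set {ffun 'I_n.+1 -> 'I_n.+1}} :=
  [set s : {ffun 'I_n.+1 -> 'I_n.+1} | (\sum_j s j == n :> nat)%N &&
    [forall i : 'I_n.+1, (i < n)%N ==> (i < \sum_(j < n.+1 | (j <= i)%N) s j)%N]]%SET.

Definition block_word n (P : {set {set 'I_n}}) : {ffun 'I_n.+1 -> 'I_n.+1} :=
  [ffun j : 'I_n.+1 => inord #|[set i | block_min P i == j :> nat]%SET|].

Lemma block_wordE n (P : {set {set 'I_n}}) j :
  block_word P j = #|[set i | block_min P i == j :> nat]%SET| :> nat.
Proof. by rewrite ffunE inordK // card_block_min_lt. Qed.

Lemma card_preim_sum n (l : 'I_n -> nat) (Q : pred nat) :
  #|[set i | Q (l i)]%SET| = (\sum_(j < n.+1 | Q j) #|[set i | l i == j]%SET|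
    + #|[set i | Q (l i) && (n < l i)%N]%SET|)%N.
Proof.
rewrite -!sum1_card.
rewrite (eq_bigr (fun j : 'I_n.+1 => \sum_(i < n) (l i == j :> nat) : nat)%N); last first.
  by move=> j _; rewrite -sum1_card big_mkcond /=; apply: eq_bigr => i _; rewrite inE.
rewrite exchange_big /= big_mkcond /= [X in (_ + X)%N]big_mkcond -big_split /=.
apply: eq_bigr => i _; rewrite !inE; case Ql: (Q (l i)) => /=.
  case: ltnP => ln.
    by rewrite big1// => j _; case: eqP => // lj; move: ln; rewrite lj ltnNge -ltnS ltn_ord.
  rewrite addn0 (bigD1 (Ordinal (ln : (l i < n.+1)%N)))//= eqxx big1// => j /andP[_ jl].
  by case: eqP => // lj; case/eqP: jl; apply: val_inj.
by rewrite addn0 big1// => j Qj; case: eqP => // lj; rewrite lj Qj in Ql.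
Qed.

(** The partial sum up to [i] counts the positions whose block minimum is at most [i], and these
    include 0, ..., i. *)
Lemma block_word_luk n (P : {set {set 'I_n}}) :
  finset.partition P [set: 'I_n]%SET -> block_word P \in luk_words n.
Proof.
move=> partP.
have H (Q : pred nat) : (\sum_(j < n.+1 | Q j) block_word P j)%N =
    #|[set i | Q (block_min P i)]%SET|.
  rewrite (@card_preim_sum n (fun i => block_min P i)).
  rewrite [X in (_ = _ + X)%N](_ : _ = 0%N) ?addn0.
    by apply: eq_bigr => j _; rewrite block_wordE.
  apply/eqP; rewrite cards_eq0; apply/eqP/setP => i; rewrite !inE.
  by rewrite (ltnNge n) (ltnW (ltn_ord _)) andbF.
rewrite inE (H xpredT); apply/andP; split.
  by rewrite -[X in _ == X](card_ord n) -cardsT; apply/eqP/eq_card => i; rewrite !inE.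
apply/forallP => i; apply/implyP => ilt; rewrite (H (fun j => j <= i)%N).
have -> : i.+1 = #|[set i' : 'I_n | (i' <= i)%N]%SET|.
  rewrite -(card_ord i.+1) -!sum1_card (big_ord_widen_cond _ xpredT (fun=> 1%N) ilt).
  by apply: eq_bigl => j; rewrite inE ltnS.
apply/subset_leq_card/fintype.subsetP => j; rewrite !inE.
exact/leq_trans/block_min_le.
Qed.

Lemma block_word_inj n : {in comb_NC n &, injective (@block_word n)}.
Proof.
move=> P P'; rewrite !inE => /andP[partP /asboolP ncP] /andP[partP' /asboolP ncP'] /ffunP e.
suff E : block_min P =1 block_min P'.
  rewrite -(preim_block_min partP) -(preim_block_min partP').
  rewrite /finset.preim_partition /finset.equivalence_partition.
  by apply: eq_imset => x; apply/setP => y; rewrite !inE !E.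
apply: label_inj; try by [exact: block_min_le | exact: block_min_idem |
  exact: label_noncrossing_block_min].
move=> j; have /(congr1 val) := e (widen_ord (leqnSn n) j).
by rewrite /= !block_wordE.
Qed.

(** The preimage is the partition into fibres of the stack labelling, whose labels are the block
    minima. *)
Lemma block_word_onto n s : s \in luk_words n -> exists2 P, P \in comb_NC n & block_word P = s.
Proof.
rewrite inE => /andP[/eqP s_sum /forallP s_luk].
pose sn j := nat_of_ord (s (inord j)).
have sumE i : (i <= n.+1)%N -> (\sum_(0 <= j < i) sn j = \sum_(j < n.+1 | (j < i)%N) s j)%N.
  move=> iN; rewrite big_mkord (big_ord_widen _ sn iN).
  by apply: eq_bigr => j _; rewrite /sn inord_val.
have sn_luk i : (i < n)%N -> (i < \sum_(0 <= j < i.+1) sn j)%N.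
  move=> iN; rewrite sumE ?ltnS ?(ltnW iN)//.
  by have := s_luk (inord i); rewrite inordK ?iN//= ltnS ltnW.
have sn_sum_le : (\sum_(0 <= j < n) sn j)%N + sn n = n.
  rewrite -big_nat_recr //= sumE // -[RHS]s_sum.
  by apply: eq_bigl => j; rewrite ltn_ord.
(* The Lukasiewicz condition at [n - 1] already forces the total [n], so the last letter is 0. *)
have sn_sum : (\sum_(0 <= j < n) sn j)%N = n.
  apply/eqP; rewrite eqn_leq; apply/andP; split.
    by rewrite -[X in (_ <= X)%N]sn_sum_le; exact: leq_addr.
  by case: (n) sn_luk => // m /(_ m (ltnSn m)).
have snn : sn n = 0%N by move: sn_sum_le; rewrite sn_sum; lia.
pose l (i : 'I_n) : 'I_n := Ordinal (leq_ltn_trans (stack_label_le sn_luk (ltn_ord i)) (ltn_ord i)).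
have lE i : l i = stack_label sn i :> nat by [].
have l_idem i : l (l i) = l i.
  by apply: ord_inj; rewrite !lE (stack_label_idem sn_luk).
have l_nc : label_noncrossing l.
  move=> a b c d ab bc cd /(congr1 val) e1 /(congr1 val) e2; apply: ord_inj.
  by apply: (stack_label_nc sn_luk _ _ e1 e2); rewrite ?ab ?bc ?cd ?ltn_ord.
have equivl : {in [set: 'I_n]%SET & &, equivalence_rel (fun x y => l x == l y)}.
  by split=> // /eqP->.
pose P := finset.preim_partition l [set: 'I_n]%SET.
have partP : finset.partition P [set: 'I_n]%SET by exact: finset.preim_partitionP.
have memP B : B \in P -> exists i, B = [set j | l i == l j]%SET.
  by case/imsetP => i _ ->; exists i; apply/setP => j; rewrite !inE.
have pbP i : finset.pblock P i = [set j | l i == l j]%SET.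
  apply: finset.def_pblock; rewrite ?inE ?(finset.partition_trivIset partP)//.
  by apply/imsetP; exists i => //; apply/setP => j; rewrite !inE.
have bmin i : block_min P i = l i.
  have [] := block_minP partP i; rewrite pbP inE => /eqP e H.
  apply/val_inj/eqP; rewrite eqn_leq H ?inE ?l_idem//=.
  by rewrite -[stack_label sn i]lE e lE (stack_label_le sn_luk).
exists P.
  rewrite inE partP /=; apply/asboolP => B C a b c d /memP[i ->] /memP[j ->].
  rewrite !inE => /eqP ia /eqP ic /eqP jb /eqP jd ab bc cd.
  have := l_nc a b c d ab bc cd; rewrite -ia ic -jb jd => /(_ erefl erefl) E.
  by rewrite E.
apply/ffunP => j; apply/val_inj; rewrite /= block_wordE.
have [jn|nj] := ltnP j n; last first.
  have ejn : (j = n :> nat) by apply/eqP; rewrite eqn_leq nj -ltnS ltn_ord.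
  have -> : (s j : nat) = sn j by rewrite /sn inord_val.
  rewrite [in RHS]ejn snn; apply/eqP; rewrite cards_eq0; apply/eqP/setP => i; rewrite !inE.
  by rewrite ejn ltn_eqF.
have := stack_label_count sn_luk sn_sum jn; rewrite {2}/sn inord_val => <-.
rewrite /label_count -sum1_count -[X in iota 0 X]subn0 -/(index_iota 0 n) big_mkord.
by rewrite -sum1_card; apply: eq_bigl => i; rewrite inE bmin lE.
Qed.

(** * The cycle lemma *)

Section cycle_lemma.
Variables (n : nat).
Implicit Types (s : {ffun 'I_n.+1 -> 'I_n.+1}) (k : 'I_n.+1).

Definition rot_word k s : {ffun 'I_n.+1 -> 'I_n.+1} := [ffun i => s (i + k)].

Definition words : {set {ffun 'I_n.+1 -> 'I_n.+1}} :=
  [set s : {ffun 'I_n.+1 -> 'I_n.+1} | (\sum_j s j == n :> nat)%N]%SET.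

Lemma rot_wordK k : cancel (rot_word k) (rot_word (- k)).
Proof. by move=> s; apply/ffunP => i; rewrite !ffunE subrK. Qed.

Lemma rot_wordNK k : cancel (rot_word (- k)) (rot_word k).
Proof. by move=> s; apply/ffunP => i; rewrite !ffunE addrK. Qed.

Lemma big_rot_word (T : Type) (idx : T) (op : Monoid.com_law idx) (F : 'I_n.+1 -> T) k s :
  \big[op/idx]_i F (rot_word k s i) = \big[op/idx]_i F (s i).
Proof.
rewrite [RHS](reindex_inj (addIr k)) /=.
by apply: eq_bigr => i _; rewrite ffunE.
Qed.

(** Partial sums of the word continued periodically, which turns rotations into shifts of the
    starting point. *)
Let height s m := (\sum_(0 <= j < m) s (inord (j %% n.+1)))%N.

Let heightD s m : s \in words -> height s (m + n.+1) = (height s m + n)%N.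
Proof.
rewrite inE => /eqP ss; rewrite /height (@big_cat_nat _ _ _ m) ?leq_addr//=.
congr addn; rewrite -{1}[m]add0n [X in index_iota _ X]addnC big_addn addnK.
rewrite big_mkord -[RHS]ss.
have mN : (m %% n.+1 < n.+1)%N by rewrite ltn_mod.
rewrite [RHS](reindex_inj (addIr (Ordinal mN))) /=; apply: eq_bigr => i _.
congr (nat_of_ord (s _)); apply: ord_inj; rewrite inordK ?ltn_mod//=.
by rewrite modnDmr.
Qed.

Let rot_luk s k : s \in words ->
  reflect (forall i, (0 < i <= n)%N -> (height s k + i <= height s (k + i))%N)
    (rot_word k s \in luk_words n).
Proof.
move=> sw; have sumE i : (i <= n)%N ->
    (height s (k + i) = height s k + \sum_(j < n.+1 | (j < i)%N) rot_word k s j)%N.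
  move=> iN; rewrite /height (@big_cat_nat _ _ _ k) ?leq_addr//=; congr addn.
  rewrite -{1}[nat_of_ord k]add0n [X in index_iota _ X]addnC big_addn addnK big_mkord.
  rewrite (big_ord_widen _ (fun j => nat_of_ord (s (inord ((j + k) %% n.+1)))) (leqW iN)).
  apply: eq_bigr => j _; rewrite ffunE; congr (nat_of_ord (s _)).
  by apply: ord_inj; rewrite inordK ?ltn_mod.
rewrite inE (big_rot_word _ (@nat_of_ord _)).
have -> /= : (\sum_i s i == n :> nat)%N by move: sw; rewrite inE.
apply: (iffP forallP) => [H [|i] //= iN|H i].
  rewrite sumE // leq_add2l.
  by have := H (inord i); rewrite inordK ?iN//= ltnS ltnW.
by apply/implyP => iN; have := H i.+1 iN; rewrite sumE // leq_add2l.
Qed.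

Lemma cycle_lemma s : s \in words ->
  (\sum_k (rot_word k s \in luk_words n) = 1)%N.
Proof.
(* Up to a constant, [f] is the path with steps [s i - 1]; the good rotation starts at its first
   minimum. The key [f m * n.+1 + m] breaks ties in favour of the smallest index. *)
move=> sw; pose f m := (height s m + (n.+1 - m))%N.
case: (arg_minnP (fun m : 'I_n.+1 => (f m * n.+1 + m)%N) (erefl : xpredT (ord0 : 'I_n.+1))) =>
  k _ kmin.
have {kmin}kmin j : (j < n.+1)%N -> (f k <= f j)%N /\ ((j < k)%N -> (f k < f j)%N).
  move=> jN; have := kmin (Ordinal jN) isT => /= H; have := ltn_ord k.
  by split; [|move=> jk]; nia.
have kgood : rot_word k s \in luk_words n.
  apply/rot_luk => // i /andP[i0 iN]; have kN := ltn_ord k.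
  have [kiN|Nki] := ltnP (k + i) n.+1.
    have [+ _] := kmin _ kiN; rewrite /f; lia.
  (* Over one period of [n.+1] steps the height grows by [n] only; the strict inequality at the
     earlier index [j] makes up for the missing unit. *)
  have jk : (k + i - n.+1 < k)%N by lia.
  have [_ /(_ jk)] := kmin (k + i - n.+1)%N ltac:(lia).
  have := heightD (k + i - n.+1) sw; rewrite subnK // => ->; rewrite /f; lia.
(* Going from [k1] to [k2] and on to [k1 + n.+1], two good rotations would require a growth of at
   least [n.+1]. *)
have uniq k1 k2 : rot_word k1 s \in luk_words n -> rot_word k2 s \in luk_words n ->
    ~~ (k1 < k2)%N.
  move=> /(rot_luk _ sw) g1 /(rot_luk _ sw) g2; apply/negP => k12.
  have := g1 (k2 - k1)%N; have := g2 (k1 + n.+1 - k2)%N; have k2N := ltn_ord k2.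
  by rewrite !subnKC ?heightD //; lia.
rewrite (bigD1 k) //= kgood big1 ?addn0 // => j jk; apply/eqP; rewrite eqb0.
apply: contraNN jk => jgood; rewrite -val_eqE /= eqn_leq [X in X && _]leqNgt [X in _ && X]leqNgt.
by rewrite (uniq _ _ jgood kgood) (uniq _ _ kgood jgood).
Qed.

(** Double counting of pairs of a rotation and a word: the product is invariant under rotation, and
    each word with sum [n] has exactly one good rotation. *)
Lemma sum_luk_words (C : comPzRingType) (x : nat -> C) :
  n.+1%:R * (\sum_(s in luk_words n) \prod_i x (s i)) = \sum_(s in words) \prod_i x (s i).
Proof.
have subw s : s \in luk_words n -> s \in words by rewrite !inE => /andP[].
have rotw k s : (rot_word k s \in words) = (s \in words).
  by rewrite !inE (big_rot_word _ (@nat_of_ord _)).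
transitivity (\sum_(k < n.+1) \sum_(s in words) (rot_word k s \in luk_words n)%:R *
  \prod_i x (s i)).
  rewrite -[X in X%:R * _]card_ord -sum1_card natr_sum mulr_suml; apply: eq_bigr => k _.
  rewrite mul1r [LHS](reindex (rot_word k)) /=; last first.
    by exists (rot_word (- k)) => s _; rewrite ?rot_wordK ?rot_wordNK.
  rewrite big_mkcond [RHS]big_mkcond; apply: eq_bigr => s _.
  rewrite (big_rot_word _ (fun i : 'I_n.+1 => x i)).
  case: ifP => [/subw|]; first by rewrite rotw => ->; rewrite mul1r.
  by rewrite mul0r; case: ifP.
rewrite exchange_big; apply: eq_bigr => s sw /=.
by rewrite -mulr_suml -natr_sum cycle_lemma // mul1r.
Qed.

End cycle_lemma.

Lemma sum_comb_NC n (C : comPzRingType) (x : nat -> C) : x 0%N = 1 ->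
  n.+1%:R * (\sum_(P in comb_NC n) \prod_(B in P) x #|B|) = \sum_(s in words n) \prod_i x (s i).
Proof.
move=> x0; rewrite -sum_luk_words; congr (_ * _).
have -> : luk_words n = [set block_word P | P in comb_NC n]%SET.
  apply/setP => s; apply/idP/imsetP => [/block_word_onto[P PN <-]|[P]]; first by exists P.
  by rewrite inE => /andP[/block_word_luk + _] ->.
rewrite (big_imset _ (@block_word_inj n)); apply: eq_bigr => P.
rewrite inE => /andP[partP _]; rewrite (prod_block_min partP x0).
by apply: eq_bigr => j _; rewrite block_wordE.
Qed.

(** * Crossings of polygons *)

Section separation.
Variables (R : realType).
Local Notation plane := (R^o * R^o)%type.

Lemma conv_lmodE (M : lmodType R) (t : {i01 R}) (x y : convex_lmodType M) :
  conv t x y = (t%:num *: (x : M) + (1 - t%:num) *: (y : M) : M).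
Proof. by []. Qed.

Lemma convex_hull_sub (M : lmodType R) (S T : set M) :
  @convex_set R M T -> S `<=` T -> convex_hull S `<=` T.
Proof. by move=> cT ST x; apply. Qed.

Lemma convex_hull_conv (M : lmodType R) (S : set M) (t : R) (x y : M) :
  0 <= t <= 1 -> S x -> S y -> convex_hull S (t *: x + (1 - t) *: y).
Proof.
move=> /andP[t0 t1] Sx Sy T [cT ST].
have /set_mem := cT x y (Itv01 t0 t1) (mem_set (ST _ Sx)) (mem_set (ST _ Sy)).
by rewrite conv_lmodE.
Qed.

(** [P] stands for membership in a half-line, so that closed and open half-planes are treated
    together. *)
Lemma halfplane_convex (P : pred R) (a b : R) :
  (forall t x y : R, 0 <= t <= 1 -> P x -> P y -> P (t * x + (1 - t) * y)) ->
  @convex_set R plane [set v : plane | P (a * v.1 + b * v.2)].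
Proof.
move=> cP x y t; rewrite !inE => /= Px Py.
have := cP t%:num _ _ _ Px Py; have /andP[t0 t1] : 0 <= t%:num <= 1 by rewrite ge0 le1.
rewrite t0 t1 => /(_ isT); congr (is_true (P _)).
rewrite /GRing.scale /= /unstable.onem; ring.
Qed.

(** The separating line may touch the hull of [B]: only the inequality for [C] is strict. *)
Lemma hull_disjoint n (B C : {set 'I_n}) (a b c : R) :
  (forall i, i \in B -> c <= a * (ngon_vertex R i).1 + b * (ngon_vertex R i).2) ->
  (forall i, i \in C -> a * (ngon_vertex R i).1 + b * (ngon_vertex R i).2 < c) ->
  block_hull R B `&` block_hull R C = set0.
Proof.
move=> HB HC; apply/seteqP; split => // v [hB hC].
have /= H1 : [set v : plane | c <= a * v.1 + b * v.2] v.
  apply: (convex_hull_sub _ _ hB) => [|_ [i iB <-]]; last exact: HB.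
  apply: (@halfplane_convex (fun z => c <= z)) => t x y /andP[t0 t1] cx cy; nra.
have /= H2 : [set v : plane | a * v.1 + b * v.2 < c] v.
  apply: (convex_hull_sub _ _ hC) => [|_ [i iB <-]]; last exact: HC.
  apply: (@halfplane_convex (fun z => z < c)) => t x y /andP[t0 t1] cx cy.
  have [->|t_neq0] := eqVneq t 0; first by rewrite mul0r add0r subr0 mul1r.
  have {}t0 : 0 < t by rewrite lt_neqAle eq_sym t_neq0.
  nra.
by rewrite ltNge H1 in H2.
Qed.

(** With half angles all differences lie in (-pi, pi), so the sine of a difference has the sign of
    the difference of the indices. *)
Definition half_angle n (i : 'I_n) : R := pi * i%:R / n%:R.

Lemma ngon_vertexE n (i : 'I_n) :
  ngon_vertex R i = (cos (half_angle i *+ 2), - sin (half_angle i *+ 2)) :> plane.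
Proof.
by rewrite /ngon_vertex /half_angle -mulrnAl -mulrnAl -[pi *+ 2]mulr_natl.
Qed.

Lemma half_angle_sin_gt0 n (i j : 'I_n) : (i < j)%N -> 0 < sin (half_angle j - half_angle i).
Proof.
move=> ij; rewrite /half_angle -mulrBl -mulrBr -natrB ?(ltnW ij)//.
have n_gt0 : (0 < n)%N by exact: leq_ltn_trans (ltn_ord i).
have n0 : (0 : R) < n%:R by rewrite ltr0n.
apply: sin_gt0_pi; rewrite divr_gt0 ?mulr_gt0 ?pi_gt0 ?ltr0n ?subn_gt0//=.
rewrite ltr_pdivrMr// ltr_pM2l ?pi_gt0// ltr_nat.
exact: leq_ltn_trans (leq_subr _ _) (ltn_ord j).
Qed.

Lemma half_angle_sin_le0 n (i j : 'I_n) : (i <= j)%N -> sin (half_angle i - half_angle j) <= 0.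
Proof.
rewrite leq_eqVlt => /predU1P[/ord_inj ->|ij]; first by rewrite subrr sin0.
by rewrite -opprB sinN oppr_le0 ltW // half_angle_sin_gt0.
Qed.

Lemma half_angle_sin_ge0 n (i j : 'I_n) : (i <= j)%N -> 0 <= sin (half_angle j - half_angle i).
Proof. by move=> /half_angle_sin_le0; rewrite -opprB sinN oppr_le0. Qed.

(* The chord joining the vertices a and b is the zero set of this functional. *)
Lemma chord_functional n (a b i : 'I_n) :
  cos (half_angle a + half_angle b) * (ngon_vertex R i).1
    - sin (half_angle a + half_angle b) * (ngon_vertex R i).2
    - cos (half_angle b - half_angle a)
  = (sin (half_angle i - half_angle a) * sin (half_angle b - half_angle i)) *+ 2.
Proof.
rewrite ngon_vertexE /=.
set x := half_angle i; set y := half_angle a; set z := half_angle b.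
rewrite mulrN opprK [cos (y + z) * _]mulrC [sin (y + z) * _]mulrC -cosB.
have -> : x *+ 2 - (y + z) = (x - y) - (z - x) by rewrite mulr2n; ring.
have -> : z - y = (x - y) + (z - x) by ring.
rewrite (cosB (x - y)) (cosD (x - y)); ring.
Qed.

(** A chord between vertices of [B] separates the hulls. If [B] has points on both sides of a point
    [c0] of [C], the chord joins the nearest ones and [C] lies between them; otherwise it joins the
    extreme points of [B] and [C] lies outside. *)
Lemma noncrossing_of_comb n (P : {set {set 'I_n}}) :
  finset.partition P [set: 'I_n]%SET -> comb_noncrossing P -> noncrossing R P.
Proof.
move=> partP ncP B C BP CP BC.
have disj i : i \in B -> i \in C -> False.
  move=> iB iC; case/eqP: BC; have tP := finset.partition_trivIset partP.
  by rewrite -(finset.def_pblock tP BP iB) -(finset.def_pblock tP CP iC).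
have ne D : D \in P -> exists i, i \in D.
  move=> DP; apply/finset.set0Pn; apply: contraTneq DP => ->.
  by rewrite (finset.partition0 partP).
have [c0 c0C] := ne _ CP.
have CB : C != B by rewrite eq_sym.
have max_in (D : {set 'I_n}) (Q : pred nat) i0 : i0 \in D -> Q i0 ->
    exists i, [/\ i \in D, Q i & forall j, j \in D -> Q j -> (j <= i)%N].
  move=> i0D Qi0; have : (i0 \in D) && Q i0 by rewrite i0D.
  move=> /(@arg_maxnP _ i0 (fun i : 'I_n => (i \in D) && Q i) (@nat_of_ord n))[i /andP[iD Qi] H].
  by exists i; split=> // j jD Qj; apply: H; rewrite jD.
have min_in (D : {set 'I_n}) (Q : pred nat) i0 : i0 \in D -> Q i0 ->
    exists i, [/\ i \in D, Q i & forall j, j \in D -> Q j -> (i <= j)%N].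
  move=> i0D Qi0; have : (i0 \in D) && Q i0 by rewrite i0D.
  move=> /(@arg_minnP _ i0 (fun i : 'I_n => (i \in D) && Q i) (@nat_of_ord n))[i /andP[iD Qi] H].
  by exists i; split=> // j jD Qj; apply: H; rewrite jD.
have neqBC i j : i \in B -> j \in C -> (i : nat) != j.
  by move=> iB jC; apply/eqP => /ord_inj e; apply: (disj i); rewrite // e.
have sep (a b : 'I_n) : (a <= b)%N ->
    (forall i, i \in B -> (i <= a)%N \/ (b <= i)%N) ->
    (forall j, j \in C -> (a < j < b)%N) -> block_hull R B `&` block_hull R C = set0.
  move=> ab HB HC.
  apply: (@hull_disjoint _ _ _ (- cos (half_angle a + half_angle b))
    (sin (half_angle a + half_angle b)) (- cos (half_angle b - half_angle a))) => i iD;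
    have E := chord_functional a b i.
    suff : sin (half_angle i - half_angle a) * sin (half_angle b - half_angle i) <= 0 by lra.
    have [ia|bi] := HB i iD.
      by rewrite mulr_le0_ge0 ?half_angle_sin_le0 ?half_angle_sin_ge0 // (leq_trans ia).
    by rewrite mulr_ge0_le0 ?half_angle_sin_le0 ?half_angle_sin_ge0 // (leq_trans ab).
  have /andP[ai ib] := HC i iD.
  suff : 0 < sin (half_angle i - half_angle a) * sin (half_angle b - half_angle i) by lra.
  by rewrite mulr_gt0 ?half_angle_sin_gt0.
(* If [B] is a singleton, then [a = b] and the chord becomes the tangent to the circumscribed circle
   at that vertex. *)
have sep' (a b : 'I_n) : (forall i, i \in B -> (a <= i <= b)%N) ->
    (forall j, j \in C -> (j < a)%N \/ (b < j)%N) ->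
    (a <= b)%N -> block_hull R B `&` block_hull R C = set0.
  move=> HB HC ab.
  apply: (@hull_disjoint _ _ _ (cos (half_angle a + half_angle b))
    (- sin (half_angle a + half_angle b)) (cos (half_angle b - half_angle a))) => i iD;
    have E := chord_functional a b i.
    have /andP[ai ib] := HB i iD.
    suff : 0 <= sin (half_angle i - half_angle a) * sin (half_angle b - half_angle i) by lra.
    by rewrite mulr_ge0 ?half_angle_sin_ge0.
  suff : sin (half_angle i - half_angle a) * sin (half_angle b - half_angle i) < 0 by lra.
  have [ia|bi] := HC i iD.
    rewrite -opprB sinN mulNr oppr_lt0 mulr_gt0 ?half_angle_sin_gt0 //.
    exact: leq_trans ab.
  rewrite -[half_angle b - _]opprB sinN mulrN oppr_lt0 mulr_gt0 ?half_angle_sin_gt0 //.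
  exact: leq_ltn_trans bi.
have [[a1 a1B a1c]|nolow] := pselect (exists2 a : 'I_n, a \in B & (a < c0)%N);
  have [[b1 b1B b1c]|noup] := pselect (exists2 b : 'I_n, b \in B & (c0 < b)%N).
- have [a [aB ac amax]] := max_in B (fun i => i < c0)%N a1 a1B a1c.
  have [b [bB bc bmin]] := min_in B (fun i => c0 < i)%N b1 b1B b1c.
  apply: (sep a b (ltnW (ltn_trans ac bc))) => [i iB|j jC].
    case: (ltngtP i c0) => [ic|ci|/ord_inj e]; first by left; exact: amax.
      by right; exact: bmin.
    by case: (disj c0) => //; rewrite -e.
  rewrite !ltnNge; apply/andP; split; apply/negP => le_j.
    have ja : (j < a)%N by rewrite ltn_neqAle le_j andbT eq_sym (neqBC _ _ aB jC).
    by case/eqP: CB; exact: (ncP C B j a c0 b).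
  have bj : (b < j)%N by rewrite ltn_neqAle le_j (neqBC _ _ bB jC).
  by case/eqP: BC; exact: (ncP B C a c0 b j).
all: have [i1 i1B] := ne _ BP.
all: have [a [aB _ amin]] := min_in B xpredT i1 i1B isT.
all: have [b [bB _ bmax]] := max_in B xpredT i1 i1B isT.
all: apply: (sep' a b) => [i iB|j jC|]; rewrite ?amin ?bmax //.
all: have [aj|] := leqP a j; last by left.
all: have [jb|] := leqP j b; last by right.
all: have {}aj : (a < j)%N by rewrite ltn_neqAle aj (neqBC _ _ aB jC).
all: have {}jb : (j < b)%N by rewrite ltn_neqAle jb eq_sym (neqBC _ _ bB jC).
- case/eqP: BC; apply: (ncP B C a j b c0) => //.
  by case: (ltngtP b c0) (neqBC _ _ bB c0C) => // cb _; case: noup; exists b.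
- case/eqP: CB; apply: (ncP C B c0 a j b) => //.
  by case: (ltngtP a c0) (neqBC _ _ aB c0C) => // ac _; case: nolow; exists a.
- case: (ltngtP a c0) (neqBC _ _ aB c0C) => // ac _; first by case: nolow; exists a.
  by case: noup; exists a.
Qed.

(** Twice the area of the triangle, with the sign that makes it positive for increasing indices in
    clockwise order. *)
Lemma signed_area n (i j k : 'I_n) :
  ((ngon_vertex R k).1 - (ngon_vertex R i).1) * ((ngon_vertex R j).2 - (ngon_vertex R i).2)
  - ((ngon_vertex R j).1 - (ngon_vertex R i).1) * ((ngon_vertex R k).2 - (ngon_vertex R i).2)
  = (sin (half_angle j - half_angle i) * sin (half_angle k - half_angle i)
    * sin (half_angle k - half_angle j)) *+ 4.
Proof.
rewrite !ngon_vertexE /=.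
set x := half_angle i; set y := half_angle j; set z := half_angle k.
have dcos (u v : R) : cos (u *+ 2) - cos (v *+ 2) = - (sin (u + v) * sin (u - v) *+ 2).
  have -> : u *+ 2 = (u + v) + (u - v) by rewrite mulr2n; ring.
  have -> : v *+ 2 = (u + v) - (u - v) by rewrite mulr2n; ring.
  rewrite (cosB (u + v)) (cosD (u + v)); ring.
have dsin (u v : R) : - sin (u *+ 2) - - sin (v *+ 2) = - (cos (u + v) * sin (u - v) *+ 2).
  have -> : u *+ 2 = (u + v) + (u - v) by rewrite mulr2n; ring.
  have -> : v *+ 2 = (u + v) - (u - v) by rewrite mulr2n; ring.
  rewrite (sinB (u + v)) (sinD (u + v)); ring.
rewrite !dcos !dsin.
have -> : z - y = (z + x) - (y + x) by ring.
rewrite [X in _ = _ * X *+ 4]sinB; ring.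
Qed.

(** The diagonals of a convex quadrilateral meet. In the barycentric coordinates of the common point
    along a diagonal, each endpoint is weighted by the area of the triangle of the other three
    vertices. *)
Lemma noncrossing_comb n (P : {set {set 'I_n}}) :
  noncrossing R P -> comb_noncrossing P.
Proof.
move=> ncP B C a b c d BP CP aB cB bC dC ab bc cd; apply/eqP/negPn/negP => BC.
have {}ncP := ncP B C BP CP BC.
pose area (i j k : 'I_n) : R :=
  ((ngon_vertex R k).1 - (ngon_vertex R i).1) * ((ngon_vertex R j).2 - (ngon_vertex R i).2)
  - ((ngon_vertex R j).1 - (ngon_vertex R i).1) * ((ngon_vertex R k).2 - (ngon_vertex R i).2).
have area_gt0 (i j k : 'I_n) : (i < j)%N -> (j < k)%N -> 0 < area i j k.
  move=> ij jk; rewrite /area signed_area pmulrn_lgt0 //.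
  by rewrite !mulr_gt0 ?half_angle_sin_gt0 // (ltn_trans ij).
have bcd := area_gt0 b c d bc cd; have abd := area_gt0 a b d ab (ltn_trans bc cd).
have acd := area_gt0 a c d (ltn_trans ab bc) cd; have abc := area_gt0 a b c ab bc.
have frac (x y : R) : 0 < x -> 0 < y -> 0 <= x / (x + y) <= 1.
  move=> x0 y0; have s0 : 0 < x + y by rewrite addr_gt0.
  by rewrite divr_ge0 ?(ltW x0) ?(ltW s0)//= ler_pdivrMr// mul1r lerDl ltW.
have compl (x y : R) : 0 < x -> 0 < y -> 1 - x / (x + y) = y / (x + y).
  by move=> x0 y0; field; rewrite gt_eqF // addr_gt0.
have hB : block_hull R B ((area b c d / (area b c d + area a b d)) *: ngon_vertex R a
    + (1 - area b c d / (area b c d + area a b d)) *: ngon_vertex R c).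
  by apply: convex_hull_conv; [exact: frac | exists a | exists c].
have hC : block_hull R C ((area a c d / (area a c d + area a b c)) *: ngon_vertex R b
    + (1 - area a c d / (area a c d + area a b c)) *: ngon_vertex R d).
  by apply: convex_hull_conv; [exact: frac | exists b | exists d].
suff E : (area b c d / (area b c d + area a b d)) *: ngon_vertex R a
    + (1 - area b c d / (area b c d + area a b d)) *: ngon_vertex R c =
  (area a c d / (area a c d + area a b c)) *: ngon_vertex R b
    + (1 - area a c d / (area a c d + area a b c)) *: ngon_vertex R d.
  by rewrite -E in hC; move/seteqP: ncP => -[/(_ _ (conj hB hC))].
(* Either diagonal cuts the quadrilateral into two triangles, so the total weights agree. *)
have Es : area b c d + area a b d = area a c d + area a b c by rewrite /area; ring.
rewrite !compl // Es.
have nz : area a c d + area a b c != 0 by rewrite gt_eqF // addr_gt0.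
have key (f : plane -> R) : (f = fst \/ f = snd) ->
  area b c d / (area a c d + area a b c) * f (ngon_vertex R a) +
  area a b d / (area a c d + area a b c) * f (ngon_vertex R c) =
  area a c d / (area a c d + area a b c) * f (ngon_vertex R b) +
  area a b c / (area a c d + area a b c) * f (ngon_vertex R d).
  move=> fE; rewrite -![_ / _ * _]mulrAC -!mulrDl; congr (_ / _).
  by rewrite /area; case: fE => ->; ring.
by apply/pair_equal_spec; split; [exact: (key fst (or_introl erefl))|exact: (key snd (or_intror
  erefl))].
Qed.

Lemma NC_comb n : NC R n = comb_NC n.
Proof.
apply/setP => P; rewrite !inE; case partP : (finset.partition _ _) => //=.
apply/asboolP/asboolP => [|]; first exact: noncrossing_comb.
exact: noncrossing_of_comb.
Qed.

End separation.

(** * Trigonometric estimates *)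

Section trig_bounds.
Variable R : realType.
Implicit Types x y : R.

Lemma ge0_from_derive (f f' : R -> R) x : f 0 = 0 ->
  (forall y : R, is_derive y (1 : R) f (f' y)) -> (forall y, 0 <= y -> 0 <= f' y) ->
  0 <= x -> 0 <= f x.
Proof.
move=> f0 df f'0; rewrite le_eqVlt => /predU1P[<-|x0]; first by rewrite f0.
have [|c /itvP cx E] := @MVT R f f' 0 x x0 (fun y _ => df y).
  by apply: derivable_within_continuous => y _; exact: ex_derive.
by move: E; rewrite f0 !subr0 => ->; rewrite mulr_ge0 ?f'0 ?cx ?ltW.
Qed.

Lemma sin_le_id x : 0 <= x -> sin x <= x.
Proof.
move=> x0; rewrite -subr_ge0.
apply: (@ge0_from_derive (fun y => y - sin y) (fun y => 1 - cos y)) => [|y _|//].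
  by rewrite sin0 subr0.
by rewrite subr_ge0 cos_le1.
Qed.

Lemma cos_ge_quad x : 1 - x ^+ 2 / 2 <= cos x.
Proof.
wlog x0 : x / 0 <= x.
  move=> H; have [/H//|x0] := leP 0 x.
  by rewrite -cosN -sqrrN H // oppr_ge0 ltW.
rewrite -subr_ge0.
apply: (@ge0_from_derive (fun y => cos y - (1 - y ^+ 2 / 2)) (fun y => y - sin y)) => // [|y|y y0].
- by rewrite cos0 expr0n /= mul0r subr0 subrr.
- apply: is_derive_eq; rewrite /GRing.scale /=; lra.
- by rewrite subr_ge0 sin_le_id.
Qed.

Lemma sin_ge_cubic x : 0 <= x -> x - x ^+ 3 / 6 <= sin x.
Proof.
move=> x0; rewrite -subr_ge0.
apply: (@ge0_from_derive (fun y => sin y - (y - y ^+ 3 / 6)) (fun y =>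
  cos y - (1 - y ^+ 2 / 2))) => // [|y|y y0].
- by rewrite sin0 expr0n /= mul0r subr0 subrr.
- apply: is_derive_eq; rewrite /GRing.scale /=; lra.
- by rewrite subr_ge0 cos_ge_quad.
Qed.

Lemma cos_le_quartic x : cos x <= 1 - x ^+ 2 / 2 + x ^+ 4 / 24.
Proof.
wlog x0 : x / 0 <= x.
  move=> H; have [/H//|x0] := leP 0 x.
  rewrite -cosN -(sqrrN x) (_ : x ^+ 4 = (- x) ^+ 4); last by rewrite exprNn; ring.
  by rewrite H // oppr_ge0 ltW.
rewrite -subr_ge0.
apply: (@ge0_from_derive (fun y => 1 - y ^+ 2 / 2 + y ^+ 4 / 24 - cos y) (fun y =>
  sin y - (y - y ^+ 3 / 6))) => // [|y|y y0].
- by rewrite cos0 !expr0n /= !mul0r subr0 addr0 subrr.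
- apply: is_derive_eq; rewrite /GRing.scale /=; lra.
- by rewrite subr_ge0 sin_ge_cubic.
Qed.

Lemma sin_dist_id x : `|sin x - x| <= `|x| ^+ 3 / 6.
Proof.
wlog x0 : x / 0 <= x.
  move=> H; have [/H//|x0] := leP 0 x.
  rewrite -normrN -(normrN x) opprB addrC -[X in X + _]opprK -(sinN x) opprK.
  by rewrite [X in `|X|](_ : _ = sin (- x) - (- x)) ?H ?oppr_ge0 ?ltW //; ring.
rewrite (ger0_norm x0) ler_norml.
by have := sin_le_id x0; have := sin_ge_cubic x0; have := exprn_ge0 3 x0; lra.
Qed.

(** A quadratic bound, valid for all [x], is what a finite variance can dominate; the cubic one
    gives the pointwise limit. *)
Lemma sin_dist_id_sqr x : `|sin x - x| <= x ^+ 2.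
Proof.
have [x6|x6] := leP `|x| 6.
  apply: le_trans (sin_dist_id x) _.
  rewrite -(real_normK (num_real x)); have := normr_ge0 x; nra.
apply: le_trans (ler_normB _ _) _; rewrite -(real_normK (num_real x)).
have := sin_max x; nra.
Qed.

Lemma sin_norm_le x : `|sin x| <= `|x|.
Proof.
wlog x0 : x / 0 <= x.
  by move=> H; have [/H//|x0] := leP 0 x; rewrite -normrN -sinN -(normrN x) H ?oppr_ge0 ?ltW.
rewrite (ger0_norm x0) ler_norml sin_le_id // andbT.
have [x1|x1] := leP x 1; last by apply: le_trans (sin_geN1 x); rewrite lerN2 ltW.
by have := sin_ge_cubic x0; nra.
Qed.

(** Since [x <= pi / 2 <= 2], the cubic bound leaves at least [x - 4 * x / 6]. *)
Lemma jordan_sin x : 0 <= x <= pi / 2 -> x / 3 <= sin x.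
Proof.
move=> /andP[x0 x1]; have [/andP[_ p2] _] := @pihalf_02_cos_pihalf R.
apply: le_trans (sin_ge_cubic x0); nra.
Qed.

Lemma cosE_half x : 1 - cos x = 2 * sin (x / 2) ^+ 2.
Proof.
rewrite {1}(_ : x = (x / 2) *+ 2); last by rewrite mulr2n; lra.
by rewrite cos_mulr2n cos2sin2; ring.
Qed.

Lemma sin_sqr_le_add x y : sin (x + y) ^+ 2 <= 2 * sin x ^+ 2 + 2 * sin y ^+ 2.
Proof.
rewrite sinD; have := cos2Dsin2 x; have := cos2Dsin2 y.
set a := sin x; set b := cos x; set c := sin y; set e := cos y => h1 h2.
have : (a * e + b * c) ^+ 2 + (a * e - b * c) ^+ 2 = 2 * (a ^+ 2 * e ^+ 2) +
  2 * (b ^+ 2 * c ^+ 2) by ring.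
have -> : e ^+ 2 = 1 - c ^+ 2 by lra.
have -> : b ^+ 2 = 1 - a ^+ 2 by lra.
have := sqr_ge0 (a * e - b * c); have := mulr_ge0 (sqr_ge0 a) (sqr_ge0 c); lra.
Qed.

(** Separates the lattice part [x] of a phase from a perturbation [y], through
    [1 - cos x = 2 * sin (x / 2) ^+ 2] and the quasi-subadditivity of the squared sine. *)
Lemma cos_shift_lower x y : (1 - cos x) / 2 - y ^+ 2 / 2 <= 1 - cos (x + y).
Proof.
have := sin_sqr_le_add ((x + y) / 2) (- (y / 2)).
rewrite (_ : (x + y) / 2 - y / 2 = x / 2); last by lra.
rewrite sinN sqrrN; have := cosE_half x; have := cosE_half (x + y); have := cosE_half y.
have := cos_ge_quad y; lra.
Qed.

Lemma sin_sqr_mul x (m : nat) : sin (m%:R * x) ^+ 2 <= (4 ^+ m) * sin x ^+ 2.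
Proof.
elim: m => [|m IH]; first by rewrite mul0r sin0 expr0n /= mulr_ge0 ?sqr_ge0.
rewrite -natr1 mulrDl mul1r; apply: le_trans (sin_sqr_le_add _ _) _.
have : 1 <= 4 ^+ m :> R by apply: exprn_ege1; lra.
move=> /(ler_wpM2r (sqr_ge0 (sin x))); rewrite mul1r (exprS 4) -mulrA; lra.
Qed.

End trig_bounds.

(** * The span of the support *)

Section lattice.
Variables (R : realType) (q : nat -> R).
Hypothesis q_ge0 : forall r, 0 <= q r.

Let dominated (m : nat) := exists M (K : R), 0 <= K /\
  forall t, sin (m%:R * t) ^+ 2 <= K * \sum_(r < M) q r * sin (r%:R * t) ^+ 2.

Let sum_mono M M' t : (M <= M')%N ->
  \sum_(r < M) q r * sin (r%:R * t) ^+ 2 <= \sum_(r < M') q r * sin (r%:R * t) ^+ 2.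
Proof.
move=> MM'; rewrite -!(big_mkord xpredT (fun r => q r * sin (r%:R * t) ^+ 2)).
rewrite [leRHS](@big_cat_nat _ _ _ M) //= lerDl; apply: sumr_ge0 => i _.
by rewrite mulr_ge0 // sqr_ge0.
Qed.

(* The span of the support is a Bezout combination of support points, so the
   inequality |sin(x + y)|^2 <= 2 |sin x|^2 + 2 |sin y|^2 transfers to it. *)
Lemma support_span r0 : (0 < r0)%N -> q r0 != 0 ->
  exists h M (K : R), [/\ (0 < h)%N, 0 <= K, forall r, q r != 0 -> (h %| r)%N &
    forall t, sin (h%:R * t) ^+ 2 <= K * \sum_(r < M) q r * sin (r%:R * t) ^+ 2].
Proof.
move=> r0_gt0 qr0.
have dom_supp r : q r != 0 -> dominated r.
  move=> qr; have qr_gt0 : 0 < q r by rewrite lt_neqAle eq_sym qr q_ge0.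
  exists r.+1, (q r)^-1; split; first by rewrite invr_ge0 ltW.
  move=> t; rewrite ler_pdivlMl // big_ord_recr /= lerDr.
  by apply: sumr_ge0 => i _; rewrite mulr_ge0 // sqr_ge0.
have ex_dom : exists m, (0 < m)%N && `[< dominated m >].
  by exists r0; rewrite r0_gt0; apply/asboolP; exact: dom_supp.
(* [h] is the least positive dominated multiplier. The remainder of a support point modulo [h] is
   dominated as well, so by minimality it is 0. *)
have [h /andP[h0 /asboolP [M [K [K0 HK]]]] hmin] := ex_minnP ex_dom.
exists h, M, K; split=> // r qr.
rewrite /dvdn; apply/negPn/negP => rh.
suff : dominated (r %% h)%N.
  move=> /asboolP dh; have := hmin (r %% h)%N; rewrite dh andbT lt0n rh => /(_ isT).
  by rewrite leqNgt ltn_mod h0.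
have [M' [K' [K'0 HK']]] := dom_supp r qr.
exists (maxn M M'), (2 * K' + 2 * (4 ^+ (r %/ h) * K)); split.
  by rewrite addr_ge0 ?mulr_ge0 ?exprn_ge0.
move=> t; have -> : (r %% h)%:R * t = r%:R * t + - ((r %/ h)%:R * (h%:R * t)).
  by rewrite {2}(divn_eq r h) natrD natrM; ring.
apply: le_trans (sin_sqr_le_add _ _) _; rewrite sinN sqrrN [leRHS]mulrDl.
apply: lerD; rewrite -[leRHS]mulrA ler_wpM2l //.
  by apply: le_trans (HK' t) _; rewrite ler_wpM2l // sum_mono // leq_maxr.
apply: le_trans (sin_sqr_mul _ _) _; rewrite -[leRHS]mulrA ler_wpM2l ?exprn_ge0 //.
by apply: le_trans (HK t) _; rewrite ler_wpM2l // sum_mono // leq_maxl.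
Qed.

End lattice.

(** * Fourier inversion *)

Section cis.
Variable R : realType.
Implicit Types (x y : R) (z w : R[i]).
Local Notation Re := (@complex.Re R).
Local Notation Im := (@complex.Im R).
Local Notation normc := (@Normc.normc R).
Local Notation "x %:C" := (real_complex R x).

Definition cis x : R[i] := Complex (cos x) (sin x).

Lemma cis0 : cis 0 = 1.
Proof. by rewrite /cis cos0 sin0. Qed.

Lemma cisD x y : cis (x + y) = cis x * cis y.
Proof. by apply/eqP; rewrite eq_complex /= cosD sinD; apply/andP; split; apply/eqP; ring. Qed.

Lemma normc_cis x : normc (cis x) = 1.
Proof. by rewrite /= cos2Dsin2 sqrtr1. Qed.

Lemma cis_sum (I : Type) (s : seq I) (P : pred I) (f : I -> R) :
  cis (\sum_(i <- s | P i) f i) = \prod_(i <- s | P i) cis (f i).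
Proof. by elim/big_rec2: _ => [|i z x _ <-]; rewrite ?cis0 ?cisD. Qed.

Lemma Re_scale x z : Re (x%:C * z) = x * Re z.
Proof. by case: z => a b /=; rewrite mul0r subr0. Qed.

Lemma Im_scale x z : Im (x%:C * z) = x * Im z.
Proof. by case: z => a b /=; rewrite mul0r addr0. Qed.

Lemma ReD z w : Re (z + w) = Re z + Re w.
Proof. by case: z => ? ?; case: w. Qed.

Lemma ImD z w : Im (z + w) = Im z + Im w.
Proof. by case: z => ? ?; case: w. Qed.

Lemma Re_sum (I : Type) (s : seq I) (P : pred I) (f : I -> R[i]) :
  Re (\sum_(i <- s | P i) f i) = \sum_(i <- s | P i) Re (f i).
Proof. exact: (big_morph Re ReD). Qed.

Lemma Im_sum (I : Type) (s : seq I) (P : pred I) (f : I -> R[i]) :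
  Im (\sum_(i <- s | P i) f i) = \sum_(i <- s | P i) Im (f i).
Proof. exact: (big_morph Im ImD). Qed.

Lemma normcD_le z w : normc (z + w) <= normc z + normc w.
Proof. exact: le_normcD. Qed.

Lemma normc_ge0 z : 0 <= normc z.
Proof. by case: z => a b; exact: sqrtr_ge0. Qed.

Lemma normc_sqr z : normc z ^+ 2 = Re z ^+ 2 + Im z ^+ 2.
Proof. by case: z => a b /=; rewrite sqr_sqrtr // addr_ge0 ?sqr_ge0. Qed.

Lemma normcXn z m : normc (z ^+ m) = normc z ^+ m.
Proof.
elim: m => [|m IH]; first by rewrite !expr0 Normc.normc1.
by rewrite !exprS Normc.normcM IH.
Qed.

Lemma Re_le_normc z : `|Re z| <= normc z.
Proof.
case: z => a b /=; rewrite -sqrtr_sqr ler_wsqrtr // lerDl; exact: sqr_ge0.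
Qed.

Lemma normc_le_ReIm z : normc z <= `|Re z| + `|Im z|.
Proof.
rewrite -(@ler_pXn2r _ 2) ?nnegrE ?normc_ge0 ?addr_ge0 //.
rewrite normc_sqr sqrrD !real_normK ?num_real // lerD2r lerDl.
by rewrite mulrn_wge0 // mulr_ge0.
Qed.

Lemma normc_real x : normc x%:C = `|x|.
Proof. by rewrite /= expr0n /= addr0 sqrtr_sqr. Qed.

Lemma normc_exp_dist z w m : normc z <= 1 -> normc w <= 1 ->
  normc (z ^+ m - w ^+ m) <= m%:R * normc (z - w).
Proof.
move=> z1 w1; elim: m => [|m IH]; first by rewrite subrr mul0r Normc.normc0.
have -> : z ^+ m.+1 - w ^+ m.+1 = z * (z ^+ m - w ^+ m) + (z - w) * w ^+ m.
  by rewrite !exprS; ring.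
apply: le_trans (normcD_le _ _) _; rewrite !Normc.normcM -natr1 mulrDl mul1r.
apply: lerD.
  by apply: le_trans IH; rewrite ler_piMl ?normc_ge0.
by rewrite ler_piMr ?normc_ge0 // normcXn exprn_ile1 ?normc_ge0.
Qed.

Lemma normc_sum_le (I : Type) (s : seq I) (P : pred I) (f : I -> R[i]) :
  normc (\sum_(i <- s | P i) f i) <= \sum_(i <- s | P i) normc (f i).
Proof.
elim/big_rec2: _ => [|i x z _ le]; first by rewrite Normc.normc0.
by apply: le_trans (normcD_le _ _) _; rewrite lerD2l.
Qed.

Lemma continuous_cos_affine (c m : R) : continuous (fun u : R => cos (c + m * u)).
Proof.
move=> u; apply: (@continuous_comp _ _ _ (fun u : R => c + m * u) cos).
  by apply: continuousD; [exact: cst_continuous | apply: continuousM; [exact: cst_continuous|]].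
exact: continuous_cos.
Qed.

Lemma integrable_cos_affine (c m L : R) :
  lebesgue_measure.-integrable `[-L, L] (EFin \o (fun u : R => cos (c + m * u))).
Proof.
apply: continuous_compact_integrable; first exact: segment_compact.
by apply: continuous_subspaceT => u; exact: continuous_cos_affine.
Qed.

Lemma integral_cos_affine (c m L : R) : 0 < L -> m != 0 ->
  \int[lebesgue_measure]_(u in `[-L, L]) cos (c + m * u) =
  m^-1 * (sin (c + m * L) - sin (c - m * L)).
Proof.
move=> L0 m0; have LL : - L < L by lra.
have df (u : R) : is_derive u (1 : R) (fun u => m^-1 * sin (c + m * u)) (cos (c + m * u)).
  apply: is_derive_eq; rewrite /GRing.scale /=; field.
  exact: m0.
rewrite /Rintegral (@continuous_FTC2 _ _ (fun u => m^-1 * sin (c + m * u))) //.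
- by rewrite -EFinB /= mulrN mulrBr.
- by apply: continuous_subspaceT => u; exact: continuous_cos_affine.
- have cF : continuous (fun u : R => m^-1 * sin (c + m * u)).
    by move=> u; apply: differentiable_continuous; apply/derivable1_diffP; exact: ex_derive.
  split.
  + by move=> u _; exact: ex_derive.
  + by apply: cvg_at_right_filter; exact: cF.
  + by apply: cvg_at_left_filter; exact: cF.
- by move=> u _; rewrite derive1E; exact: derive_val.
Qed.

Lemma sin_natpi m : sin (m%:R * pi) = 0 :> R.
Proof.
elim: m => [|m IH]; first by rewrite mul0r sin0.
by rewrite -natr1 mulrDl mul1r sinD IH sinpi; ring.
Qed.

Lemma integrable_sumR d (T : measurableType d) (mu : {measure set T -> \bar R})
    (I : Type) (s : seq I) (P : pred I) (f : I -> T -> R) (D : set T) :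
  measurable D -> (forall i, mu.-integrable D (EFin \o f i)) ->
  mu.-integrable D (EFin \o (fun u => \sum_(i <- s | P i) f i u)).
Proof.
move=> mD fi.
rewrite (_ : _ \o _ = (fun u => \sum_(i <- s | P i) (f i u)%:E)%E).
  by apply: integrable_sum => // i _; exact: fi.
by apply/funext => u /=; rewrite sumEFin.
Qed.

Lemma Rintegral_sum d (T : measurableType d) (mu : {measure set T -> \bar R})
    (I : Type) (s : seq I) (P : pred I) (f : I -> T -> R) (D : set T) :
  measurable D -> (forall i, mu.-integrable D (EFin \o f i)) ->
  \int[mu]_(u in D) (\sum_(i <- s | P i) f i u) =
  \sum_(i <- s | P i) \int[mu]_(u in D) f i u.
Proof.
move=> mD fi; elim: s => [|i s IH].
  rewrite big_nil (@eq_Rintegral _ _ _ mu _ (cst 0)) => [|u _]; last by rewrite big_nil.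
  by rewrite Rintegral_cst // mul0r.
rewrite big_cons; case: ifP => Pi.
  rewrite (@eq_Rintegral _ _ _ mu _ (fun u => f i u + \sum_(j <- s | P j) f j u)) => [|u _].
    by rewrite RintegralD // ?IH //; exact: integrable_sumR.
  by rewrite big_cons Pi.
rewrite (@eq_Rintegral _ _ _ mu _ (fun u => \sum_(j <- s | P j) f j u)) ?IH // => u _.
by rewrite big_cons Pi.
Qed.

Section fourier.
Variables (q tau : nat -> R) (n : nat) (k b : R).
Implicit Types s : {ffun 'I_n.+1 -> 'I_n.+1}.

Let S s := (\sum_i s i)%N.
Let W s := \prod_i q (s i).
Let T s := b + \sum_i tau (s i).
Let M s := ((S s)%:R - n%:R) / k.

Let prodE s (g : 'I_n.+1 -> R) :
  \prod_i ((q (s i))%:C * cis (g i)) = (W s)%:C * cis (\sum_i g i).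
Proof. by rewrite big_split /= -cis_sum /W rmorph_prod. Qed.

(** The [n.+1] increments add up to [S s - n.+1]; the factor [cis (u / k)] restores [S s - n], the
    frequency that must vanish. *)
Lemma charfun_pow_expand (u : R) : k != 0 ->
  Re (cis b * (\sum_(r < n.+1) (q r)%:C * cis (tau r + u / k * (r%:R - 1))) ^+ n.+1
    * cis (u / k)) = \sum_s W s * cos (T s + M s * u).
Proof.
move=> k0; rewrite -[X in _ ^+ X]card_ord -prodr_const bigA_distr_bigA mulr_sumr mulr_suml Re_sum.
apply: eq_bigr => s _; rewrite (prodE s (fun i => tau (s i) + u / k * ((s i)%:R - 1))).
rewrite mulrCA -mulrA Re_scale -!cisD; congr (_ * cos _).
rewrite big_split /= -mulr_sumr sumrB sumr_const card_ord /T /M /S natr_sum.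
by rewrite -[X in _ - X]natr1; field.
Qed.

(** Orthogonality of characters: [n] and the sums [S s] of words of nonzero weight are multiples of
    [h], so the interval is a whole number of periods for each nonzero frequency. *)
Lemma fourier_inversion (h : nat) : (0 < h)%N -> 0 < k ->
  (forall r, q r != 0 -> (h %| r)%N) -> (h %| n)%N ->
  \int[lebesgue_measure]_(u in `[-(pi * k / h%:R), pi * k / h%:R])
    Re (cis b * (\sum_(r < n.+1) (q r)%:C * cis (tau r + u / k * (r%:R - 1))) ^+ n.+1
        * cis (u / k)) =
  2 * (pi * k / h%:R) *
    Re (cis b * \sum_(s in words n) \prod_i ((q (s i))%:C * cis (tau (s i)))).
Proof.
move=> h0 k0 hq /dvdnP[n' nE]; set L := pi * k / h%:R.
have h0R : (0 : R) < h%:R by rewrite ltr0n.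
have L0 : 0 < L by rewrite divr_gt0 // mulr_gt0 // pi_gt0.
rewrite (@eq_Rintegral _ _ _ lebesgue_measure _ (fun u =>
  \sum_s W s * cos (T s + M s * u))); last first.
  by move=> u _; rewrite charfun_pow_expand // gt_eqF.
rewrite Rintegral_sum //; last first.
  move=> s; rewrite (_ : _ \o _ = (fun u => (W s)%:E * (cos (T s + M s * u))%:E)%E) //.
  by apply: integrableZl => //; exact: integrable_cos_affine.
rewrite mulr_sumr Re_sum mulr_sumr [RHS]big_mkcond /=; apply: eq_bigr => s _.
rewrite (prodE s (fun i => tau (s i))) [cis b * _]mulrCA -cisD Re_scale /= -/(T s).
rewrite RintegralZl //; last exact: integrable_cos_affine.
rewrite inE -/(S s); case: eqP => [Sn|/eqP Sn].
  rewrite (@eq_Rintegral _ _ _ lebesgue_measure _ (cst (cos (T s)))) => [|u _]; last first.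
    by rewrite /M Sn subrr mul0r mul0r addr0.
  rewrite Rintegral_cst //= lebesgue_measure_itv /= lte_fin.
  rewrite ifT; last lra.
  by rewrite -EFinB /=; ring.
have [->|Ws] := eqVneq (W s) 0; first by rewrite mul0r.
have /dvdnP[a aE] : (h %| S s)%N.
  apply: dvdn_sum => i _; apply: hq; apply: contraNneq Ws => qi.
  by rewrite /W (bigD1 i) //= qi mul0r.
have M0 : M s != 0.
  by rewrite /M mulf_neq0 ?invr_eq0 ?(gt_eqF k0) // subr_eq0 eqr_nat.
have sML : sin (M s * L) = 0.
  rewrite /M aE {1}nE !natrM (_ : _ * L = a%:R * pi - n'%:R * pi).
    by rewrite sinB !sin_natpi; ring.
  by rewrite /L; field; rewrite !gt_eqF.
by rewrite integral_cos_affine // sinD sinB sML; ring.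
Qed.

End fourier.

End cis.

(** * Limits and dominated convergence for real integrals *)

Section limits.
Variable R : realType.

Lemma le_cvg0 (u v : nat -> R) (F : set_system nat) {FF : Filter F} :
  (\forall n \near F, `|u n| <= v n) -> v n @[n --> F] --> 0 -> u n @[n --> F] --> 0.
Proof.
move=> uv v0; apply: norm_cvg0; apply: (@squeeze_cvgr _ _ _ _ (cst 0) v _ _ 0 _ v0).
  by near do rewrite normr_ge0 /=.
exact: cvg_cst.
Unshelve. all: by end_near. Qed.

Lemma cvg_of_sqrt_bound (u : nat -> R) (l C : R) :
  (forall n, (0 < n)%N -> `|u n - l| <= C / Num.sqrt n%:R) -> u n @[n --> \oo] --> l.
Proof.
move=> H; apply/subr_cvg0.
have C0 : 0 <= C by have := H 1%N isT; rewrite sqrtr1 divr1; apply: le_trans.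
(* [harmonic n] is [1 / (n + 1)], and [1 / n <= 2 / (n + 1)]. *)
apply: (@le_cvg0 _ (fun n => (C * Num.sqrt 2) * Num.sqrt (harmonic n))).
  exists 1%N => // n /= n1; apply: le_trans (H n n1) _.
  rewrite -mulrA ler_wpM2l // -sqrtrV // -sqrtrM // ler_wsqrtr //.
  rewrite /harmonic /= -[leLHS]mul1r ler_pdivrMr ?ltr0n // mulrAC.
  by rewrite ler_pdivlMr ?ltr0n // mul1r -natrM ler_nat; lia.
rewrite -(mulr0 (C * Num.sqrt 2)); apply: cvgMr; rewrite -[in X in _ --> X](sqrtr0 R).
apply: (@cvg_comp _ _ _ harmonic Num.sqrt); first exact: cvg_harmonic.
exact: sqrt_continuous.
Qed.

Section integrableR.
Context d (T : measurableType d) (mu : {measure set T -> \bar R}) (D : set T).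
Hypothesis mD : measurable D.
Local Notation integ f := (mu.-integrable D (EFin \o f)).
Implicit Types f g : T -> R.

Lemma integrableRD f g : integ f -> integ g -> integ (fun x => f x + g x).
Proof. exact: integrableD. Qed.

Lemma integrableRB f g : integ f -> integ g -> integ (fun x => f x - g x).
Proof. exact: integrableB. Qed.

Lemma integrableRZ c f : integ f -> integ (fun x => c * f x).
Proof. exact: integrableZl. Qed.

End integrableR.

Lemma Rintegral_dct d (T : measurableType d) (mu : {measure set T -> \bar R})
    (f_ : nat -> T -> R) (f g : T -> R) :
  (forall n, measurable_fun setT (f_ n)) -> measurable_fun setT f ->
  (forall x, f_ n x @[n --> \oo] --> f x) ->
  mu.-integrable setT (EFin \o g) -> (forall n x, `|f_ n x| <= g x) ->
  \int[mu]_x f_ n x @[n --> \oo] --> \int[mu]_x f x.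
Proof.
move=> mf_ mf cvgf ig le_g.
have mfE (h : T -> R) : measurable_fun setT h -> measurable_fun setT (EFin \o h).
  by move=> mh; exact/measurable_EFinP.
have cvgE x : (EFin \o f_^~ x) n @[n --> \oo] --> (f x)%:E.
  by apply/fine_cvgP; split; [exact: nearW | exact: cvgf].
have [intf _ H] := @dominated_convergence _ _ _ mu setT measurableT
  (fun n => EFin \o f_ n) (EFin \o f) (EFin \o g)
  (fun n => mfE _ (mf_ n)) (mfE _ mf) (aeW _ (fun x _ => cvgE x)) ig
  (aeW _ (fun x n _ => le_g n x)).
apply: fine_cvg; rewrite /Rintegral fineK //.
exact: integrable_fin_num.
Qed.

Lemma integrable_dominated d (T : measurableType d) (mu : {measure set T -> \bar R})
    (f g : T -> R) : measurable_fun setT f -> mu.-integrable setT (EFin \o g) ->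
  (forall x, `|f x| <= g x) -> mu.-integrable setT (EFin \o f).
Proof.
move=> mf ig le_g; apply: le_integrable ig => //.
- exact/measurable_EFinP.
- by move=> x _ /=; rewrite lee_fin (le_trans (le_g x)) // ler_norm.
Qed.

End limits.

Lemma Rintegral_prob_cst (R : realType) d (T : measurableType d) (Pr : probability T R) (c : R) :
  \int[Pr]_t c = c.
Proof.
rewrite Rintegral_cst // -[RHS]mulr1; congr (_ * _).
exact: (congr1 fine (probability_setT Pr)).
Qed.

Section discrete.
Variables (R : realType) (p : probability nat R).
Local Notation E g := (\int[p]_r g r).
Local Notation integ g := (p.-integrable setT (EFin \o g)).

Lemma mass_ge0 r : 0 <= mass p r.
Proof. by rewrite /mass fine_ge0. Qed.

Lemma integ_indic r : integ (\1_[set r] : nat -> R).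
Proof. by apply: integrable_indic => //; rewrite ltey_eq fin_num_measure. Qed.

(** Turns truncated sums into expectations, to which dominated convergence applies. *)
Lemma sum_mass n (g : nat -> R) :
  \sum_(r < n) mass p r * g r = E (fun r => (r < n)%N%:R * g r).
Proof.
transitivity (E (fun r => \sum_(i < n) g i * \1_[set (i : nat)] r)); last first.
  apply: eq_Rintegral => r _; have [rn|nr] := ltnP r n.
    rewrite (bigD1 (Ordinal rn)) //= indicE mem_set // mulr1 big1 ?addr0 ?mul1r // => i ir.
    rewrite indicE memNset ?mulr0 //= => ri.
    by case/eqP: ir; apply: val_inj.
  rewrite mul0r big1 // => i _; rewrite indicE memNset ?mulr0 //= => ri.
  by move: nr; rewrite ri leqNgt ltn_ord.
rewrite Rintegral_sum //; last first.
  by move=> i; apply: integrableRZ => //; exact: integ_indic.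
apply: eq_bigr => i _; rewrite RintegralZl //; last exact: integ_indic.
by rewrite mulrC /Rintegral integral_indic // setIT.
Qed.

Lemma sum_mass1 n : \sum_(r < n) mass p r <= 1.
Proof.
rewrite (eq_bigr (fun r : 'I_n => mass p r * 1)) => [|r _]; last by rewrite mulr1.
rewrite (sum_mass n (fun=> 1)).
have E1 : E (cst 1) = 1.
  exact: Rintegral_prob_cst.
rewrite -[leRHS]E1; apply: le_Rintegral => //.
- apply: (@integrable_dominated _ _ _ _ _ (cst 1)) => //.
    exact: finite_measure_integrable_cst.
  by move=> r; rewrite mulr1 ger0_norm ?ler0n // lern1 leq_b1.
- exact: finite_measure_integrable_cst.
- by move=> r _; rewrite mulr1 lern1 leq_b1.
Qed.

End discrete.

(** * The local limit theorem *)

Section pointwise.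
Variables (R : realType) (p : probability nat R).
Local Notation E g := (\int[p]_r g r).
Local Notation integ g := (p.-integrable setT (EFin \o g)).
Local Notation normc := (@Normc.normc R).
Local Notation "x %:C" := (real_complex R x).

Lemma integ_bounded (g : nat -> R) (C : R) : (forall r, `|g r| <= C) -> integ g.
Proof.
move=> gC; apply: (@integrable_dominated _ _ _ _ _ (cst C)) => //.
exact: finite_measure_integrable_cst.
Qed.

Lemma expR_quad (x : R) : x <= 0 -> `|expR x - 1 - x| <= x ^+ 2.
Proof.
move=> x0; have := expR_ge1Dx x; have := expR_ge1Dx (- x); rewrite expRN => h1 h2.
have e0 := expR_gt0 x; rewrite ger0_norm; last lra.
have : expR x * (1 - x) <= 1.
  by rewrite -[leRHS](divff (lt0r_neq0 e0)) ler_pM2l.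
nra.
Qed.

Variables (X : nat -> R) (v : R).
Hypothesis id_int : integ (fun r => r%:R).
Hypothesis X_int : integ X.
Hypothesis X2_int : integ (fun r => X r ^+ 2).
Hypothesis X_mean : E X = 0.
Hypothesis X_var : E (fun r => X r ^+ 2) = v.

Let z n := \sum_(r < n.+1) (mass p r)%:C * cis (X r / Num.sqrt n%:R).

Let sqrtn_sqr n : Num.sqrt n%:R ^+ 2 = n%:R :> R.
Proof. by rewrite sqr_sqrtr. Qed.

Let scaled_sqr n x : (0 < n)%N -> n%:R * (x / Num.sqrt n%:R) ^+ 2 = x ^+ 2 :> R.
Proof.
by move=> n0; rewrite exprMn exprVn sqrtn_sqr mulrCA divff ?mulr1 // pnatr_eq0 -lt0n.
Qed.

Let Re_z n : complex.Re (z n) = E (fun r => (r < n.+1)%N%:R * cos (X r / Num.sqrt n%:R)).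
Proof. by rewrite -sum_mass Re_sum; apply: eq_bigr => r _; rewrite Re_scale. Qed.

Let Im_z n : complex.Im (z n) = E (fun r => (r < n.+1)%N%:R * sin (X r / Num.sqrt n%:R)).
Proof. by rewrite -sum_mass Im_sum; apply: eq_bigr => r _; rewrite Im_scale. Qed.

Let ind_le1 (b : bool) (x : R) : `|b%:R * x| <= `|x|.
Proof. by case: b; rewrite ?mul1r // mul0r normr0. Qed.

(** For fixed [r] the truncation is inactive as soon as [n >= r]; the shift by [r] ensures this, and
    the bound at [n + r] is relaxed to the one at [n]. *)
Let cvg_shift0 (f : nat -> nat -> R) (l C : nat -> R) :
  (forall r n, (r <= n)%N -> (0 < n)%N -> `|f n r - l r| <= C r / Num.sqrt n%:R) ->
  forall r, f n r @[n --> \oo] --> l r.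
Proof.
move=> H r.
suff : f (n + r)%N r @[n --> \oo] --> l r by rewrite (@cvg_shiftn r R (f ^~ r)).
apply: (@cvg_of_sqrt_bound R _ _ (C r)) => n n0.
have C0 : 0 <= C r.
  have := H r (n + r)%N (leq_addl _ _) (ltn_addr _ n0) => /(le_trans (normr_ge0 _)).
  by rewrite pmulr_lge0 // invr_gt0 sqrtr_gt0 ltr0n ltn_addr.
apply: le_trans (H r _ (leq_addl _ _) (ltn_addr _ n0)) _.
rewrite ler_wpM2l // lef_pV2 ?posrE ?sqrtr_gt0 ?ltr0n ?ltn_addr //.
by rewrite ler_wsqrtr // ler_nat leq_addr.
Qed.

Let inv_le_sqrt n (C : R) : (0 < n)%N -> 0 <= C -> C / n%:R <= C / Num.sqrt n%:R.
Proof.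
move=> n0 C0; rewrite ler_wpM2l // lef_pV2 ?posrE ?sqrtr_gt0 ?ltr0n //.
have s0 : 1 <= Num.sqrt n%:R :> R by rewrite -[leLHS]sqrtr1 ler_wsqrtr // ler1n.
by rewrite -[leRHS]sqrtn_sqr expr2 ler_peMl // (le_trans ler01).
Qed.

Lemma re_drift : n%:R * (complex.Re (z n) - 1) @[n --> \oo] --> - (v / 2).
Proof.
pose f n r : R := n%:R * ((r < n.+1)%N%:R * cos (X r / Num.sqrt n%:R) - 1).
have -> : (fun n => n%:R * (complex.Re (z n) - 1)) = (fun n => E (f n)).
  apply/funext => n; rewrite Re_z.
  have i1 : integ (fun r => (r < n.+1)%N%:R * cos (X r / Num.sqrt n%:R)).
    apply: (@integ_bounded _ 1) => r; apply: le_trans (ind_le1 _ _) _; exact: cos_max.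
  have i2 : integ (cst 1) by apply: (@integ_bounded _ 1) => r; rewrite normr1.
  rewrite /f RintegralZl //; last exact: integrableRB.
  by rewrite RintegralB // Rintegral_prob_cst.
rewrite -X_var (_ : - _ = E (fun r => (- 2^-1) * X r ^+ 2)); last first.
  by rewrite RintegralZl //; lra.
apply: (@Rintegral_dct _ _ _ p f _ (fun r => r%:R + X r ^+ 2)) => //.
- apply: (@cvg_shift0 f _ (fun r => X r ^+ 4)) => r n rn n0.
  apply: (@le_trans _ _ (X r ^+ 4 / n%:R)); last by rewrite inv_le_sqrt ?exprn_even_ge0.
  rewrite /f ltnS rn mul1r; set y := X r / _.
  have -> : X r ^+ 4 / n%:R = n%:R * y ^+ 4.
    have nn : n%:R != 0 :> R by rewrite pnatr_eq0 -lt0n.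
    rewrite (_ : 4 = 2 * 2)%N // [y ^+ _]exprM [X r ^+ _]exprM.
    rewrite -(scaled_sqr (X r) n0) -/y; field; exact: nn.
  rewrite -(scaled_sqr (X r) n0) -/y.
  rewrite (_ : _ - _ = n%:R * (cos y - 1 + y ^+ 2 / 2)); last by lra.
  rewrite normrM ger0_norm // ler_wpM2l // ger0_norm.
    by have := cos_le_quartic y; have := exprn_even_ge0 y (isT : ~~ odd 4); lra.
  by have := cos_ge_quad y; lra.
- exact: integrableRD.
(* The square dominates [n * (1 - cos)]; beyond the truncation the term has modulus [n], which is
   below [r]. *)
- move=> n r; rewrite /f; have [rn|nr] := ltnP r n.+1.
    rewrite mul1r; case: n rn => [|n] rn; first by rewrite mul0r normr0 addr_ge0 ?sqr_ge0.
    rewrite normrM ger0_norm // -[X in _ <= _ + X](scaled_sqr (X r) (ltn0Sn n)).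
    set y := X r / _; rewrite distrC ger0_norm ?subr_ge0 ?cos_le1 //.
    apply: (@le_trans _ _ (n.+1%:R * y ^+ 2)); last by rewrite lerDr.
    by rewrite ler_wpM2l //; have := cos_ge_quad y; have := sqr_ge0 y; lra.
  rewrite mul0r sub0r mulrN1 normrN ger0_norm //.
  by rewrite (@le_trans _ _ r%:R) ?lerDl ?sqr_ge0 // ler_nat ltnW.
Qed.

(** The linear term [Num.sqrt n%:R * X r] has mean 0 and may be subtracted; what it leaves of the
    scaled sine is bounded by [X r ^+ 2]. *)
Lemma im_drift : n%:R * complex.Im (z n) @[n --> \oo] --> 0.
Proof.
pose f n r : R := (r < n.+1)%N%:R * (n%:R * sin (X r / Num.sqrt n%:R)) - Num.sqrt n%:R * X r.
have -> : (fun n => n%:R * complex.Im (z n)) = (fun n => E (f n)).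
  apply/funext => n; rewrite Im_z.
  have i1 : integ (fun r => (r < n.+1)%N%:R * sin (X r / Num.sqrt n%:R)).
    apply: (@integ_bounded _ 1) => r; apply: le_trans (ind_le1 _ _) _; exact: sin_max.
  have i2 : integ (fun r => Num.sqrt n%:R * X r).
    exact: integrableRZ.
  rewrite -RintegralZl // -[LHS]subr0 -[X in _ - X](mulr0 (Num.sqrt n%:R)) -X_mean -RintegralZl //.
  rewrite -RintegralB //; last exact: integrableRZ.
  by apply: eq_Rintegral => r _; rewrite /f mulrCA.
rewrite -(Rintegral_prob_cst p 0).
apply: (@Rintegral_dct _ _ _ p f _ (fun r => r%:R + X r ^+ 2)) => //.
- apply: (@cvg_shift0 f _ (fun r => `|X r| ^+ 3)) => r n rn n0.
  have s0 : 0 < Num.sqrt n%:R :> R by rewrite sqrtr_gt0 ltr0n.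
  rewrite /f subr0 ltnS rn mul1r; set s := Num.sqrt n%:R in s0 *; set y := X r / s.
  have XE : X r = y * s by rewrite divfK ?gt_eqF.
  have -> : n%:R * sin y - s * X r = s ^+ 2 * (sin y - y) by rewrite sqrtn_sqr XE -sqrtn_sqr -/s;
    ring.
  rewrite normrM ger0_norm ?sqr_ge0 // XE normrM (ger0_norm (ltW s0)).
  rewrite (_ : _ / s = s ^+ 2 * `|y| ^+ 3); last by field; rewrite gt_eqF.
  rewrite ler_wpM2l ?sqr_ge0 //; apply: le_trans (sin_dist_id y) _.
  by have := exprn_ge0 3 (normr_ge0 y); lra.
- exact: integrableRD.
- move=> n r; rewrite /f; have s0 : 0 <= Num.sqrt n%:R :> R by exact: sqrtr_ge0.
  set s := Num.sqrt n%:R in s0 *; have sE : n%:R = s ^+ 2 by rewrite sqrtn_sqr.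
  have [rn|nr] := ltnP r n.+1; last first.
    rewrite mul0r sub0r normrN normrM (ger0_norm s0).
    have : s ^+ 2 <= r%:R by rewrite -sE ler_nat ltnW.
    rewrite -[X in _ <= _ + X](real_normK (num_real (X r))).
    by have := normr_ge0 (X r); have := sqr_ge0 (s - `|X r|); nra.
  rewrite mul1r sE; have [s00|s_neq0] := eqVneq s 0.
    by rewrite s00 expr0n /= !mul0r subr0 normr0 addr_ge0 ?sqr_ge0.
  set y := X r / s; have XE : X r = y * s by rewrite divfK.
  have -> : s ^+ 2 * sin y - s * X r = s ^+ 2 * (sin y - y) by rewrite XE; ring.
  rewrite normrM ger0_norm ?sqr_ge0 // XE exprMn [y ^+ 2 * _]mulrC.
  apply: (@le_trans _ _ (s ^+ 2 * y ^+ 2)); last by rewrite lerDr.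
  by rewrite ler_wpM2l ?sqr_ge0 // sin_dist_id_sqr.
Qed.

(** No complex logarithm is taken: [z n] is compared with [w n], the exponential of [- v / (2 n)],
    whose powers are explicit. Both have modulus at most 1, so the powers differ by at most [n.+1]
    times the distance of [z n] and [w n], which the two drifts send to 0. *)
Lemma charfun_pow_cvg :
  normc (z n ^+ n.+1 - (expR (- (v / 2)))%:C) @[n --> \oo] --> 0.
Proof.
have v0 : 0 <= v by rewrite -X_var Rintegral_ge0 // => r _; exact: sqr_ge0.
pose w n := expR (- (v / 2) / n%:R).
have w1 n : 0 <= w n <= 1.
  by rewrite expR_ge0 -[leRHS]expR0 ler_expR mulNr oppr_le0 !mulr_ge0 ?invr_ge0.
have wn n : (0 < n)%N -> w n ^+ n = expR (- (v / 2)).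
  by move=> n0; rewrite -expRM_natl mulrC divfK // pnatr_eq0 -lt0n.
have w_drift : n%:R * (w n - 1) @[n --> \oo] --> - (v / 2).
  apply: (@cvg_of_sqrt_bound R _ _ ((v / 2) ^+ 2)) => n n0.
  apply: le_trans (inv_le_sqrt n0 (sqr_ge0 _)).
  have nn : 0 < n%:R :> R by rewrite ltr0n.
  set x := - (v / 2) / n%:R.
  have x0 : x <= 0 by rewrite /x mulNr oppr_le0 !mulr_ge0 ?invr_ge0.
  have -> : n%:R * (w n - 1) - - (v / 2) = n%:R * (expR x - 1 - x).
    by rewrite /w -/x (_ : - (v / 2) = n%:R * x); [ring | rewrite /x mulrCA divff ?mulr1 // gt_eqF].
  rewrite normrM (ger0_norm (ltW nn)).
  apply: le_trans (ler_wpM2l (ltW nn) (expR_quad x0)) _.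
  rewrite le_eqVlt; apply/orP; left; apply/eqP; rewrite /x; field.
  by rewrite gt_eqF.
have z1 n : normc (z n) <= 1.
  apply: le_trans (normc_sum_le _ _ _) _; apply: le_trans (sum_mass1 p n.+1).
  by apply: ler_sum => r _; rewrite Normc.normcM normc_cis mulr1 normc_real ger0_norm ?mass_ge0.
have cw n : normc (w n)%:C <= 1.
  by rewrite normc_real; have /andP[w0 wle] := w1 n; rewrite ger0_norm.
apply: (@le_cvg0 _ _ (fun n => 2 * (`|n%:R * (complex.Re (z n) - 1) - n%:R * (w n - 1)|
   + `|n%:R * complex.Im (z n)|) + `|w n - 1|)).
  exists 1%N => // n /= n1; rewrite ger0_norm ?normc_ge0 //.
  rewrite (_ : z n ^+ n.+1 - _ = (z n ^+ n.+1 - (w n)%:C ^+ n.+1) +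
    ((w n)%:C ^+ n.+1 - (expR (- (v / 2)))%:C)); last by ring.
  apply: le_trans (normcD_le _ _) _; apply: lerD.
    apply: le_trans (normc_exp_dist _ (z1 n) (cw n)) _.
    apply: (@le_trans _ _ ((2 * n%:R) * normc (z n - (w n)%:C))).
      by rewrite ler_wpM2r ?normc_ge0 // -natrM ler_nat; lia.
    rewrite -mulrA ler_wpM2l // -mulrBr !normrM normr_nat -mulrDr ler_wpM2l //.
    rewrite opprB addrA addrNK; apply: le_trans (normc_le_ReIm _) _.
    by case: (z n) => a c /=; rewrite subr0.
  rewrite -rmorphXn -rmorphB normc_real exprS (wn n n1) -{2}[expR _]mul1r -mulrBl normrM.
  by rewrite ler_piMr // ger0_norm ?expR_ge0 // -expR0 ler_expR oppr_le0 divr_ge0.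
suff : 2 * (`|n%:R * (complex.Re (z n) - 1) - n%:R * (w n - 1)|
   + `|n%:R * complex.Im (z n)|) + `|w n - 1| @[n --> \oo] -->
   2 * (`|- (v / 2) - - (v / 2)| + `|0 : R|) + `|1 - 1 : R|.
  by rewrite !(subrr, normr0, addr0, mulr0).
apply: cvgD.
  apply: cvgMr; apply: cvgD; apply: cvg_norm; last exact: im_drift.
  by apply: cvgB; [exact: re_drift | exact: w_drift].
apply: cvg_norm; apply: cvgB; last exact: cvg_cst.
apply: (@cvg_of_sqrt_bound R _ _ (v / 2)) => n n0.
have nn : 0 < n%:R :> R by rewrite ltr0n.
apply: le_trans (inv_le_sqrt n0 _); last by rewrite divr_ge0.
have /andP[_ wle] := w1 n; rewrite distrC ger0_norm ?subr_ge0 //.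
by have := expR_ge1Dx (- (v / 2) / n%:R); rewrite -/(w n) mulNr; lra.
Qed.

End pointwise.

(** * Gaussian domination of the integrand *)

Section domination.
Variables (R : realType) (p : probability nat R) (tau : nat -> R).
Variables (h M : nat) (K : R).
Local Notation normc := (@Normc.normc R).
Local Notation "x %:C" := (real_complex R x).
Hypothesis h_gt0 : (0 < h)%N.
Hypothesis K_ge0 : 0 <= K.
Hypothesis p0_gt0 : 0 < mass p 0.
Hypothesis span_le : forall t : R,
  sin (h%:R * t) ^+ 2 <= K * \sum_(r < M) mass p r * sin (r%:R * t) ^+ 2.

(** [D] is the loss due to [tau] and [c] the Gaussian rate: 36 is 4, from the half angle, times 9,
    from [sin x >= x / 3], and [K + 1] avoids a division by 0. Neither depends on [n], since the
    sums stop at [M]. *)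
Let D := mass p 0 * \sum_(r < M) mass p r * ((tau r - tau 0%N) ^+ 2 / 2).
Let c := mass p 0 * (h%:R ^+ 2 / (36 * (K + 1))).

Let D_ge0 : 0 <= D.
Proof.
apply: mulr_ge0; first exact: mass_ge0.
by apply: sumr_ge0 => r _; rewrite mulr_ge0 ?mass_ge0 // divr_ge0 // sqr_ge0.
Qed.

Let c_gt0 : 0 < c.
Proof.
by rewrite mulr_gt0 // divr_gt0 ?exprn_gt0 ?ltr0n // mulr_gt0 // ltr_wpDl.
Qed.

Lemma normc_sum_cis_sqr N (a q : nat -> R) :
  normc (\sum_(r < N) (q r)%:C * cis (a r)) ^+ 2 =
  \sum_(s < N) \sum_(r < N) q r * q s * cos (a r - a s).
Proof.
have ReE : complex.Re (\sum_(r < N) (q r)%:C * cis (a r)) = \sum_(r < N) q r * cos (a r).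
  by rewrite Re_sum; apply: eq_bigr => r _; rewrite Re_scale.
have ImE : complex.Im (\sum_(r < N) (q r)%:C * cis (a r)) = \sum_(r < N) q r * sin (a r).
  by rewrite Im_sum; apply: eq_bigr => r _; rewrite Im_scale.
rewrite normc_sqr ReE ImE !expr2 !mulr_suml -big_split /=.
rewrite exchange_big /=; apply: eq_bigr => s _; rewrite !mulr_sumr -big_split /=.
by apply: eq_bigr => r _; rewrite cosB; ring.
Qed.

(** Symmetrization: the squared modulus is a double sum of [cos (a r - a s)]. The rows other than
    [s = 0] are bounded by their mass; in that row the -1 of the increments cancels, so the
    multiples [r * t] of the frequency appear and the span inequality applies. *)
Lemma normc_char_bound n (u : R) : (M <= n)%N -> (0 < n)%N ->
  `|u| <= pi * Num.sqrt n%:R / h%:R ->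
  normc (\sum_(r < n.+1) (mass p r)%:C *
    cis (tau r / Num.sqrt n%:R + u / Num.sqrt n%:R * (r%:R - 1))) ^+ 2
  <= expR ((D - c * u ^+ 2) / n%:R).
Proof.
move=> Mn n0 uL; set k := Num.sqrt n%:R in uL *.
have nn : 0 < n%:R :> R by rewrite ltr0n.
have k0 : 0 < k by rewrite sqrtr_gt0.
have kE : k ^+ 2 = n%:R by rewrite sqr_sqrtr // ltW.
have h0 : 0 < h%:R :> R by rewrite ltr0n.
set a := fun r : nat => tau r / k + u / k * (r%:R - 1).
rewrite (normc_sum_cis_sqr n.+1 a).
pose t := u / k.
have m0 r : 0 <= mass p r by exact: mass_ge0.
have row (s : nat) : (s < n.+1)%N ->
    \sum_(r < n.+1) mass p r * mass p s * cos (a r - a s) <= mass p s.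
  move=> _; apply: (@le_trans _ _ (\sum_(r < n.+1) mass p r * mass p s)).
    by apply: ler_sum => r _; rewrite ler_piMr ?mulr_ge0 ?cos_le1.
  by rewrite -mulr_suml ler_piMl ?sum_mass1.
rewrite big_ord_recl /=.
apply: (@le_trans _ _ (\sum_(r < n.+1) mass p r * mass p 0 * cos (a r - a 0%N)
  + \sum_(s < n) mass p s.+1)).
  by rewrite lerD2l; apply: ler_sum => s _; rewrite row // ltnS.
have tot : mass p 0 + \sum_(s < n) mass p s.+1 <= 1.
  by have := sum_mass1 p n.+1; rewrite big_ord_recl.
have first_row : \sum_(r < n.+1) mass p r * mass p 0 * cos (a r - a 0%N) <=
    mass p 0 - mass p 0 * \sum_(r < M) mass p r * (1 - cos (a r - a 0%N)).
  apply: (@le_trans _ _ (mass p 0 - mass p 0 * \sum_(r < n.+1) mass p r * (1 - cos (a r - a 0%N)))).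
    rewrite (eq_bigr (fun r : 'I_n.+1 => mass p 0 * mass p r - mass p 0 * (mass p r *
      (1 - cos (a r - a 0%N))))); last first.
      by move=> r _; ring.
    by rewrite sumrB -!mulr_sumr lerD2r ler_piMr ?sum_mass1.
  rewrite lerD2l lerN2 ler_wpM2l //.
  rewrite -!(big_mkord xpredT (fun r => mass p r * (1 - cos (a r - a 0%N)))).
  rewrite [leRHS](@big_cat_nat _ _ _ M) ?leqW //= lerDl; apply: sumr_ge0 => r _.
  by rewrite mulr_ge0 // subr_ge0 cos_le1.
have lower (r : nat) : sin (r%:R * (t / 2)) ^+ 2 - (tau r - tau 0%N) ^+ 2 / 2 / n%:R <=
    1 - cos (a r - a 0%N).
  have -> : a r - a 0%N = r%:R * t + (tau r - tau 0%N) / k.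
    by rewrite /a /t; field; rewrite gt_eqF.
  apply: le_trans (cos_shift_lower _ _); rewrite cosE_half.
  by rewrite -[r%:R * t / 2]mulrA exprMn exprVn kE; lra.
have sum_lower : \sum_(r < M) mass p r * sin (r%:R * (t / 2)) ^+ 2
    - (\sum_(r < M) mass p r * ((tau r - tau 0%N) ^+ 2 / 2)) / n%:R <=
    \sum_(r < M) mass p r * (1 - cos (a r - a 0%N)).
  rewrite mulr_suml -sumrB; apply: ler_sum => r _.
  by rewrite -mulrA -mulrBr ler_wpM2l.
have th : `|h%:R * (t / 2)| <= pi / 2.
  rewrite normrM (ger0_norm (ltW h0)) /t !normrM normfV (ger0_norm (ltW k0)) normfV.
  rewrite (ger0_norm (_ : 0 <= 2)) //.
  have -> : h%:R * (`|u| / k / 2) = `|u| * h%:R / k / 2 by ring.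
  by rewrite ler_pM2r ?invr_gt0 // ler_pdivrMr // -ler_pdivlMr.
have sin_low : (h%:R * (t / 2)) ^+ 2 / 9 <= sin (h%:R * (t / 2)) ^+ 2.
  move: th; set x := h%:R * (t / 2) => th.
  have -> : sin x ^+ 2 = sin `|x| ^+ 2.
    by have [x0|x0] := leP 0 x; [rewrite ger0_norm | rewrite ltr0_norm // sinN sqrrN].
  rewrite -(real_normK (num_real x)).
  have j := @jordan_sin R `|x|; rewrite normr_ge0 th in j; have {}j := j isT.
  have -> : `|x| ^+ 2 / 9 = (`|x| / 3) ^+ 2 by rewrite expr_div_n; congr (_ / _); ring.
  by rewrite ler_pXn2r ?nnegrE ?divr_ge0 // (le_trans _ j) // divr_ge0.
have main : c * (u ^+ 2 / n%:R) <= mass p 0 * \sum_(r < M) mass p r * sin (r%:R * (t / 2)) ^+ 2.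
  rewrite /c -mulrA ler_wpM2l //.
  have K1 : 0 < K + 1 by rewrite ltr_wpDl.
  set Sg := \sum_(r < M) _.
  have Sg0 : 0 <= Sg by apply: sumr_ge0 => r _; rewrite mulr_ge0 // sqr_ge0.
  have -> : h%:R ^+ 2 / (36 * (K + 1)) * (u ^+ 2 / n%:R) = (h%:R * (t / 2)) ^+ 2 / 9 / (K + 1).
    by rewrite -kE /t; field; rewrite !gt_eqF.
  rewrite ler_pdivrMr //; apply: le_trans sin_low _.
  apply: le_trans (span_le (t / 2)) _; rewrite -/Sg mulrC ler_wpM2l //.
  by rewrite lerDl.
apply: (@le_trans _ _ (1 + (D - c * u ^+ 2) / n%:R)); last exact: expR_ge1Dx.
have := ler_wpM2l (ltW p0_gt0) sum_lower; rewrite mulrBr mulrA -/D.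
rewrite mulrBl; move: main first_row tot; rewrite -[c * u ^+ 2 / _]mulrA; lra.
Qed.

(** The exponent [n.+1] is at least [n], which keeps the full rate [c], and at most [2 n], which
    costs [2 D]; passing from the square to the modulus halves both. *)
Lemma normc_char_pow_bound n (u : R) : (M <= n)%N -> (0 < n)%N ->
  `|u| <= pi * Num.sqrt n%:R / h%:R ->
  normc (\sum_(r < n.+1) (mass p r)%:C *
    cis (tau r / Num.sqrt n%:R + u / Num.sqrt n%:R * (r%:R - 1))) ^+ n.+1
  <= expR D * expR (- (c / 2 * u ^+ 2)).
Proof.
move=> Mn n0 uL; have := normc_char_bound Mn n0 uL.
set z := normc _; have z0 : 0 <= z by exact: normc_ge0.
have nn : 0 < n%:R :> R by rewrite ltr0n.
move=> z2; rewrite -(@ler_pXn2r _ 2) ?nnegrE ?exprn_ge0 ?mulr_ge0 ?expR_ge0 //.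
rewrite -exprM mulnC exprM; apply: (@le_trans _ _ (expR ((D - c * u ^+ 2) / n%:R) ^+ n.+1)).
  by rewrite ler_pXn2r ?nnegrE ?expR_ge0 ?sqr_ge0.
rewrite -expRM_natl -expRD -expRM_natl ler_expR.
have -> : n.+1%:R * ((D - c * u ^+ 2) / n%:R) = (D - c * u ^+ 2) + (D - c * u ^+ 2) / n%:R.
  by rewrite -natr1; field; rewrite gt_eqF.
have cu : 0 <= c * u ^+ 2 by rewrite mulr_ge0 ?sqr_ge0 ?ltW.
have : (D - c * u ^+ 2) / n%:R <= D.
  rewrite ler_pdivrMr //; apply: (@le_trans _ _ D); first by lra.
  by rewrite ler_peMr // ler1n.
lra.
Qed.

End domination.

(** * Convergence of the Fourier integrals *)

Section local_limit.
Variables (R : realType) (p : probability nat R) (sigma2 : R).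
Local Notation E g := (\int[p]_r g r).
Local Notation integ g := (p.-integrable setT (EFin \o g)).
Local Notation normc := (@Normc.normc R).
Local Notation Re := (@complex.Re R).
Local Notation "x %:C" := (real_complex R x).

Definition incr (r : nat) : R := r%:R - 1.

Hypothesis incr2_int : integ (fun r => incr r ^+ 2).
Hypothesis incr_mean : E incr = 0.
Hypothesis incr_var : E (fun r => incr r ^+ 2) = sigma2.
Hypothesis sigma2_gt0 : 0 < sigma2.

Lemma integ_of_sqr (g : nat -> R) : integ (fun r => g r ^+ 2) -> integ g.
Proof.
move=> g2; apply: (@integrable_dominated _ _ _ _ _ (fun r => 1 + g r ^+ 2)) => //.
  by apply: integrableRD => //; apply: (@integ_bounded _ _ _ 1) => r; rewrite normr1.
by move=> r; rewrite -[in leRHS](real_normK (num_real (g r))); have := sqr_ge0 (`|g r| - 1); nra.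
Qed.

Lemma integ_mul (f g : nat -> R) : integ (fun r => f r ^+ 2) -> integ (fun r => g r ^+ 2) ->
  integ (fun r => f r * g r).
Proof.
move=> f2 g2; apply: (@integrable_dominated _ _ _ _ _ (fun r => f r ^+ 2 + g r ^+ 2)) => //.
  exact: integrableRD.
move=> r; rewrite normrM -[in leRHS](real_normK (num_real (f r))) -[in leRHS](real_normK
  (num_real (g r))).
by have := sqr_ge0 (`|f r| - `|g r|); nra.
Qed.

Let incr_int : integ incr.
Proof. exact: integ_of_sqr. Qed.

Let id_int : integ (fun r => r%:R).
Proof.
rewrite (_ : (fun r => r%:R) = (fun r => incr r + 1)).
  by apply: integrableRD => //; apply: (@integ_bounded _ _ _ 1) => r; rewrite normr1.
by apply/funext => r; rewrite /incr subrK.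
Qed.

Definition gauss_mass (s : R) := \int[lebesgue_measure]_u expR (- (s / 2 * u ^+ 2)).

Lemma gauss_normal_pdf (s u : R) : 0 < s ->
  expR (- (s / 2 * u ^+ 2)) =
  (normal_peak (Num.sqrt s^-1))^-1 * normal_pdf 0 (Num.sqrt s^-1) u.
Proof.
move=> s0; have q0 : Num.sqrt s^-1 != 0 by rewrite gt_eqF // sqrtr_gt0 invr_gt0.
rewrite normal_pdfE // mulKf ?gt_eqF ?normal_peak_gt0 //.
rewrite /normal_fun subr0 sqr_sqrtr ?invr_ge0 ?ltW //; congr expR.
by rewrite -mulr_natr; field; rewrite gt_eqF.
Qed.

Lemma integrable_gauss (s : R) : 0 < s ->
  lebesgue_measure.-integrable setT (EFin \o (fun u : R => expR (- (s / 2 * u ^+ 2)))).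
Proof.
move=> s0; rewrite (_ : (fun u => _) = (fun u =>
  (normal_peak (Num.sqrt s^-1))^-1 * normal_pdf 0 (Num.sqrt s^-1) u)).
  by apply: integrableRZ => //; exact: integrable_normal_pdf.
by apply/funext => u; exact: gauss_normal_pdf.
Qed.

Lemma gauss_mass_gt0 (s : R) : 0 < s -> 0 < gauss_mass s.
Proof.
move=> s0; rewrite /gauss_mass.
have q0 : Num.sqrt s^-1 != 0 by rewrite gt_eqF // sqrtr_gt0 invr_gt0.
rewrite (@eq_Rintegral _ _ _ lebesgue_measure _ (fun u =>
  (normal_peak (Num.sqrt s^-1))^-1 * normal_pdf 0 (Num.sqrt s^-1) u)).
  rewrite RintegralZl //; last exact: integrable_normal_pdf.
  by rewrite /Rintegral integral_normal_pdf mulr1 invr_gt0 normal_peak_gt0.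
by move=> u _; exact: gauss_normal_pdf.
Qed.

Section with_tau.
Variables (tau : nat -> R) (v b : R) (b_ : nat -> R) (h : nat).
Hypothesis tau2_int : integ (fun r => tau r ^+ 2).
Hypothesis tau_mean : E tau = 0.
Hypothesis tau_incr : E (fun r => tau r * incr r) = 0.
Hypothesis tau_var : E (fun r => tau r ^+ 2) = v.
Hypothesis b_cvg : b_ n @[n --> \oo] --> b.

Let tau_int : integ tau.
Proof. exact: integ_of_sqr. Qed.

(* n + 1 letters with sum n have increments adding up to -1, whence the last factor. *)
Definition fourier_integrand n u :=
  Re (cis (b_ n) * (\sum_(r < n.+1) (mass p r)%:C *
     cis (tau r / Num.sqrt n%:R + u / Num.sqrt n%:R * (r%:R - 1))) ^+ n.+1
     * cis (u / Num.sqrt n%:R)).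

Definition fourier_integral n :=
  \int[lebesgue_measure]_(u in `[-(pi * Num.sqrt n%:R / h%:R), pi * Num.sqrt n%:R / h%:R])
    fourier_integrand n u.

Let X u r := tau r + u * incr r.

Let X2E u : (fun r => X u r ^+ 2) = (fun r => tau r ^+ 2 + (2 * u) * (tau r * incr r) +
  u ^+ 2 * incr r ^+ 2).
Proof. by apply/funext => r; rewrite /X; ring. Qed.

Let X2_int u : integ (fun r => X u r ^+ 2).
Proof.
rewrite X2E; apply: integrableRD => //; last exact: integrableRZ.
by apply: integrableRD => //; apply: integrableRZ => //; exact: integ_mul.
Qed.

Let X_mean u : E (X u) = 0.
Proof. by rewrite RintegralD ?RintegralZl ?tau_mean ?incr_mean ?mulr0 ?addr0 //;
  exact: integrableRZ. Qed.

(** The cross term vanishes since [tau] is uncorrelated with the increment; hence the limit factors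
    in [v] and [u]. *)
Let X_var u : E (fun r => X u r ^+ 2) = v + sigma2 * u ^+ 2.
Proof.
have i1 : integ (fun r => tau r * incr r) by exact: integ_mul.
have i2 : integ (fun r => (2 * u) * (tau r * incr r)) by exact: integrableRZ.
have i3 : integ (fun r => u ^+ 2 * incr r ^+ 2) by exact: integrableRZ.
rewrite X2E RintegralD //; last exact: integrableRD.
rewrite RintegralD // !RintegralZl // tau_var tau_incr incr_var; ring.
Qed.

Lemma sqrtn_cvg_pinfty (A : R) : \forall n \near \oo, A <= Num.sqrt n%:R.
Proof.
exists (Num.truncn (A ^+ 2)).+1 => // n /= An.
have [A0|A0] := leP A 0; first by apply: le_trans A0 _; exact: sqrtr_ge0.
rewrite -(ger0_norm (ltW A0)) -sqrtr_sqr ler_wsqrtr //.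
apply: le_trans (_ : (Num.truncn (A ^+ 2)).+1%:R <= _); last by rewrite ler_nat.
by apply: ltW; rewrite truncnS_gt.
Qed.

Lemma fourier_integrand_cvg u :
  fourier_integrand n u @[n --> \oo] --> cos b * expR (- (v / 2)) * expR (- (sigma2 / 2 * u ^+ 2)).
Proof.
have H := @charfun_pow_cvg R p (X u) _ id_int (integ_of_sqr (X2_int u)) (X2_int u) (X_mean u)
  (X_var u).
have sE n r : tau r / Num.sqrt n%:R + u / Num.sqrt n%:R * (r%:R - 1) = X u r / Num.sqrt n%:R.
  by rewrite /X /incr; ring.
set e := expR (- ((v + sigma2 * u ^+ 2) / 2)) in H.
have eE : expR (- (v / 2)) * expR (- (sigma2 / 2 * u ^+ 2)) = e.
  by rewrite -expRD /e; congr expR; ring.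
rewrite -mulrA eE.
pose z n := (\sum_(r < n.+1) (mass p r)%:C * cis (X u r / Num.sqrt n%:R)) ^+ n.+1.
have -> : fourier_integrand ^~ u = (fun n => Re (cis (b_ n + u / Num.sqrt n%:R) * (z n - e%:C)) +
  cos (b_ n + u / Num.sqrt n%:R) * e).
  apply/funext => n; rewrite /fourier_integrand.
  under eq_bigr do rewrite sE.
  rewrite -/(z n) mulrAC -cisD mulrBr -[X in _ = Re (_ - X) + _]mulrC.
  by case: (cis _ * z n) => x y /=; ring.
rewrite -[X in _ --> X]add0r; apply: cvgD.
  apply: (@le_cvg0 _ _ (fun n => normc (z n - e%:C))); last exact: H.
  by apply: nearW => n; apply: le_trans (Re_le_normc _) _; rewrite Normc.normcM normc_cis mul1r.
apply: cvgMl; apply: continuous_cvg; first exact: continuous_cos.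
rewrite -[X in _ --> X]addr0; apply: cvgD => //.
apply: (@cvg_of_sqrt_bound R _ _ `|u|) => n n0; rewrite subr0 normrM normfV.
by rewrite (ger0_norm (sqrtr_ge0 _)).
Qed.

Lemma measurable_fourier_integrand n : (0 < n)%N -> measurable_fun setT (fourier_integrand n).
Proof.
move=> n0; have k0 : Num.sqrt n%:R != 0 :> R by rewrite gt_eqF // sqrtr_gt0 ltr0n.
have E u := @charfun_pow_expand R (mass p) (fun r => tau r / Num.sqrt n%:R) n _ (b_ n) u k0.
have -> : fourier_integrand n = _ := funext E.
apply: measurable_sum => s; apply: measurable_funM => //.
by apply: continuous_measurable_fun => u; exact: continuous_cos_affine.
Qed.

Lemma fourier_integral_cvg (M : nat) (K : R) : (0 < h)%N -> 0 <= K -> 0 < mass p 0 ->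
  (forall t : R, sin (h%:R * t) ^+ 2 <= K * \sum_(r < M) mass p r * sin (r%:R * t) ^+ 2) ->
  fourier_integral n @[n --> \oo] --> cos b * expR (- (v / 2)) * gauss_mass sigma2.
Proof.
move=> h0 K0 p0 span_le; have hR : 0 < h%:R :> R by rewrite ltr0n.
pose I n : set R := [set` `[-(pi * Num.sqrt n%:R / h%:R), pi * Num.sqrt n%:R / h%:R]].
pose f n u : R := if (M <= n)%N && (0 < n)%N then (fourier_integrand n \_ (I n)) u else 0.
have -> : cos b * expR (- (v / 2)) * gauss_mass sigma2 =
    \int[lebesgue_measure]_u (cos b * expR (- (v / 2)) * expR (- (sigma2 / 2 * u ^+ 2))).
  by rewrite RintegralZl //; exact: integrable_gauss.
have fE : \forall n \near \oo, \int[lebesgue_measure]_u f n u = fourier_integral n.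
  exists (maxn M 1) => // n /=; rewrite geq_max => /andP[Mn n0].
  by rewrite /f Mn n0 /fourier_integral Rintegral_mkcond.
apply: (cvg_trans (near_eq_cvg fE)).
pose D := mass p 0 * \sum_(r < M) mass p r * ((tau r - tau 0%N) ^+ 2 / 2).
pose c := mass p 0 * (h%:R ^+ 2 / (36 * (K + 1))).
have c0 : 0 < c.
  by rewrite mulr_gt0 // divr_gt0 ?exprn_gt0 // mulr_gt0 // ltr_wpDl.
apply: (@Rintegral_dct R _ _ lebesgue_measure f
  (fun u => cos b * expR (- (v / 2)) * expR (- (sigma2 / 2 * u ^+ 2)))
  (fun u => expR D * expR (- (c / 2 * u ^+ 2)))).
- move=> n; rewrite /f; case Mn : ((M <= n)%N && (0 < n)%N) => //.
  have /andP[_ n0] := Mn.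
  apply/(measurable_restrictT _ _).1; first exact: measurable_itv.
  by apply: measurable_funTS; exact: measurable_fourier_integrand.
- apply: measurable_funM => //; apply: measurableT_comp => //.
  apply: measurableT_comp => //; apply: measurable_funM => //.
- move=> u; apply: (@cvg_trans _ (fourier_integrand n u @[n --> \oo]));
  last exact: fourier_integrand_cvg.
  apply: near_eq_cvg; near=> n.
  rewrite /f; have -> : (M <= n)%N by near: n; exists M.
  have -> : (0 < n)%N by near: n; exists 1%N.
  have uI : I n u.
    rewrite /I /= in_itv /= -ler_norml ler_pdivlMr // -ler_pdivrMl ?pi_gt0 //.
    by near: n; exact: sqrtn_cvg_pinfty.
  by rewrite /= patchE mem_set.
- by apply: integrableRZ => //; exact: integrable_gauss.
- move=> n u; rewrite /f; case: ifP => [/andP[Mn n0]|_]; last first.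
    by rewrite normr0 mulr_ge0 ?expR_ge0.
  rewrite patchE; case: ifPn => [|_]; last by rewrite normr0 mulr_ge0 ?expR_ge0.
  rewrite inE /I /= in_itv /= -ler_norml => uI.
  apply: le_trans (Re_le_normc _) _; rewrite !Normc.normcM !normc_cis mul1r mulr1 normcXn.
  exact: (normc_char_pow_bound _ h0 K0 p0 span_le).
Unshelve. all: by end_near. Qed.

End with_tau.

End local_limit.

(** * The characteristic function of the rescaled counts *)

Section NC_charfun.
Variables (R : realType) (w : nat -> R) (p : probability nat R).
Local Notation Re := (@complex.Re R).
Local Notation "x %:C" := (real_complex R x).
Hypothesis w0 : w 0%N = 1.
Hypothesis w_equiv : equivalent_seq w (mass p).

Lemma sum_NC_words n : exists2 c : R, 0 < c & forall y : nat -> R[i], y 0%N = 1 ->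
  c%:C * \sum_(P in NC R n) (Omega w P)%:C * \prod_(B in P) y #|B| =
  \sum_(s in words n) \prod_i ((mass p (s i))%:C * y (s i)).
Proof.
have [a [b [a0 b0 pE]]] := w_equiv.
(* [n.+1] comes from the cycle lemma; passing from [w] to [p] multiplies a product over [n.+1]
   letters of sum [n] by [a ^+ n.+1 * b ^+ n]. *)
exists (n.+1%:R * (a ^+ n.+1 * b ^+ n)); first by rewrite !mulr_gt0 ?exprn_gt0 ?ltr0n.
move=> y y0; rewrite NC_comb.
have -> : \sum_(P in comb_NC n) (Omega w P)%:C * \prod_(B in P) y #|B| =
    \sum_(P in comb_NC n) \prod_(B in P) ((w #|B|)%:C * y #|B|).
  by apply: eq_bigr => P _; rewrite big_split /Omega rmorph_prod.
have := @sum_comb_NC n _ (fun r => (w r)%:C * y r).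
rewrite w0 y0 mulr1 => /(_ (rmorph1 _)) H.
rewrite rmorphM rmorph_nat mulrAC H mulrC mulr_sumr; apply: eq_bigr => s.
rewrite inE => /eqP ss.
rewrite !big_split /= mulrA; congr (_ * _).
rewrite -!rmorph_prod -rmorphM; congr (_%:C).
rewrite [RHS](eq_bigr (fun i => a * b ^+ (s i) * w (s i))) => [|i _]; last by rewrite pE.
by rewrite !big_split /= prodr_const card_ord prodrXr ss.
Qed.

Variables (k : nat) (A : 'I_k -> set nat).
Hypothesis A_pos : forall i, A i `<=` [set r | (0 < r)%N].

(** The coefficients [c] are free at this stage: the increments of a word with sum [n] add up to -1,
    so they shift the total by a constant. *)
Definition tau_of (theta c : 'I_k -> R) (r : nat) : R :=
  \sum_i theta i * ((r \in A i)%:R - fine (p (A i)) - c i * (r%:R - 1)).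

Lemma zeta_sum (B : set nat) n (P : {set {set 'I_n}}) :
  (zeta B P)%:R = \sum_(C in P) (#|C| \in B)%:R :> R.
Proof.
rewrite /zeta -sum1_card natr_sum [LHS]big_mkcond [RHS]big_mkcond /=.
by apply: eq_bigr => C _; rewrite inE; case: (C \in P) => //=; case: (_ \in B).
Qed.

(** [p (A i)] arises because [n.+1] letters are centred while the counts are centred by [n] terms,
    and [- c i] because the increments add up to -1. *)
Definition phase_shift (theta c : 'I_k -> R) : R :=
  \sum_i theta i * (fine (p (A i)) - c i).

Lemma NC_charfun_words (theta c : 'I_k -> R) (b : R) n : (0 < n)%N -> exists2 C : R, 0 < C &
  C * \sum_(P in NC R n) Omega w P = \sum_(s in words n) \prod_i mass p (s i) /\
  C * \sum_(P in NC R n) Omega w P * cos (b + \sum_i theta i * scaled_counts p A P 0 i) =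
  Re (cis (b + phase_shift theta c / Num.sqrt n%:R) *
    \sum_(s in words n) \prod_i ((mass p (s i))%:C * cis (tau_of theta c (s i) / Num.sqrt n%:R))).
Proof.
move=> n0; have [C C0 CE] := sum_NC_words n; exists C => //; split.
  have := CE (fun=> 1) erefl.
  rewrite (eq_bigr (fun P => (Omega w P)%:C)) => [|P _]; last by rewrite big1 ?mulr1.
  rewrite -rmorph_sum -rmorphM [RHS](_ : _ = (\sum_(s in words n) \prod_i mass p (s i))%:C).
    by move=> /(congr1 Re).
  by rewrite rmorph_sum; apply: eq_bigr => s _; rewrite rmorph_prod; apply: eq_bigr =>
    i _; rewrite mulr1.
set k0 := Num.sqrt n%:R; have k0_gt0 : 0 < k0 by rewrite sqrtr_gt0 ltr0n.
have kE : n%:R = k0 ^+ 2 by rewrite sqr_sqrtr.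
pose g r : R := \sum_i theta i * (r \in A i)%:R.
(* Positions that are not block minima carry the letter 0 and must not be counted: the sets [A i]
   avoid 0. *)
have g0 : g 0%N = 0.
  rewrite /g big1 // => i _; rewrite memNset ?mulr0 // => /A_pos; by [].
pose thp := \sum_i theta i * fine (p (A i)); pose thc := \sum_i theta i * c i.
have CEg := CE (fun r => cis (g r / k0)) _.
have {}CEg := CEg (_ : cis (g 0%N / k0) = 1).
rewrite g0 mul0r cis0 in CEg; have {}CEg := CEg erefl.
have tauE r : tau_of theta c r = g r - thp - thc * (r%:R - 1).
  rewrite /tau_of /g /thp /thc mulr_suml -!sumrB; apply: eq_bigr => i _; ring.
have words_tau s : s \in words n ->
    \prod_i ((mass p (s i))%:C * cis (g (s i) / k0)) =
    cis (((n%:R + 1) * thp - thc) / k0) * \prod_i ((mass p (s i))%:C *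
      cis (tau_of theta c (s i) / k0)).
  rewrite inE => /eqP ss; rewrite !big_split /= mulrCA; congr (_ * _).
  rewrite -!cis_sum -cisD; congr cis; rewrite -!mulr_suml -mulrDl; congr (_ / _).
  rewrite [in RHS](eq_bigr _ (fun i _ => tauE (s i))) !sumrB -mulr_sumr sumrB !sumr_const card_ord.
  rewrite -natr_sum ss -mulr_natr -[n.+1%:R]natr1; ring.
have PE (P : {set {set 'I_n}}) : \prod_(B in P) cis (g #|B| / k0) =
    cis ((\sum_i theta i * (zeta (A i) P)%:R) / k0).
  rewrite -cis_sum -mulr_suml; congr (cis (_ / _)).
  rewrite /g exchange_big /=; apply: eq_bigr => i _.
  by rewrite -mulr_sumr zeta_sum.
have VE (P : {set {set 'I_n}}) : \sum_i theta i * scaled_counts p A P 0 i =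
    (\sum_i theta i * (zeta (A i) P)%:R) / k0 - thp * n%:R / k0.
  rewrite /thp !mulr_suml -sumrB; apply: eq_bigr => i _; rewrite mxE -/k0.
  by field; rewrite gt_eqF.
rewrite (eq_bigr _ words_tau) -mulr_sumr in CEg.
transitivity (Re (cis (b - thp * n%:R / k0) *
    (C%:C * \sum_(P in NC R n) (Omega w P)%:C * \prod_(B in P) cis (g #|B| / k0)))).
  rewrite mulrCA Re_scale; congr (_ * _); rewrite mulr_sumr Re_sum; apply: eq_bigr => P _.
  by rewrite mulrCA Re_scale PE -cisD VE; congr (_ * cos _); ring.
rewrite CEg mulrA -cisD; congr (Re (cis _ * _)).
have -> : phase_shift theta c = thp - thc.
  by rewrite /phase_shift /thp /thc -sumrB; apply: eq_bigr => i _; rewrite mulrBr.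
by field; rewrite gt_eqF.
Qed.

Hypothesis w_gt0 : exists2 i, (2 <= i)%N & 0 < w i.
Variable sigma2 : R.
Local Notation E g := (\int[p]_r g r).
Local Notation integ g := (p.-integrable setT (EFin \o g)).
Hypothesis incr2_int : integ (fun r => incr R r ^+ 2).
Hypothesis incr_mean : E (incr R) = 0.
Hypothesis incr_var : E (fun r => incr R r ^+ 2) = sigma2.
Hypothesis sigma2_gt0 : 0 < sigma2.

Lemma well_defined_words n : well_defined w n ->
  0 < \sum_(s in words n) \prod_i mass p (s i).
Proof.
move=> [n0]; have [C C0 [<- _]] := NC_charfun_words (fun=> 0) (fun=> 0) 0 n0.
by move=> Z0; rewrite mulr_gt0.
Qed.

(** Some word with sum [n] has nonzero weight, and all its letters are multiples of [h]. *)
Lemma well_defined_dvd h n : (forall r, mass p r != 0 -> (h %| r)%N) ->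
  well_defined w n -> (h %| n)%N.
Proof.
move=> hp /well_defined_words W0.
have [s sw Ws] : exists2 s, s \in words n & \prod_i mass p (s i) != 0.
  apply: contrapT => H; move: W0; rewrite big1 ?ltxx // => s sw.
  by apply/eqP/negPn/negP => Ws; apply: H; exists s.
move: sw; rewrite inE => /eqP <-; apply: dvdn_sum => i _; apply: hp.
by apply: contraNneq Ws => pi0; rewrite (bigD1 i) //= pi0 mul0r.
Qed.

(** Numerator and partition function carry the same constants, so their quotient is that of two
    Fourier integrals, the second with [tau = 0] and phase 0. The factor [gauss_mass sigma2] of both
    limits cancels too. *)
Lemma NC_charfun_cvg (theta c : 'I_k -> R) (b v : R) :
  integ (fun r => tau_of theta c r ^+ 2) -> E (tau_of theta c) = 0 ->
  E (fun r => tau_of theta c r * incr R r) = 0 ->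
  E (fun r => tau_of theta c r ^+ 2) = v ->
  \sum_(P in NC R n) sg_prob w P * cos (b + \sum_i theta i * scaled_counts p A P 0 i)
    @[n --> within (well_defined w) \oo] --> cos b * expR (- (v / 2)).
Proof.
move=> t2 t1 ti tv; have [a [b' [a0 b0 pE]]] := w_equiv.
have p0 : 0 < mass p 0 by rewrite pE w0 expr0 !mulr1.
have [r0 r02 wr0] := w_gt0.
have pr0 : mass p r0 != 0 by rewrite pE !mulf_neq0 ?expf_neq0 ?gt_eqF.
have [h [M [K [h0 K0 hp span_le]]]] := support_span (mass_ge0 p) (ltnW r02) pr0.
pose b_ n := b + phase_shift theta c / Num.sqrt n%:R.
have b_cvg : b_ n @[n --> \oo] --> b.
  apply: (@cvg_of_sqrt_bound R _ _ `|phase_shift theta c|) => n n0.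
  by rewrite /b_ addrAC subrr add0r normrM normfV (ger0_norm (sqrtr_ge0 _)).
have zmean : E (fun=> 0 : R) = 0 by exact: (Rintegral_prob_cst p 0).
have zint : integ (fun=> 0 : R) by apply: (@integ_bounded _ _ _ 0) => r; rewrite normr0.
have J1 := fourier_integral_cvg incr2_int incr_mean incr_var sigma2_gt0 t2 t1 ti tv b_cvg h0 K0
  p0 span_le.
have J0 : fourier_integral p (fun=> 0) (fun=> 0) h n @[n --> \oo] --> gauss_mass sigma2.
  have := @fourier_integral_cvg R p sigma2 incr2_int incr_mean incr_var sigma2_gt0
    (fun=> 0) 0 0 (fun=> 0) h _ zmean _ _ (cvg_cst 0) M K h0 K0 p0 span_le.
  rewrite mul0r oppr0 expR0 cos0 !mul1r; apply.
  - by rewrite (_ : (fun r => 0 ^+ 2) = fun=> 0) //; apply/funext => r; rewrite expr0n.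
  - by rewrite -[RHS]zmean; apply: eq_Rintegral => r _; rewrite mul0r.
  - by rewrite -[RHS]zmean; apply: eq_Rintegral => r _; rewrite expr0n.
have G0 := gauss_mass_gt0 sigma2_gt0.
apply: (@cvg_trans _ (fourier_integral p (tau_of theta c) b_ h n / fourier_integral p (fun=> 0)
  (fun=> 0) h n @[n --> within (well_defined w) \oo])).
  apply: near_eq_cvg; rewrite near_withinE; apply: nearW => n wn.
  have [n0 Z0] := wn; have hn := well_defined_dvd hp wn; have W0 := well_defined_words wn.
  have k0 : 0 < Num.sqrt n%:R :> R by rewrite sqrtr_gt0 ltr0n.
  have [C C0 [CZ CE]] := NC_charfun_words theta c b n0.
  rewrite /fourier_integral /fourier_integrand.
  rewrite (@fourier_inversion R (mass p) (fun r =>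
    tau_of theta c r / Num.sqrt n%:R) n _ (b_ n) h) //.
  rewrite (@fourier_inversion R (mass p) (fun r => 0 / Num.sqrt n%:R) n _ 0 h) //.
  have -> : Re (cis 0 * \sum_(s in words n) \prod_i ((mass p (s i))%:C * cis (0 / Num.sqrt n%:R))) =
      \sum_(s in words n) \prod_i mass p (s i).
    rewrite cis0 mul1r -[RHS]/(Re (_%:C)) rmorph_sum; congr Re; apply: eq_bigr => s _.
    by rewrite rmorph_prod; apply: eq_bigr => i _; rewrite mul0r cis0 mulr1.
  rewrite -CE -CZ.
  have L0 : 0 < pi * Num.sqrt n%:R / h%:R :> R by rewrite !mulr_gt0 ?pi_gt0 ?invr_gt0 ?ltr0n.
  set L := pi * _ / _ in L0 *; rewrite -/(partition_function w n) in Z0 *.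
  have -> : \sum_(P in NC R n) sg_prob w P * cos (b + \sum_i theta i * scaled_counts p A P 0 i) =
      (\sum_(P in NC R n) Omega w P * cos (b + \sum_i theta i *
        scaled_counts p A P 0 i)) / partition_function w n.
    by rewrite mulr_suml; apply: eq_bigr => P _; rewrite /sg_prob mulrAC.
  set S := \sum_(P in NC R n) _; set Z := partition_function w n in Z0 *.
  by field; rewrite !gt_eqF.
rewrite -[cos b * _](mulfK (lt0r_neq0 G0)).
apply: cvg_trans; first by apply: cvg_app; exact: cvg_within.
by apply: cvgM => //; apply: cvgV => //; rewrite gt_eqF.
Qed.

End NC_charfun.

(** * Trigonometric approximation and the continuity theorem *)

Section bernstein.
Variable R : realType.
Implicit Types (u : R) (phi : nat -> R).

Definition bernstein N u (j : nat) : R := 'C(N, j)%:R * u ^+ j * (1 - u) ^+ (N - j).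

(** Conditioning on one trial: a binomial variable with [N.+1] trials is one with [N] trials plus an
    independent Bernoulli variable. *)
Lemma bernsteinS N u phi :
  \sum_(j < N.+2) phi j * bernstein N.+1 u j =
  u * (\sum_(j < N.+1) phi j.+1 * bernstein N u j) +
  (1 - u) * (\sum_(j < N.+1) phi j * bernstein N u j).
Proof.
have E j : (j <= N.+1)%N -> bernstein N.+1 u j =
    (if j is j'.+1 then u * bernstein N u j' else 0) +
      (1 - u) * (if (j <= N)%N then bernstein N u j else 0).
  case: j => [_|j jN]; rewrite /bernstein.
    by rewrite leq0n !bin0 !subn0 [(1 - u) ^+ N.+1]exprS; ring.
  rewrite binS natrD subSS !exprS; case: ltnP => jN'; last by rewrite bin_small //; ring.
  have -> : (1 - u) ^+ (N - j) = (1 - u) * (1 - u) ^+ (N - j.+1).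
    by rewrite -exprS; congr (_ ^+ _); lia.
  by ring.
rewrite (eq_bigr (fun j : 'I_N.+2 => phi j * (if (j : nat) is j'.+1 then u *
  bernstein N u j' else 0)
  + phi j * ((1 - u) * (if (j <= N)%N then bernstein N u j else 0)))); last first.
  move=> j _; rewrite E; last by rewrite -ltnS.
  by rewrite mulrDr.
rewrite big_split /= big_ord_recl /= mulr0 add0r [X in _ + X]big_ord_recr /= ltnn !mulr0 addr0.
rewrite !mulr_sumr; congr (_ + _); apply: eq_bigr => j _; first by ring.
by rewrite -ltnS ltn_ord; ring.
Qed.

Lemma bernstein_sum N u : \sum_(j < N.+1) bernstein N u j = 1.
Proof.
have E M : \sum_(j < M.+1) bernstein M u j = \sum_(j < M.+1) 1 * bernstein M u j.
  by apply: eq_bigr => j _; rewrite mul1r.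
elim: N => [|N IH]; first by rewrite big_ord1 /bernstein bin0 !expr0 !mulr1.
by rewrite E (bernsteinS N u (fun=> 1)) -!E IH !mulr1 addrC subrK.
Qed.

Lemma bernstein_ge0 N u j : 0 <= u <= 1 -> 0 <= bernstein N u j.
Proof.
by move=> /andP[u0 u1]; rewrite !mulr_ge0 ?exprn_ge0 // subr_ge0.
Qed.

Lemma bernstein_var N u :
  \sum_(j < N.+1) (j%:R - N%:R * u) * bernstein N u j = 0 /\
  \sum_(j < N.+1) (j%:R - N%:R * u) ^+ 2 * bernstein N u j = N%:R * (u * (1 - u)).
Proof.
elim: N => [|N [IH1 IH2]]; first by rewrite !big_ord1 !mul0r subrr expr0n /= !mul0r.
have S1 := bernstein_sum N u.
rewrite (bernsteinS N u (fun j => j%:R - N.+1%:R * u)) (bernsteinS N u (fun j =>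
  (j%:R - N.+1%:R * u) ^+ 2)).
have sh1 (a b : R) (M := \sum_(j < N.+1) (j%:R - N%:R * u) * bernstein N u j) :
  \sum_(j < N.+1) ((j%:R - N%:R * u) + a) * bernstein N u j = a.
  rewrite (eq_bigr _ (fun j _ => mulrDl _ _ _)) big_split /= IH1 -mulr_sumr S1; ring.
have sh2 (a : R) : \sum_(j < N.+1) ((j%:R - N%:R * u) + a) ^+ 2 * bernstein N u j
    = N%:R * (u * (1 - u)) + a ^+ 2.
  rewrite (eq_bigr (fun j : 'I_N.+1 => (j%:R - N%:R * u) ^+ 2 * bernstein N u j +
    (2 * a) * ((j%:R - N%:R * u) * bernstein N u j) + a ^+ 2 * bernstein N u j));
      last by move=> j _; ring.
  by rewrite !big_split /= -!mulr_sumr IH1 IH2 S1; ring.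
split.
  rewrite [X in u * X](eq_bigr (fun j : 'I_N.+1 =>
    ((j%:R - N%:R * u) + (1 - u)) * bernstein N u j)); last first.
    by move=> j _; rewrite -!natr1; ring.
  rewrite [X in (1 - u) * X](eq_bigr (fun j : 'I_N.+1 =>
    ((j%:R - N%:R * u) + (- u)) * bernstein N u j)); last first.
    by move=> j _; rewrite -!natr1; ring.
  by rewrite !sh1 //; ring.
rewrite [X in u * X](eq_bigr (fun j : 'I_N.+1 =>
  ((j%:R - N%:R * u) + (1 - u)) ^+ 2 * bernstein N u j)); last first.
  by move=> j _; rewrite -!natr1; ring.
rewrite [X in (1 - u) * X](eq_bigr (fun j : 'I_N.+1 =>
  ((j%:R - N%:R * u) + (- u)) ^+ 2 * bernstein N u j)); last first.
  by move=> j _; rewrite -!natr1; ring.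
by rewrite !sh2 -natr1; ring.
Qed.

(** Chebyshev's inequality, with [u * (1 - u) <= 1]. *)
Lemma bernstein_tail N u (eta : R) : (0 < N)%N -> 0 <= u <= 1 -> 0 < eta ->
  \sum_(j < N.+1) (eta <= `|j%:R / N%:R - u|)%R%:R * bernstein N u j <= (N%:R * eta ^+ 2)^-1.
Proof.
move=> N0 u01 eta0; have NR : 0 < N%:R :> R by rewrite ltr0n.
have b0 j := bernstein_ge0 N j u01.
apply: (@le_trans _ _ (\sum_(j < N.+1) (N%:R * eta) ^- 2 * ((j%:R - N%:R * u) ^+ 2 *
  bernstein N u j))).
  apply: ler_sum => j _; rewrite [leRHS]mulrA ler_wpM2r //.
  have -> : (N%:R * eta) ^- 2 * (j%:R - N%:R * u) ^+ 2 = ((j%:R / N%:R - u) / eta) ^+ 2.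
    by field; rewrite !gt_eqF.
  have [h|_] := leP eta `|j%:R / N%:R - u|; last exact: sqr_ge0.
  rewrite -(real_normK (num_real (_ / eta))) exprn_ege1 // normrM normfV (gtr0_norm eta0).
  by rewrite ler_pdivlMr // mul1r.
rewrite -mulr_sumr (bernstein_var N u).2.
have -> : (N%:R * eta) ^- 2 * (N%:R * (u * (1 - u))) = (u * (1 - u)) * (N%:R * eta ^+ 2)^-1.
  by field; rewrite !gt_eqF.
rewrite ler_piMl ?invr_ge0 ?mulr_ge0 ?sqr_ge0 // ?ltW //.
by case/andP: u01 => u0 u1; nra.
Qed.

End bernstein.

Section unif_continuity.
Variables (R : realType) (k : nat).

(** The point [y] may leave the cube, so the covering argument is run on [x] alone, with halved
    radii. *)
Lemma unif_continuity_cube (f : 'rV[R]_k -> R) (A eps : R) : continuous f -> 0 < eps ->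
  exists2 eta, 0 < eta & forall x y : 'rV[R]_k, (forall i, `|x 0 i| <= A) ->
    (forall i, `|x 0 i - y 0 i| < eta) -> `|f x - f y| < eps.
Proof.
move=> cf eps0.
pose K := [set x : 'rV[R]_k | forall i, `[-A, A]%classic (x 0 i)].
have cK : compact K.
  by apply: (@rV_compact R k (fun=> `[-A, A]%classic)) => i; exact: segment_compact.
pose P (eta : R) (x : 'rV[R]_k) := forall y : 'rV[R]_k, (forall i,
  `|x 0 i - y 0 i| < eta) -> `|f x - f y| < eps.
have /(_ R 0^'+ P) H := (compact_near_coveringP K).1 cK.
have [|e /= e0 He] := H _.
  move=> x Kx.
  have /cvgrPdist_lt/(_ (eps / 2)) := cf x.
  rewrite divr_gt0 // => /(_ isT) /nbhs_ballP [d /= d0 Hd].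
  exists (ball x (d / 2), [set t | 0 < t < d / 2]) => /=.
    split; first by apply: nbhsx_ballx; rewrite divr_gt0.
    exists (d / 2); first by rewrite /= divr_gt0.
    by move=> t /=; rewrite sub0r normrN => td t0; rewrite t0 (le_lt_trans (ler_norm t)).
  move=> [x' t] /= [[_ bx] /andP[t0 td]] y xy.
  have Bx' : `|f x - f x'| < eps / 2.
    by apply: Hd; split=> // i j; apply: lt_le_trans (bx i j) _; lra.
  have By : `|f x - f y| < eps / 2.
    apply: Hd; split=> // i j; have b1 : `|x i j - x' i j| < d / 2 := bx i j; have b2 := xy j.
    rewrite (ord1 i) in b1 *; rewrite /ball /=.
    rewrite (_ : x 0 j - y 0 j = (x 0 j - x' 0 j) + (x' 0 j - y 0 j)); last by ring.
    by apply: le_lt_trans (ler_normD _ _) _; lra.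
  rewrite (_ : f x' - f y = (f x - f y) - (f x - f x')); last by ring.
  by apply: le_lt_trans (ler_normB _ _) _; lra.
exists (e / 2); first by rewrite divr_gt0.
move=> x y xA xy; apply: (He (e / 2)) => //=.
- by rewrite sub0r normrN gtr0_norm ?divr_gt0 //; lra.
- by rewrite divr_gt0.
- by move=> i; rewrite /= in_itv /= -ler_norml.
Qed.

End unif_continuity.

(** * The algebra of trigonometric polynomials *)

Section trigpoly.
Variables (R : realType) (k : nat).
Implicit Types (f g : 'rV[R]_k -> R) (x : 'rV[R]_k).

(** Arbitrary finite index types let sums and products be indexed by sum and product types. *)
Definition trigpoly f := exists (I : finType) (a b : I -> R) (theta : I -> 'I_k -> R),
  forall x, f x = \sum_j a j * cos (b j + \sum_i theta j i * x 0 i).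

Lemma trigpoly_ext f g : f =1 g -> trigpoly f -> trigpoly g.
Proof. by move=> fg [I [a [b [th H]]]]; exists I, a, b, th => x; rewrite -fg. Qed.

Lemma trigpoly_cos (b : R) (theta : 'I_k -> R) :
  trigpoly (fun x => cos (b + \sum_i theta i * x 0 i)).
Proof. by exists 'I_1, (fun=> 1), (fun=> b), (fun=> theta) => x; rewrite big_ord1 mul1r. Qed.

Lemma trigpolyZ (c : R) f : trigpoly f -> trigpoly (fun x => c * f x).
Proof.
move=> [I [a [b [th H]]]]; exists I, (fun j => c * a j), b, th => x.
by rewrite H mulr_sumr; apply: eq_bigr => j _; rewrite mulrA.
Qed.

Lemma trigpolyD f g : trigpoly f -> trigpoly g -> trigpoly (fun x => f x + g x).
Proof.
move=> [I [a [b [th H]]]] [J [a' [b' [th' H']]]].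
exists (I + J)%type, (fun j => match j with inl j => a j | inr j => a' j end),
  (fun j => match j with inl j => b j | inr j => b' j end),
  (fun j => match j with inl j => th j | inr j => th' j end) => x.
by rewrite H H' big_sumType.
Qed.

(** Product-to-sum formula; the boolean index selects the sum or the difference of the phases. *)
Lemma trigpolyM f g : trigpoly f -> trigpoly g -> trigpoly (fun x => f x * g x).
Proof.
move=> [I [a [b [th H]]]] [J [a' [b' [th' H']]]].
pose sg (e : bool) : R := if e then 1 else - 1.
exists (I * J * bool)%type, (fun t => a t.1.1 * a' t.1.2 / 2),
  (fun t => b t.1.1 + sg t.2 * b' t.1.2),
  (fun t i => th t.1.1 i + sg t.2 * th' t.1.2 i) => x.
rewrite H H' big_distrlr /= pair_big /=.
rewrite -(pair_bigA _ (fun (t : I * J) (e : bool) => a t.1 * a' t.2 / 2 *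
  cos (b t.1 + sg e * b' t.2 + \sum_i (th t.1 i + sg e * th' t.2 i) * x 0 i))) /=.
apply: eq_bigr => -[i j] _ /=; rewrite big_bool /= !mul1r !mulN1r.
set u := b i + _; set v := b' j + _.
have lin (c : R) : \sum_l (th i l + c * th' j l) * x 0 l =
    \sum_l th i l * x 0 l + c * \sum_l th' j l * x 0 l.
  by rewrite mulr_sumr -big_split; apply: eq_bigr => l _ /=; ring.
rewrite !lin.
have -> : b i + b' j + (\sum_l th i l * x 0 l + 1 * \sum_l th' j l * x 0 l) = u + v.
  by rewrite /u /v; ring.
have -> : b i - b' j + (\sum_l th i l * x 0 l + -1 * \sum_l th' j l * x 0 l) = u - v.
  by rewrite /u /v; ring.
by rewrite cosD cosB; field.
Qed.

Lemma trigpoly_cst (c : R) : trigpoly (fun=> c).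
Proof.
apply: trigpoly_ext (trigpolyZ c (trigpoly_cos 0 (fun=> 0))) => x.
by rewrite big1 ?addr0 ?cos0 ?mulr1 // => i _; rewrite mul0r.
Qed.

Lemma trigpoly_sin (i : 'I_k) (c : R) : trigpoly (fun x => sin (c * x 0 i)).
Proof.
apply: trigpoly_ext (trigpoly_cos (- (pi / 2)) (fun j => if j == i then c else 0)) => x.
rewrite (bigD1 i) //= eqxx big1 ?addr0 => [|j /negbTE ->]; last by rewrite mul0r.
by rewrite addrC cosBpihalf.
Qed.

Lemma trigpoly_sum (I : Type) (s : seq I) (F : I -> 'rV[R]_k -> R) :
  (forall i, trigpoly (F i)) -> trigpoly (fun x => \sum_(i <- s) F i x).
Proof.
move=> HF; elim: s => [|i s IH].
  by apply: trigpoly_ext (trigpoly_cst 0) => x; rewrite big_nil.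
by apply: trigpoly_ext (trigpolyD (HF i) IH) => x; rewrite big_cons.
Qed.

Lemma trigpoly_prod (I : Type) (s : seq I) (F : I -> 'rV[R]_k -> R) :
  (forall i, trigpoly (F i)) -> trigpoly (fun x => \prod_(i <- s) F i x).
Proof.
move=> HF; elim: s => [|i s IH].
  by apply: trigpoly_ext (trigpoly_cst 1) => x; rewrite big_nil.
by apply: trigpoly_ext (trigpolyM (HF i) IH) => x; rewrite big_cons.
Qed.

Lemma trigpolyX f m : trigpoly f -> trigpoly (fun x => f x ^+ m).
Proof.
move=> Hf; elim: m => [|m IH].
  by apply: trigpoly_ext (trigpoly_cst 1) => x; rewrite expr0.
by apply: trigpoly_ext (trigpolyM Hf IH) => x; rewrite exprS.
Qed.

End trigpoly.

Section trig_approx.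
Variables (R : realType).

Lemma pihalf_gt1 : 1 < pi / 2 :> R.
Proof.
rewrite lt_neqAle pihalf_ge1 andbT; apply: contraTneq (@cos1_gt0 R) => ->.
by rewrite cos_pihalf ltxx.
Qed.

(** The derivative of the inverse sine blows up at the ends, but [b] stays away from them since
    [1 < pi / 2]. The midpoint of [a] and [b] is then at most [m < pi / 2] in absolute value, so its
    cosine is at least [cos m]. *)
Lemma sin_dist_lower : exists2 kappa : R, 0 < kappa & forall a b : R,
  `|a| <= pi / 2 -> `|b| <= 1 -> kappa * `|a - b| <= `|sin a - sin b|.
Proof.
have p1 := pihalf_gt1; pose m : R := (pi / 2 + 1) / 2.
have cm : 0 < cos m by apply: cos_gt0_pihalf; rewrite /m; lra.
exists (cos m / 3); first by rewrite divr_gt0.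
move=> a b ha hb.
have -> : sin a - sin b = 2 * cos ((a + b) / 2) * sin ((a - b) / 2).
  have -> : sin a = sin ((a + b) / 2 + (a - b) / 2) by congr sin; lra.
  have -> : sin b = sin ((a + b) / 2 - (a - b) / 2) by congr sin; lra.
  by rewrite (sinD ((a + b) / 2)) (sinB ((a + b) / 2)); ring.
have hs : `|(a + b) / 2| <= m.
  by rewrite normrM (ger0_norm (_ : 0 <= 2^-1)) // ler_pM2r // (le_trans (ler_normD _ _)) // lerD.
have hd : `|(a - b) / 2| <= m.
  by rewrite normrM (ger0_norm (_ : 0 <= 2^-1)) // ler_pM2r // (le_trans (ler_normB _ _)) // lerD.
have hc : cos m <= cos ((a + b) / 2).
  rewrite -(cos_norm ((a + b) / 2)) leNgt; apply/negP.
  rewrite ltr_cos ?in_itv /= ?normr_ge0 //=; first by rewrite ltNge hs.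
  - by rewrite /m; have := @pi_ge2 R; lra.
  - by rewrite (le_trans hs) // /m; have := @pi_ge2 R; lra.
have hsin : `|(a - b) / 2| / 3 <= `|sin ((a - b) / 2)|.
  set y := (a - b) / 2 in hd *.
  have -> : `|sin y| = sin `|y|.
    have yp : `|y| <= pi by apply: le_trans hd _; rewrite /m; have := @pi_ge2 R; lra.
    have s0 : 0 <= sin `|y| by apply: sin_ge0_pi; rewrite normr_ge0.
    rewrite -[RHS](ger0_norm s0).
    by have [y0|y0] := leP 0 y; [rewrite (ger0_norm y0) | rewrite (ltr0_norm y0) sinN normrN].
  by apply: jordan_sin; rewrite normr_ge0 (le_trans hd) // /m; lra.
rewrite !normrM (ger0_norm (_ : 0 <= 2)) // (ger0_norm (le_trans (ltW cm) hc)).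
have -> : cos m / 3 * `|a - b| = 2 * cos m * (`|(a - b) / 2| / 3).
  by rewrite normrM (ger0_norm (_ : 0 <= 2^-1)) //; field.
by apply: ler_pM; rewrite ?mulr_ge0 ?divr_ge0 ?(ltW cm) // ler_pM2l.
Qed.

Variable k : nat.

(** Under the product of the weights [c l], the coordinate [q i] has law [c i]. *)
Lemma sum_ffun_marginal N (c : 'I_k -> 'I_N -> R) (i : 'I_k) (phi : 'I_N -> R) :
  (forall l, \sum_j c l j = 1) ->
  \sum_(q : {ffun 'I_k -> 'I_N}) phi (q i) * \prod_l c l (q l) = \sum_j phi j * c i j.
Proof.
move=> c1; transitivity (\prod_l \sum_j (if l == i then phi j else 1) * c l j).
  rewrite bigA_distr_bigA; apply: eq_bigr => q _; rewrite big_split /=; congr (_ * _).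
  by rewrite (bigD1 i) //= eqxx big1 ?mulr1 // => l /negbTE ->.
rewrite (bigD1 i) //= eqxx [X in _ * X]big1 ?mulr1 // => l /negbTE ->.
by rewrite -[RHS](c1 l); apply: eq_bigr => j _; rewrite mul1r.
Qed.

Lemma sum_ffun_prod N (c : 'I_k -> 'I_N -> R) : (forall l, \sum_j c l j = 1) ->
  \sum_(q : {ffun 'I_k -> 'I_N}) \prod_l c l (q l) = 1.
Proof.
by move=> c1; rewrite -(bigA_distr_bigA c) big1.
Qed.

(* The Bernstein operator in the variables u_i = (1 + sin (x_i / A)) / 2 gives a
   trigonometric polynomial that is bounded by B everywhere, not only on the
   cube, because its weights are nonnegative and add up to 1. *)
Lemma trigpoly_approx (f : 'rV[R]_k -> R) (A B eps : R) : 0 < A -> 0 < eps ->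
  continuous f -> (forall x, `|f x| <= B) ->
  exists tau, [/\ trigpoly tau, forall x, `|tau x| <= B &
    forall x : 'rV[R]_k, (forall i, `|x 0 i| <= A) -> `|f x - tau x| <= eps].
Proof.
move=> A0 eps0 cf fB.
have B0 : 0 <= B by apply: le_trans (fB 0).
have [eta0 eta0_gt0 fU] := unif_continuity_cube A cf (divr_gt0 eps0 (ltr0Sn R 1)).
have [kappa k0 sin_low] := sin_dist_lower.
(* Values of [u] closer than [eta] give sines closer than [2 * eta], hence by [sin_dist_lower]
   points closer than [eta0] after scaling by [A]. *)
pose eta := eta0 * kappa / (2 * A).
have eta_gt0 : 0 < eta by rewrite divr_gt0 ?mulr_gt0.
(* [N > C] brings the union bound over the [k] coordinates, [2 * B * k / (N * eta ^+ 2)], below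
   [eps / 2]. *)
pose C := 4 * B * k%:R / eta ^+ 2 / eps.
have C0 : 0 <= C by rewrite !mulr_ge0 ?invr_ge0 ?sqr_ge0 // ltW.
pose N := (Num.truncn C).+1.
have NC : C < N%:R by exact: truncnS_gt.
have NR : 0 < N%:R :> R by rewrite ltr0n.
pose u (x : 'rV[R]_k) i : R := (1 + sin (A^-1 * x 0 i)) / 2.
have u01 x i : 0 <= u x i <= 1.
  by rewrite /u; have := sin_geN1 (A^-1 * x 0 i); have := sin_le1 (A^-1 * x 0 i); lra.
(* Inverse images under [u] of the grid points [j / N]. *)
pose node (q : {ffun 'I_k -> 'I_N.+1}) : 'rV[R]_k := \row_i (A * asin (2 * (q i)%:R / N%:R - 1)).
pose wt x (q : {ffun 'I_k -> 'I_N.+1}) := \prod_i bernstein N (u x i) (q i).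
have wt0 x q : 0 <= wt x q by apply: prodr_ge0 => i _; exact: bernstein_ge0.
have bs1 x l : \sum_j bernstein N (u x l) (j : 'I_N.+1) = 1 by exact: bernstein_sum.
have wt1 x : \sum_q wt x q = 1 by exact: (sum_ffun_prod (bs1 x)).
exists (fun x => \sum_q f (node q) * wt x q); split.
- apply: trigpoly_sum => q; apply: trigpolyZ; apply: trigpoly_prod => i.
  rewrite /bernstein /u; apply: trigpolyM.
    apply: trigpolyZ; apply: trigpolyX.
    apply: trigpoly_ext (trigpolyZ 2^-1 (trigpolyD (trigpoly_cst k 1) (trigpoly_sin i A^-1))) => x.
    by rewrite mulrC.
  apply: trigpolyX.
  apply: trigpoly_ext (trigpolyD (trigpoly_cst k 2^-1) (trigpolyZ (- 2^-1) (trigpoly_sin i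
    A^-1))) => x.
  by lra.
- move=> x; apply: le_trans (ler_norm_sum _ _ _) _.
  apply: (@le_trans _ _ (\sum_q B * wt x q)); last by rewrite -mulr_sumr wt1 mulr1.
  by apply: ler_sum => q _; rewrite normrM (ger0_norm (wt0 x q)) ler_wpM2r.
- move=> x xA.
  pose bad (j : 'I_N.+1) i : R := (eta <= `|(j : nat)%:R / N%:R - u x i|)%R%:R.
  have bad0 j i : 0 <= bad j i by exact: ler0n.
  have close q : `|f x - f (node q)| <= eps / 2 + 2 * B * \sum_i bad (q i) i.
    have [[i bi]|nobad] := pselect (exists i, eta <= `|(q i)%:R / N%:R - u x i|).
      apply: (@le_trans _ _ (2 * B)).
        by apply: le_trans (ler_normB _ _) _; have := fB x; have := fB (node q); lra.
      apply: (@le_trans _ _ (2 * B * \sum_i bad (q i) i)).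
        rewrite ler_peMr ?mulr_ge0 // (bigD1 i) //= /bad bi lerDl.
        by apply: sumr_ge0 => l _; exact: bad0.
      by rewrite lerDr divr_ge0 // ltW.
    apply: (@le_trans _ _ (eps / 2)); last first.
      by rewrite lerDl !mulr_ge0 //; apply: sumr_ge0 => l _; exact: bad0.
    apply/ltW/fU => // i; rewrite mxE.
    have lt_eta : `|(q i)%:R / N%:R - u x i| < eta.
      by rewrite ltNge; apply/negP => bi; apply: nobad; exists i.
    set t := 2 * (q i)%:R / N%:R - 1.
    have t1 : -1 <= t <= 1.
      have qN : (q i)%:R / N%:R <= 1 :> R by rewrite ler_pdivrMr // mul1r ler_nat -ltnS.
      have q0 : 0 <= (q i)%:R / N%:R :> R by rewrite divr_ge0.
      by rewrite /t -mulrA; lra.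
    have xi : `|A^-1 * x 0 i| <= 1.
      by rewrite normrM normfV (gtr0_norm A0) mulrC ler_pdivrMr // mul1r.
    have at_ : `|asin t| <= pi / 2 by rewrite ler_norml asin_geNpi2 ?asin_lepi2.
    have := sin_low _ _ at_ xi; rewrite asinK ?in_itv //= => low.
    have E : t - sin (A^-1 * x 0 i) = 2 * ((q i)%:R / N%:R - u x i) by rewrite /t /u; lra.
    rewrite E normrM (ger0_norm (_ : 0 <= 2)) // in low.
    have -> : x 0 i - A * asin t = - (A * (asin t - A^-1 * x 0 i)).
      by field; rewrite gt_eqF.
    rewrite normrN normrM (gtr0_norm A0) -ltr_pdivlMl // -(ltr_pM2l k0).
    apply: le_lt_trans low _.
    have -> : kappa * (A^-1 * eta0) = 2 * eta by rewrite /eta; field; rewrite gt_eqF.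
    by rewrite ltr_pM2l.
  have -> : f x = \sum_q f x * wt x q by rewrite -mulr_sumr wt1 mulr1.
  rewrite -sumrB; apply: le_trans (ler_norm_sum _ _ _) _.
  apply: (@le_trans _ _ (\sum_(q : {ffun 'I_k -> 'I_N.+1}) (eps / 2 +
    2 * B * \sum_i bad (q i) i) * wt x q)).
    by apply: ler_sum => q _; rewrite -mulrBl normrM (ger0_norm (wt0 x q)) ler_wpM2r.
  rewrite (eq_bigr (fun q : {ffun 'I_k -> 'I_N.+1} =>
    eps / 2 * wt x q + 2 * B * \sum_i (bad (q i) i * wt x q))); last first.
    by move=> q _; rewrite mulrDl -mulr_suml [in RHS]mulrA.
  rewrite big_split /= -!mulr_sumr wt1 mulr1 exchange_big /=.
  rewrite (eq_bigr (fun i => \sum_(j < N.+1) bad j i * bernstein N (u x i) j)); last first.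
    by move=> i _; exact: (sum_ffun_marginal i (bad ^~ i) (bs1 x)).
  suff : 2 * B * \sum_(i < k) \sum_(j < N.+1) bad j i * bernstein N (u x i) j <= eps / 2 by lra.
  apply: (@le_trans _ _ (2 * B * \sum_(i < k) (N%:R * eta ^+ 2)^-1)).
    by rewrite ler_wpM2l ?mulr_ge0 //; apply: ler_sum => i _; exact: bernstein_tail.
  rewrite sumr_const card_ord -[_ *+ k]mulr_natr.
  have -> : 2 * B * ((N%:R * eta ^+ 2)^-1 * k%:R) = C * eps / 2 / N%:R.
    by rewrite /C; field; rewrite !gt_eqF.
  by rewrite ler_pdivrMr //; have := ler_wpM2l (ltW eps0) (ltW NC); lra.
Qed.

End trig_approx.

Section trig_laws.
Variables (R : realType) (k : nat).

(** The cubes exhaust the space and [B] does not depend on [m], so dominated convergence applies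
    under any law. *)
Lemma trigpoly_approx_seq (f : 'rV[R]_k -> R) (B : R) :
  continuous f -> (forall x, `|f x| <= B) ->
  exists tau : nat -> 'rV[R]_k -> R, [/\ forall m, trigpoly (tau m),
    forall m x, `|tau m x| <= B,
    forall m (x : 'rV[R]_k), (forall i, `|x 0 i| <= m.+1%:R) -> `|f x - tau m x| <= m.+1%:R^-1 &
    forall x, tau m x @[m --> \oo] --> f x].
Proof.
move=> cf fB.
have H m : exists tau, [/\ trigpoly tau, forall x, `|tau x| <= B &
    forall x : 'rV[R]_k, (forall i, `|x 0 i| <= m.+1%:R) -> `|f x - tau x| <= m.+1%:R^-1].
  by apply: trigpoly_approx; rewrite ?invr_gt0 ?ltr0n.
have [tau Htau] := choice H.
exists tau; split=> [m|m x|m x|x]; try by have [] := Htau m => *; eauto.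
apply/subr_cvg0; apply: (@le_cvg0 _ _ (@harmonic R)); last exact: cvg_harmonic.
exists (Num.truncn (\sum_i `|x 0 i|)).+1 => // m /= xm.
have [_ _ Hm] := Htau m; rewrite distrC; apply: Hm => i.
apply: (@le_trans _ _ (\sum_i `|x 0 i|)).
  by rewrite (bigD1 i) //= lerDl; apply: sumr_ge0.
by apply: ltW; apply: lt_le_trans (truncnS_gt _) _; rewrite ler_nat ltnW.
Qed.

Variables (d : measure_display) (T : measurableType d) (Pr : probability T R).
Variable X : T -> 'rV[R]_k.
Hypothesis mX : forall i, measurable_fun setT (fun t => X t 0 i).

Lemma measurable_cos_comp (b : R) (theta : 'I_k -> R) :
  measurable_fun setT (fun t => cos (b + \sum_i theta i * X t 0 i)).
Proof.
apply: measurableT_comp; first by apply: continuous_measurable_fun; exact: continuous_cos.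
apply: measurable_funD => //; apply: measurable_sum => i.
by apply: measurable_funM => //.
Qed.

Lemma measurable_trigpoly_comp (tau : 'rV[R]_k -> R) :
  trigpoly tau -> measurable_fun setT (tau \o X).
Proof.
move=> [I [a [b [th H]]]].
rewrite (_ : tau \o X = fun t => \sum_j a j * cos (b j + \sum_i th j i * X t 0 i)); last first.
  by apply/funext => t /=; rewrite H.
by apply: measurable_sum => j; apply: measurable_funM => //; exact: measurable_cos_comp.
Qed.

Lemma bounded_integrable (g : T -> R) (B : R) : measurable_fun setT g -> (forall t, `|g t| <= B) ->
  Pr.-integrable setT (EFin \o g).
Proof.
move=> mg gB; apply: (@integrable_dominated _ _ _ _ _ (cst B)) => //.
exact: finite_measure_integrable_cst.
Qed.

Lemma trigpoly_expectation (tau : 'rV[R]_k -> R) (I : finType) (a b : I -> R) (th : I -> 'I_k ->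
  R) :
  (forall x, tau x = \sum_j a j * cos (b j + \sum_i th j i * x 0 i)) ->
  \int[Pr]_t tau (X t) = \sum_j a j * \int[Pr]_t cos (b j + \sum_i th j i * X t 0 i).
Proof.
move=> H; have ci j : Pr.-integrable setT (EFin \o (fun t => cos (b j + \sum_i th j i * X t 0 i))).
  by apply: (@bounded_integrable _ 1); [exact: measurable_cos_comp | move=> t; exact: cos_max].
rewrite (@eq_Rintegral _ _ _ Pr _ (fun t => \sum_j a j * cos (b j + \sum_i th j i * X t 0 i)));
  last first.
  by move=> t _; rewrite H.
rewrite Rintegral_sum //; last by move=> j; apply: integrableRZ.
by apply: eq_bigr => j _; rewrite RintegralZl.
Qed.

Variables (f : 'rV[R]_k -> R) (B : R).
Hypotheses (cf : continuous f) (fB : forall x, `|f x| <= B).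

(** Only the coordinates of [X] are known to be measurable; [f \o X] is a pointwise limit of
    trigonometric polynomials in them. *)
Lemma measurable_continuous_comp : measurable_fun setT (f \o X).
Proof.
have [tau [tt _ _ tc]] := trigpoly_approx_seq cf fB.
apply: (@measurable_fun_cvg _ _ _ _ (fun m => tau m \o X)) => [m|t _]; last exact: tc.
exact: measurable_trigpoly_comp.
Qed.

Lemma trigpoly_expectation_cvg (tau : nat -> 'rV[R]_k -> R) :
  (forall m, trigpoly (tau m)) -> (forall m x, `|tau m x| <= B) ->
  (forall x, tau m x @[m --> \oo] --> f x) ->
  \int[Pr]_t tau m (X t) @[m --> \oo] --> \int[Pr]_t f (X t).
Proof.
move=> tt tB tc; apply: (@Rintegral_dct R _ _ Pr (fun m t => tau m (X t)) _ (cst B)).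
- by move=> m; exact: measurable_trigpoly_comp.
- exact: measurable_continuous_comp.
- by move=> t; exact: tc.
- exact: finite_measure_integrable_cst.
- by move=> m t; exact: tB.
Qed.

End trig_laws.

(** * Uniqueness of laws on the line *)

Section uniqueness.
Variable R : realType.

Lemma probability_itv_unique (P Q : probability R R) :
  (forall a : R, P `]-oo, a]%classic = Q `]-oo, a]%classic) -> forall A, measurable A -> P A = Q A.
Proof.
move=> PQ A mA.
apply: (@measure_unique _ R R (@ocitv R) (fun n => `]-n%:R, n%:R]%classic) _ _ _ _ P Q) => //.
- exact: ocitvI.
- by move=> n; exact: is_ocitv.
- apply/seteqP; split => // x _; exists (Num.truncn `|x|).+1 => //=.
  have := truncnS_gt `|x|; rewrite in_itv /= ltr_norml => /andP[-> h2] /=.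
  exact: ltW.
- move=> _ [[a b] _ <-] /=.
  have [ab|ba] := leP a b; last first.
    by rewrite set_itv_ge ?measure0// bnd_simp -leNgt ltW.
  have -> : `]a, b]%classic = `]-oo, b]%classic `\` `]-oo, a]%classic :> set R.
    by rewrite -[RHS]setCK setCD setCitvl setUC -[LHS]setCK setCitv.
  rewrite !measureD //= ?PQ.
  + by rewrite !setIidr ?PQ //; exact: subset_itvl.
  + by rewrite ltey_eq fin_num_measure.
  + by rewrite ltey_eq fin_num_measure.
- by move=> n; rewrite ltey_eq fin_num_measure.
Qed.

(** Equality on cosines with all phases passes to trigonometric polynomials, then to bounded
    continuous functions, and through ramps to the half-lines, which generate the Borel sets. *)
Lemma law_unique d d' (T : measurableType d) (T' : measurableType d')
    (Pr : probability T R) (Pr' : probability T' R) (Y : T -> R) (Z : T' -> R) :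
  measurable_fun setT Y -> measurable_fun setT Z ->
  (forall b s, \int[Pr]_t cos (b + s * Y t) = \int[Pr']_t cos (b + s * Z t)) ->
  forall A, measurable A -> Pr (Y @^-1` A) = Pr' (Z @^-1` A).
Proof.
move=> mY mZ YZ.
pose X (U : Type) (W : U -> R) (t : U) : 'rV[R]_1 := \row_(i < 1) W t.
have mX d0 (U : measurableType d0) (W : U -> R) : measurable_fun setT W ->
    forall i, measurable_fun setT (fun t => X U W t 0 i).
  by move=> mW i; rewrite (_ : (fun t => X U W t 0 i) = W) //; apply/funext => t; rewrite mxE.
have E_eq (g : R -> R) (B : R) : continuous g -> (forall y, `|g y| <= B) ->
    \int[Pr]_t g (Y t) = \int[Pr']_t g (Z t).
  move=> cg gB; pose f (x : 'rV[R]_1) := g (x 0 0).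
  have cf : continuous f.
    by move=> x; apply: (@continuous_comp _ _ _ (fun x : 'rV[R]_1 =>
      x 0 0) g); [exact: coord_continuous | exact: cg].
  have fB x : `|f x| <= B by exact: gB.
  have [tau [tt tB _ tc]] := trigpoly_approx_seq cf fB.
  have c1 := trigpoly_expectation_cvg (Pr := Pr) (mX _ _ _ mY) cf fB tt tB tc.
  have c2 := trigpoly_expectation_cvg (Pr := Pr') (mX _ _ _ mZ) cf fB tt tB tc.
  have same m : \int[Pr]_t tau m (X T Y t) = \int[Pr']_t tau m (X T' Z t).
    have [I [a [b [th H]]]] := tt m.
    rewrite (trigpoly_expectation Pr (mX _ _ _ mY) H) (trigpoly_expectation Pr' (mX _ _ _ mZ) H).
    apply: eq_bigr => j _; congr (_ * _).
    rewrite (@eq_Rintegral _ _ _ Pr _ (fun t => cos (b j + th j 0 * Y t))); last first.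
      by move=> t _; rewrite big_ord1 mxE.
    rewrite YZ; apply: eq_Rintegral => t _; by rewrite big_ord1 mxE.
  have <- : \int[Pr]_t f (X T Y t) = \int[Pr]_t g (Y t).
    by apply: eq_Rintegral => t _; rewrite /f mxE.
  have <- : \int[Pr']_t f (X T' Z t) = \int[Pr']_t g (Z t).
    by apply: eq_Rintegral => t _; rewrite /f mxE.
  apply: cvg_unique c1 _ => //.
  by rewrite (_ : (fun m => \int[Pr]_t tau m (X T Y t)) = (fun m =>
    \int[Pr']_t tau m (X T' Z t))) //;
    apply/funext.
(* For [m > 0] this is 1 up to [a], 0 from [a + 1 / m] on, and linear in between. *)
pose ramp (a : R) (m : nat) (y : R) : R := Num.max 0 (Num.min 1 (1 - m%:R * (y - a))).
have cramp a m : continuous (ramp a m).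
  move=> y; apply: (@continuous_max _ _ (cst 0) (fun y => Num.min 1 (1 - m%:R * (y - a)))).
    exact: cst_continuous.
  apply: (@continuous_min _ _ (cst 1) (fun y => 1 - m%:R * (y - a))).
    exact: cst_continuous.
  apply: continuousB; first exact: cst_continuous.
  apply: continuousM; first exact: cst_continuous.
  by apply: continuousB => //; exact: cst_continuous.
have ramp01 a m y : 0 <= ramp a m y <= 1.
  by rewrite /ramp le_max lexx ge_max ler01 ge_min lexx.
have rampB a m y : `|ramp a m y| <= 1.
  by have /andP[r0 r1] := ramp01 a m y; rewrite ger0_norm.
have ramp_cvg a y : ramp a m y @[m --> \oo] --> (\1_(`]-oo, a]%classic) y : R).
  rewrite indicE; have [ya|ay] := leP y a.
    rewrite mem_set /=; last by rewrite in_itv.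
    rewrite (_ : ramp a ^~ y = cst 1); first exact: cvg_cst.
    apply/funext => m; rewrite /ramp /=.
    have m0 : 0 <= m%:R :> R by exact: ler0n.
    by rewrite min_l ?max_r //; nra.
  rewrite memNset /=; last by rewrite in_itv /=; apply/negP; rewrite -ltNge.
  apply: cvg_near_cst; exists (Num.truncn ((y - a)^-1)).+1 => // m /= ym.
  have ya : 0 < y - a by rewrite subr_gt0.
  rewrite /ramp max_l // ge_min; apply/orP; right.
  rewrite subr_le0 -ler_pdivrMr // mul1r; apply/ltW/(lt_le_trans (truncnS_gt _)).
  by rewrite ler_nat.
have tail_lim d0 (U : measurableType d0) (P : probability U R) (W : U ->
  R) a : measurable_fun setT W ->
    \int[P]_t ramp a m (W t) @[m --> \oo] --> fine (P (W @^-1` `]-oo, a]%classic)).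
  move=> mW; have mWa : measurable (W @^-1` `]-oo, a]%classic).
    by rewrite -[X in measurable X]setTI; apply: mW => //; exact: measurable_itv.
  have -> : fine (P (W @^-1` `]-oo, a]%classic)) = \int[P]_t \1_(`]-oo, a]%classic) (W t).
    rewrite (_ : (fun t => \1_(`]-oo, a]%classic) (W t)) = \1_(W @^-1` `]-oo, a]%classic)) //.
    by rewrite /Rintegral integral_indic // setIT.
  apply: (@Rintegral_dct R _ _ P (fun m t => ramp a m (W t)) _ (cst 1)).
  - by move=> m; apply: measurableT_comp => //; apply: continuous_measurable_fun; exact: cramp.
  - by apply: measurableT_comp => //; apply: measurable_indic; exact: measurable_itv.
  - by move=> t; exact: ramp_cvg.
  - exact: finite_measure_integrable_cst.
  - by move=> m t; exact: rampB.
have tail a : Pr (Y @^-1` `]-oo, a]%classic) = Pr' (Z @^-1` `]-oo, a]%classic).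
  have c1 := tail_lim _ _ Pr Y a mY; have c2 := tail_lim _ _ Pr' Z a mZ.
  have E : (fun m => \int[Pr]_t ramp a m (Y t)) = (fun m => \int[Pr']_t ramp a m (Z t)).
    by apply/funext => m; apply: (E_eq _ 1); [exact: cramp | exact: rampB].
  rewrite E in c1; have eqf := cvg_unique _ c1 c2.
  have fin d0 (U : measurableType d0) (P : probability U R) (W : U -> R) : measurable_fun setT W ->
      P (W @^-1` `]-oo, a]%classic) \is a fin_num.
    move=> mW; apply: fin_num_measure.
    by rewrite -[X in measurable X]setTI; apply: mW => //; exact: measurable_itv.
  by rewrite -(fineK (fin _ _ Pr _ mY)) -(fineK (fin _ _ Pr' _ mZ)) eqf.
exact: (@probability_itv_unique (distribution Pr (mfun_Sub (mem_set mY)))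
  (distribution Pr' (mfun_Sub (mem_set mZ)))).
Qed.

End uniqueness.

(** Bookkeeping for [levy_cvg]: [u] is the inverse of the cube size, [2 * u] the frequency range of
    the tail estimate, and the [+ 1] in the denominator covers [B = 0]. *)
Lemma levy_arith (R : realType) (B K C e u : R) :
  0 <= B -> 0 <= K -> 0 <= C -> 0 < e -> 0 <= u <= 1 ->
  u + 2 * B * (K * (2 * C * (2 * u) ^+ 2 + e / (8 * (2 * B * K + 1)))) <=
  (1 + 16 * B * K * C) * u + e / 8.
Proof.
move=> B0 K0 C0 e0 /andP[u0 u1].
have i3 : 2 * B * K * (e / (8 * (2 * B * K + 1))) <= e / 8.
  have : 0 <= 2 * B * K by rewrite !mulr_ge0.
  move: (2 * B * K) => z z0.
  have -> : z * (e / (8 * (z + 1))) = e / 8 * (z / (z + 1)).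
    by field; rewrite gt_eqF // ltr_wpDl.
  by rewrite ler_piMr ?divr_ge0 ?(ltW e0) // ler_pdivrMr ?ltr_wpDl // mul1r lerDl.
have i5 : 0 <= 16 * B * K * C by rewrite !mulr_ge0.
have i4 : u ^+ 2 <= u by rewrite expr2 ler_piMl.
have -> : u + 2 * B * (K * (2 * C * (2 * u) ^+ 2 + e / (8 * (2 * B * K + 1)))) =
     u + 16 * B * K * C * u ^+ 2 + 2 * B * K * (e / (8 * (2 * B * K + 1))) by ring.
have := ler_wpM2l i5 i4; rewrite mulrDl mul1r; lra.
Qed.

(** * Tightness and the continuity theorem *)

Section levy.
Variables (R : realType) (k : nat) (W : set nat) (I : nat -> finType).
Variables (S : forall n, {set I n}) (q : forall n, I n -> R) (V : forall n, I n -> 'rV[R]_k).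
Hypothesis q_ge0 : forall n j, W n -> 0 <= @q n j.
Hypothesis q_sum : forall n, W n -> \sum_(j in S n) q j = 1.
Variables (d : measure_display) (T : measurableType d) (Pr : probability T R).
Variable X : T -> 'rV[R]_k.
Hypothesis mX : forall i, measurable_fun setT (fun t => X t 0 i).
Hypothesis charfun_cvg : forall b (theta : 'I_k -> R),
  \sum_(j in S n) q j * cos (b + \sum_i theta i * V j 0 i) @[n --> within W \oo] -->
  \int[Pr]_t cos (b + \sum_i theta i * X t 0 i).
Variable C : R.
Hypothesis C_ge0 : 0 <= C.
Hypothesis charfun_quad : forall i s, 1 - \int[Pr]_t cos (s * X t 0 i) <= C * s ^+ 2.

Let L n (f : 'rV[R]_k -> R) := \sum_(j in S n) q j * f (V j).

Lemma sinc_avg (y : R) : y != 0 ->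
  \int[lebesgue_measure]_(s in `[-1, 1]) cos (y * s) = 2 * (sin y / y).
Proof.
move=> y0; rewrite (@eq_Rintegral _ _ _ lebesgue_measure _ (fun s => cos (0 + y * s))); last first.
  by move=> s _; rewrite add0r.
rewrite integral_cos_affine // !add0r mulr1 sinN; ring.
Qed.

(* The average of cos (y s) over [-1, 1] is sin y / y, which is at most 1/2 for |y| >= 2. *)
Lemma avg_cos_tail (x delta : R) : 0 < delta ->
  (2 / delta < `|x|)%R%:R <= 2 - \int[lebesgue_measure]_(s in `[-1, 1]) cos (delta * x * s).
Proof.
move=> d0; set y := delta * x.
have I1 : \int[lebesgue_measure]_(s in `[-1, 1 : R]) 1 = 2 :> R.
  by rewrite Rintegral_cst //= lebesgue_measure_itv /= lte_fin ifT ?EFinN /=; lra.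
have [y0|y0] := eqVneq y 0.
  rewrite y0 (@eq_Rintegral _ _ _ lebesgue_measure _ (cst 1)) => [|s _]; last by rewrite mul0r cos0.
  rewrite I1 subrr; move/eqP: y0; rewrite mulf_eq0 gt_eqF //= => /eqP ->.
  by rewrite normr0 ltNge divr_ge0 // ltW.
rewrite sinc_avg //.
have ny : 0 < `|y| by rewrite normr_gt0.
have h : sin y / y <= `|y|^-1.
  apply: le_trans (ler_norm _) _; rewrite normrM normfV ler_piMl ?invr_ge0 //.
  exact: sin_max.
case: ltP => [xl|_].
  have : `|y|^-1 <= 2^-1.
    rewrite lef_pV2 ?posrE //; rewrite ltr_pdivrMr // in xl.
    by rewrite /y normrM (gtr0_norm d0) mulrC ltW.
  move=> h2; rewrite [X in X <= _](_ : _ = 1) //.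
  have := le_trans h h2; set z := _ / y; lra.
have : sin y / y <= 1.
  apply: le_trans (ler_norm _) _; rewrite normrM normfV ler_pdivrMr // mul1r.
  exact: sin_norm_le.
by move=> h2; rewrite [X in X <= _](_ : _ = 0) //; move: h2; set z := _ / y; lra.
Qed.

Lemma avg_E n (i : 'I_k) (delta : R) : W n ->
  L n (fun x => 2 - \int[lebesgue_measure]_(s in `[-1, 1]) cos (delta * x 0 i * s)) =
  \int[lebesgue_measure]_(s in `[-1, 1]) (1 - L n (fun x => cos (delta * s * x 0 i))).
Proof.
move=> Wn; have ic (y : R) : lebesgue_measure.-integrable `[-1, 1] (EFin \o (fun s : R =>
  cos (y * s))).
  rewrite (_ : (fun s => cos (y * s)) = (fun s => cos (0 + y * s))); last by apply/funext =>
    s; rewrite add0r.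
  exact: integrable_cos_affine.
have I1 : \int[lebesgue_measure]_(s in `[-1, 1 : R]) 1 = 2 :> R.
  by rewrite Rintegral_cst //= lebesgue_measure_itv /= lte_fin ifT ?EFinN /=; lra.
have i1 : lebesgue_measure.-integrable `[-1, 1] (EFin \o (fun s : R => 1 : R)).
  have := ic 0; rewrite (_ : (fun s => cos (0 * s)) = (fun s => 1)) //.
  by apply/funext => s; rewrite mul0r cos0.
rewrite /L (@eq_Rintegral _ _ _ lebesgue_measure _
  (fun s => 1 - \sum_(j in S n) q j * cos (delta * V j 0 i * s))); last first.
  by move=> s _; congr (_ - _); apply: eq_bigr => j _; rewrite mulrAC.
rewrite RintegralB //; last first.
  by apply: integrable_sumR => // j; apply: integrableRZ => //; exact: ic.
rewrite Rintegral_sum //; last by move=> j; apply: integrableRZ => //; exact: ic.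
rewrite I1.
rewrite (eq_bigr (fun j => q j * 2 - q j * \int[lebesgue_measure]_(s in `[-1,
  1]) cos (delta * V j 0 i * s))); last first.
  by move=> j _; rewrite mulrBr.
rewrite sumrB -mulr_suml q_sum // mul1r; congr (_ - _); apply: eq_bigr => j _.
by rewrite RintegralZl //; exact: ic.
Qed.

(** The tail is bounded by the average of [1 - ch] over frequencies up to [delta]. Only the excess
    of [1 - ch] over its limiting bound [C * delta ^+ 2] depends on [n], and its integral tends to
    0. *)
Lemma tail_bound (i : 'I_k) (delta eps : R) : 0 < delta -> 0 < eps ->
  \forall n \near within W \oo,
    L n (fun x => (2 / delta < `|x 0 i|)%R%:R) <= 2 * C * delta ^+ 2 + eps.
Proof.
move=> d0 e0.
pose ch n s := L n (fun x => cos (delta * s * x 0 i)).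
pose D : set R := `[-1, 1]%classic.
(* The value 0 for [n] outside [W] turns a limit along [W] into one over all [n], as dominated
   convergence requires. *)
pose u n (s : R) : R := if pselect (W n) then ((fun s =>
  Num.max 0 (1 - ch n s - C * delta ^+ 2)) \_ D) s else 0.
have chE n s : ch n s = \sum_(j in S n) q j * cos (0 +
  \sum_l (if l == i then delta * s else 0) * V j 0 l).
  apply: eq_bigr => j _; rewrite add0r (bigD1 i) //= eqxx big1 ?addr0 // => l /negbTE ->.
  by rewrite mul0r.
have mch n : measurable_fun setT (ch n).
  rewrite (_ : ch n = fun s => \sum_(j <- enum (S n)) q j * cos (delta * s * V j 0 i)); last first.
    by apply/funext => s; rewrite /ch /L big_enum.
  apply: measurable_sum => j; apply: measurable_funM => //.
  apply: measurableT_comp => //; last by apply: measurable_funM => //; apply: measurable_funM.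
  by apply: continuous_measurable_fun; exact: continuous_cos.
have ch_norm n s : W n -> `|ch n s| <= 1.
  move=> Wn; apply: le_trans (ler_norm_sum _ _ _) _.
  rewrite -(q_sum Wn); apply: ler_sum => j _.
  by rewrite normrM (ger0_norm (q_ge0 _ Wn)) ler_piMr ?q_ge0 // cos_max.
have u_cvg s : u n s @[n --> \oo] --> (0 : R).
  have [sD|/negbTE sD] := boolP (s \in D); last first.
    by apply: cvg_near_cst; apply: nearW => n; rewrite /u /patch sD; case: pselect.
  have s1 : `|s| <= 1 by move: sD; rewrite inE /D /= in_itv /= -ler_norml.
  have lim : ch n s @[n --> within W \oo] --> \int[Pr]_t cos (delta * s * X t 0 i).
    have := @charfun_cvg 0 (fun l => if l == i then delta * s else 0).
    rewrite (_ : \int[Pr]_t _ = \int[Pr]_t cos (delta * s * X t 0 i)).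
      by apply: cvg_trans; apply: near_eq_cvg; apply: nearW => n; rewrite chE.
    apply: eq_Rintegral => t _; rewrite add0r (bigD1 i) //= eqxx big1 ?addr0 // => l /negbTE ->.
    by rewrite mul0r.
  have small : 1 - \int[Pr]_t cos (delta * s * X t 0 i) <= C * delta ^+ 2.
    apply: le_trans (@charfun_quad _ _) _; rewrite ler_wpM2l // exprMn ler_piMr ?sqr_ge0 //.
    by rewrite -(real_normK (num_real s)) expr_le1.
  apply/cvgrPdist_lt => e e1.
  move/cvgrPdist_lt: (lim) => /(_ _ e1); rewrite near_withinE => near_ch.
  near=> n; rewrite sub0r normrN /u /patch sD; case: pselect => [Wn|nW]; last by rewrite normr0.
  have : W n -> `|\int[Pr]_t cos (delta * s * X t 0 i) - ch n s| < e by near: n.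
  move=> /(_ Wn); rewrite ltr_norml => /andP[_ h].
  rewrite ger0_norm ?le_max ?lexx // gt_max e1 /=; lra.
have u_int : \int[lebesgue_measure]_s u n s @[n --> \oo] --> (0 : R).
  pose g : R -> R := (fun s : R => 2 : R) \_ D.
  suff H : \int[lebesgue_measure]_s u n s @[n --> \oo] --> \int[lebesgue_measure]_s (cst 0 s : R).
    by move: H; rewrite [X in _ --> X]/Rintegral integral0.
  apply: (@Rintegral_dct R _ _ lebesgue_measure u (cst 0) g) => //.
  - move=> n; rewrite /u; case: pselect => Wn //.
    apply/(measurable_restrictT _ _).1; first exact: measurable_itv.
    apply: measurable_funTS; apply: measurable_maxr => //.
    apply: measurable_funB; last exact: measurable_cst.
    apply: measurable_funB; [exact: measurable_cst|].
    exact: mch.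
  - have : lebesgue_measure.-integrable D (EFin \o (cst (2 : R))).
      apply: continuous_compact_integrable; first exact: segment_compact.
      by apply: continuous_subspaceT => x; exact: cst_continuous.
    by move/integrable_mkcond; rewrite restrict_EFin; apply; exact: measurable_itv.
  - move=> n s; rewrite /u /g /patch; case: pselect => Wn; case: ifP => _; rewrite ?normr0 //.
    rewrite ger0_norm ?le_max ?lexx // ge_max ler0n /=.
    have := ch_norm n s Wn; rewrite ler_norml => /andP[h _].
    have : 0 <= C * delta ^+ 2 by rewrite mulr_ge0 ?sqr_ge0.
    rewrite /cst; lra.
rewrite near_withinE; move/cvgrPdist_lt: (u_int) => /(_ _ e0).
apply: filterS => n h Wn.
apply: (@le_trans _ _ (L n (fun x => 2 - \int[lebesgue_measure]_(s in `[-1,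
  1]) cos (delta * x 0 i * s)))).
  by apply: ler_sum => j _; rewrite ler_wpM2l ?q_ge0 // avg_cos_tail.
rewrite avg_E //.
have iD (f : R -> R) (M : R) : measurable_fun setT f -> (forall s, `|f s| <= M) ->
    lebesgue_measure.-integrable D (EFin \o f).
  move=> mf fM; apply: (@measurable_bounded_integrable _ _ _ lebesgue_measure).
  - exact: measurable_itv.
  - by rewrite /D /= lebesgue_measure_itv /= lte_fin ifT ?EFinN ?ltry //; lra.
  - exact: measurable_funTS.
  - by exists M; split; [exact: num_real | move=> y My x _; apply: le_trans (fM x) (ltW My)].
have mu_ : measurable_fun setT (fun s => Num.max 0 (1 - ch n s - C * delta ^+ 2)).
  by apply: measurable_maxr => //; do ?apply: measurable_funB => //.
have Cd : 0 <= C * delta ^+ 2 by rewrite mulr_ge0 ?sqr_ge0.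
have i1 : lebesgue_measure.-integrable D (EFin \o (fun s =>
  Num.max 0 (1 - ch n s - C * delta ^+ 2))).
  apply: (iD _ 2) => // s.
  rewrite ger0_norm ?le_max ?lexx // ge_max ler0n /=.
  by have := ch_norm n s Wn; rewrite ler_norml => /andP[h1 _]; lra.
have i2 : lebesgue_measure.-integrable D (EFin \o (fun s : R => C * delta ^+ 2)).
  by apply: (iD _ (C * delta ^+ 2)) => // s; rewrite ger0_norm.
apply: (@le_trans _ _ (\int[lebesgue_measure]_(s in D) (Num.max 0 (1 - ch n s - C * delta ^+ 2) +
  C * delta ^+ 2))).
  apply: le_Rintegral; first exact: measurable_itv.
  - apply: (iD _ 2); first exact: measurable_funB (measurable_cst _) (mch n).
    move=> s; have := ch_norm n s Wn; rewrite [in X in X -> _]ler_norml => /andP[h1 h2].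
    by rewrite ler_norml -/(ch n s); apply/andP; split; lra.
  - by apply: integrableRD => //; exact: measurable_itv.
  - by move=> s _; rewrite -/(ch n s) -lerBlDr le_max lexx orbT.
rewrite RintegralD //; last exact: measurable_itv.
rewrite Rintegral_cst; last exact: measurable_itv.
rewrite /= lebesgue_measure_itv /= lte_fin ifT; last lra.
rewrite addrC lerD //; first by rewrite EFinN /=; lra.
have -> : \int[lebesgue_measure]_(s in D) Num.max 0 (1 - ch n s - C *
  delta ^+ 2) = \int[lebesgue_measure]_s u n s.
  rewrite Rintegral_mkcond; apply: eq_Rintegral => s _.
  by rewrite /u; case: pselect.
by move: h; rewrite sub0r normrN => /ltW; apply: le_trans; exact: ler_norm.
Unshelve. all: by end_near. Qed.

Lemma trigpoly_cvg (tau : 'rV[R]_k -> R) : trigpoly tau ->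
  L n tau @[n --> within W \oo] --> \int[Pr]_t tau (X t).
Proof.
move=> [J [a [b [th H]]]]; rewrite (trigpoly_expectation Pr mX H).
have -> : L ^~ tau = fun n => \sum_j a j * \sum_(l in S n) q l * cos (b j +
  \sum_i th j i * V l 0 i).
  apply/funext => n; under [RHS]eq_bigr do rewrite mulr_sumr.
  rewrite exchange_big /=; apply: eq_bigr => l _; rewrite H mulr_sumr.
  by apply: eq_bigr => j _; rewrite mulrCA.
by apply: cvg_big => [|j _]; [exact: add_continuous | apply: cvgMr; exact: charfun_cvg].
Qed.

Lemma levy_cvg (f : 'rV[R]_k -> R) (B : R) : continuous f -> (forall x, `|f x| <= B) ->
  \sum_(j in S n) q j * f (V j) @[n --> within W \oo] --> \int[Pr]_t f (X t).
Proof.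
move=> cf fB; have B0 : 0 <= B by apply: le_trans (fB 0).
have [tau [tt tB tf tc]] := trigpoly_approx_seq cf fB.
have lim := trigpoly_expectation_cvg (Pr := Pr) mX cf fB tt tB tc.
apply/cvgrPdist_lt => eps e0.
have e4 : 0 < eps / 4 by rewrite divr_gt0.
have four : eps / 4 + eps / 4 + (eps / 4 + eps / 4) <= eps by lra.
pose M := 1 + 16 * B * k%:R * C.
have M0 : 0 < M by rewrite ltr_wpDr // !mulr_ge0.
have e' : 0 < eps / (8 * (2 * B * k%:R + 1)).
  by rewrite divr_gt0 // mulr_gt0 // ltr_wpDl // !mulr_ge0.
set eps' := eps / _ in e'.
(* [m] is fixed before [n]: it makes the approximation good under the limit law and bounds the tail
   term, of order [M / m.+1]. *)
have [m [lim_m small_m]] : exists m,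
    `|\int[Pr]_t f (X t) - \int[Pr]_t tau m (X t)| < eps / 4 /\ M / m.+1%:R < eps / 4.
  near \oo => m; exists m; split; near: m.
    by move/cvgrPdist_lt: lim; apply.
  exists (Num.truncn (M / (eps / 4))) => // m /= Mm.
  rewrite ltr_pdivrMr ?ltr0n // mulrC -ltr_pdivrMr //.
  by apply: lt_le_trans (truncnS_gt _) _; rewrite ler_nat ltnS.
have dm : 0 < 2 / m.+1%:R :> R by rewrite divr_gt0.
have near_tau := (cvgrPdist_lt _ _).1 (trigpoly_cvg (tt m)) _ e4.
have near_tail : \forall n \near within W \oo, forall i,
    L n (fun x => (2 / (2 / m.+1%:R) < `|x 0 i|)%R%:R) <= 2 * C * (2 / m.+1%:R) ^+ 2 + eps'.
  by apply: filter_forall => i; exact: tail_bound.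
near=> n.
have Wn : W n by near: n; rewrite near_withinE; exact: nearW.
have h1 : `|\int[Pr]_t tau m (X t) - L n (tau m)| < eps / 4 by near: n; exact: near_tau.
have h2 : forall i, L n (fun x => (2 / (2 / m.+1%:R) < `|x 0 i|)%R%:R) <=
    2 * C * (2 / m.+1%:R) ^+ 2 + eps' by near: n; exact: near_tail.
have mm (i : R) : 2 / (2 / m.+1%:R) = m.+1%:R :> R by field; rewrite addrC natr1 pnatr_eq0.
have h3 : `|L n (tau m) - L n f| <= m.+1%:R^-1 + 2 * B * \sum_i L n (fun x =>
  (m.+1%:R < `|x 0 i|)%R%:R).
  pose out (j : I n) i : R := (m.+1%:R < `|V j 0 i|)%R%:R.
  have -> : m.+1%:R^-1 + 2 * B * \sum_i L n (fun x => (m.+1%:R < `|x 0 i|)%R%:R) =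
      \sum_(j in S n) q j * (m.+1%:R^-1 + 2 * B * \sum_i out j i).
    rewrite (eq_bigr (fun j => q j * m.+1%:R^-1 + 2 * B * \sum_i q j * out j i)); last first.
      by move=> j _; rewrite -mulr_sumr; ring.
    by rewrite big_split /= -mulr_suml q_sum // mul1r -mulr_sumr exchange_big.
  rewrite -sumrB; apply: le_trans (ler_norm_sum _ _ _) _; apply: ler_sum => j _.
  rewrite -mulrBr normrM (ger0_norm (q_ge0 _ Wn)).
  rewrite ler_wpM2l ?q_ge0 // distrC.
  have [[i bi]|good] := pselect (exists i, m.+1%:R < `|V j 0 i|).
    apply: (@le_trans _ _ (2 * B * 1)).
      by apply: le_trans (ler_normB _ _) _; rewrite mulr1 mulr_natl mulr2n lerD.
    rewrite ler_wpDl ?invr_ge0 // ler_wpM2l ?mulr_ge0 // (bigD1 i) //= /out bi lerDl.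
    by apply: sumr_ge0 => l _.
  rewrite ler_wpDr //; first by rewrite !mulr_ge0 //; apply: sumr_ge0.
  by apply: tf => i; rewrite leNgt; apply/negP => bi; apply: good; exists i.
have h4 : \sum_i L n (fun x => (m.+1%:R < `|x 0 i|)%R%:R) <= k%:R * (2 * C * (2 / m.+1%:R) ^+ 2 +
  eps').
  rewrite mulr_natl -[k in leRHS]card_ord -sumr_const.
  by apply: ler_sum => i _; have := h2 i; rewrite mm.
have h5 : m.+1%:R^-1 + 2 * B * (k%:R * (2 * C * (2 / m.+1%:R) ^+ 2 + eps')) <= M / m.+1%:R +
  eps / 8.
  by apply: levy_arith => //; rewrite invr_ge0 ler0n invf_le1 // ler1n.
have h6 := ler_wpM2l (mulr_ge0 (ler0n R 2) B0) h4.
apply: le_lt_trans (ler_distD (L n (tau m)) _ _) _.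
apply: le_lt_trans (lerD (ler_distD (\int[Pr]_t tau m (X t)) _ _) (le_trans h3 (le_trans (lerD
  (lexx _) h6) h5))) _.
apply: lt_le_trans (ltrD (ltrD lim_m h1) (_ : _ < eps / 4 + eps / 4)) four.
by rewrite ltrD // ltr_pM2l // ltf_pV2 // ?posrE // ltr_nat.
Unshelve. all: by end_near. Qed.

End levy.

(** * Gaussian vectors *)

Section gaussian_integrals.
Variables (R : realType) (a : R).
Hypothesis a_gt0 : 0 < a.
Local Notation mu := (@lebesgue_measure R).
Local Notation "'g' u" := (expR (- (a / 2 * u ^+ 2))) (at level 10, u at level 9).

(** Stands in for integration by parts on the whole line: the fundamental theorem on growing
    intervals and dominated convergence. *)
Lemma Rintegral_derive (F F' : R -> R) :
  (forall x, is_derive x (1 : R) F (F' x)) -> continuous F' ->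
  mu.-integrable setT (EFin \o F') ->
  (F n%:R - F (- n%:R)) @[n --> \oo] --> (0 : R) -> \int[mu]_x F' x = 0.
Proof.
move=> dF cF' iF' F0.
have cF : continuous F.
  by move=> x; apply: differentiable_continuous; apply/derivable1_diffP; exact: ex_derive.
have FTC n : \int[mu]_x (F' \_ `[- n.+1%:R, n.+1%:R]) x = F n.+1%:R - F (- n.+1%:R).
  rewrite -Rintegral_mkcond /Rintegral (@continuous_FTC2 _ _ F) //.
  - by rewrite ltrNl (lt_trans _ (ltr0Sn R n)) // oppr_lt0.
  - by apply: continuous_subspaceT => x; exact: cF'.
  - split.
    + by move=> x _; exact: ex_derive.
    + by apply: cvg_at_right_filter; exact: cF.
    + by apply: cvg_at_left_filter; exact: cF.
  - by move=> x _; rewrite derive1E; exact: derive_val.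
have L1 : \int[mu]_x (F' \_ `[- n.+1%:R, n.+1%:R]) x @[n --> \oo] --> \int[mu]_x F' x.
  apply: (@Rintegral_dct R _ _ mu (fun n => F' \_ `[- n.+1%:R, n.+1%:R]) F' (fun x => `|F' x|)).
  - move=> n; apply/(measurable_restrictT _ _).1; first exact: measurable_itv.
    by apply: measurable_funTS; exact: continuous_measurable_fun.
  - exact: continuous_measurable_fun.
  - move=> x; apply: cvg_near_cst; exists (Num.truncn `|x|) => // n /= xn.
    rewrite patchE mem_set //= in_itv /= -ler_norml.
    by apply/ltW/(lt_le_trans (truncnS_gt _)); rewrite ler_nat ltnS.
  - by have := integrable_norm iF'.
  - by move=> n x; rewrite patchE; case: ifP; rewrite ?normr0.
apply: cvg_unique L1 _ => //.
rewrite (_ : (fun n => _) = fun n => F n.+1%:R - F (- n.+1%:R)); last exact/funext.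
by move: F0; rewrite -(cvg_shiftS (fun n => F n%:R - F (- n%:R))).
Qed.

Lemma continuous_gauss : continuous (fun u : R => g u).
Proof.
move=> x; apply: differentiable_continuous; apply/derivable1_diffP; exact: ex_derive.
Qed.

Lemma integrable_sqr_gauss : mu.-integrable setT (EFin \o (fun u => u ^+ 2 * g u)).
Proof.
apply: (@integrable_dominated R _ _ mu (fun u => u ^+ 2 * g u) (fun u =>
  4 / a * expR (- (a / 2 / 2 * u ^+ 2)))).
- apply: measurable_funM => //; apply: continuous_measurable_fun; exact: continuous_gauss.
- by apply: integrableRZ => //; apply: integrable_gauss; rewrite divr_gt0.
move=> u; rewrite normrM !ger0_norm ?expR_ge0 ?sqr_ge0 //.
(* Half of the exponent absorbs the factor [u ^+ 2], since [y] is at most its exponential. *)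
set y := a / 2 / 2 * u ^+ 2.
have -> : a / 2 * u ^+ 2 = y + y by rewrite /y; field.
have -> : u ^+ 2 = 4 / a * y by rewrite /y; field; rewrite gt_eqF.
rewrite -[leLHS]mulrA ler_wpM2l ?divr_ge0 ?(ltW a_gt0) // opprD expRD.
rewrite mulrA ler_piMl ?expR_ge0 // expRN ler_pdivrMr ?expR_gt0 // mul1r.
by apply: le_trans (expR_ge1Dx y); rewrite lerDr.
Qed.

Lemma gauss_decay n : (0 < n)%N -> n%:R * g n%:R <= 4 / a * harmonic n.
Proof.
move=> n0; have nR : 0 < n%:R :> R by rewrite ltr0n.
rewrite /harmonic /= expRN; set y := a / 2 * _.
have y0 : 0 < y by rewrite mulr_gt0 ?exprn_gt0 ?divr_gt0.
apply: (@le_trans _ _ (n%:R / y)).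
  rewrite ler_pM2l // lef_pV2 ?posrE ?expR_gt0 //.
  by apply: le_trans (expR_ge1Dx y); rewrite lerDr.
have -> : n%:R / y = 2 / a / n%:R by rewrite /y; field; rewrite !gt_eqF.
rewrite ler_pdivrMr // mulrAC ler_pdivlMr ?ltr0n //.
have -> : 4 / a * n%:R = 2 / a * (2 * n%:R) by ring.
rewrite ler_wpM2l ?divr_ge0 ?(ltW a_gt0) // -natr1.
by have : 1 <= n%:R :> R; [rewrite ler1n | lra].
Qed.

Lemma gauss_even (u : R) : g (- u) = g u.
Proof. by rewrite sqrrN. Qed.

Lemma gauss_boundary (F : R -> R) : (forall u, 1 <= `|u| -> `|F u| <= `|u| * g u) ->
  (F n%:R - F (- n%:R)) @[n --> \oo] --> (0 : R).
Proof.
move=> FB; apply: (@le_cvg0 _ _ (fun n => 8 / a * harmonic n)); last first.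
  by rewrite -(mulr0 (8 / a)); apply: cvgMr; exact: cvg_harmonic.
exists 1%N => // n /= n0; apply: le_trans (ler_normB _ _) _.
have n1 : 1 <= `|n%:R| :> R by rewrite normr_nat ler1n.
have n1' : 1 <= `|- n%:R| :> R by rewrite normrN.
have := FB _ n1; have := FB _ n1'; rewrite normrN gauss_even normr_nat => h1 h2.
have := gauss_decay n0.
have -> : 8 / a * harmonic n = 4 / a * harmonic n + 4 / a * harmonic n by field; rewrite gt_eqF.
lra.
Qed.

Lemma gauss_second_moment : \int[mu]_u (u ^+ 2 * g u) = gauss_mass a / a.
Proof.
have dF (x : R) : is_derive x (1 : R) (fun u => u * g u) (g x - a * (x ^+ 2 * g x)).
  by apply: is_derive_eq; rewrite /GRing.scale /=; field.
have i1 := integrable_gauss a_gt0; have i2 := integrable_sqr_gauss.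
have i3 := integrableRZ measurableT a i2.
have : \int[mu]_u (g u - a * (u ^+ 2 * g u)) = 0.
  apply: (Rintegral_derive dF).
  - move=> x; apply: differentiable_continuous; apply/derivable1_diffP; exact: ex_derive.
  - exact: integrableRB.
  - by apply: (@gauss_boundary (fun u => u * g u)) => u _; rewrite normrM (ger0_norm (expR_ge0 _)).
rewrite RintegralB // RintegralZl // => /eqP; rewrite subr_eq0 =>
  /eqP; rewrite -/(gauss_mass a) => ->.
by field; rewrite gt_eqF.
Qed.

Let H b t := \int[mu]_u (cos (b + t * u) * g u).
Let H' b t := \int[mu]_u (- (u * sin (b + t * u)) * g u).

Lemma continuous_trig_gauss b t : continuous (fun u : R => cos (b + t * u) * g u) /\
  continuous (fun u : R => sin (b + t * u) * g u).
Proof.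
by split=> x; apply: differentiable_continuous; apply/derivable1_diffP; exact: ex_derive.
Qed.

Let cos_int b t : mu.-integrable setT (EFin \o (fun u : R => cos (b + t * u) * g u)).
Proof.
apply: (@integrable_dominated R _ _ mu _ (fun u => g u)).
- by apply: continuous_measurable_fun; exact: (continuous_trig_gauss b t).1.
- exact: integrable_gauss.
- by move=> u; rewrite normrM (ger0_norm (expR_ge0 _)) ler_piMl ?expR_ge0 // cos_max.
Qed.

Let sin_int b t : mu.-integrable setT (EFin \o (fun u : R => u * sin (b + t * u) * g u)).
Proof.
apply: (@integrable_dominated R _ _ mu _ (fun u => g u + u ^+ 2 * g u)).
- under eq_fun do rewrite -mulrA.
  apply: measurable_funM => //.
  by apply: continuous_measurable_fun; exact: (continuous_trig_gauss b t).2.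
- by apply: integrableRD => //; [exact: integrable_gauss | exact: integrable_sqr_gauss].
- move=> u; have -> : g u + u ^+ 2 * g u = (1 + u ^+ 2) * g u by ring.
  rewrite normrM (ger0_norm (expR_ge0 _)).
  rewrite ler_wpM2r ?expR_ge0 // normrM.
  apply: (@le_trans _ _ `|u|); first by rewrite ler_piMr // sin_max.
  by rewrite -(real_normK (num_real u)); have := sqr_ge0 (`|u| - 1); nra.
Qed.

Let derive_H b t : is_derive t (1 : R) (H b) (H' b t).
Proof.
have df (x u : R) : is_derive x (1 : R) (fun x =>
  cos (b + x * u) * g u) (- (u * sin (b + x * u)) * g u).
  by apply: is_derive_eq; rewrite /GRing.scale /=; ring.
have d1 (x u : R) : partial1of2 (fun x u => cos (b + x * u) * g u) x u = - (u * sin (b +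
  x * u)) * g u.
  by rewrite partial1of2E; exact: (@derive_val _ _ _ _ _ _ _ (df x u)).
have tI : `]t - 1, t + 1[%classic t by rewrite /= in_itv /= ltrBlDr ltrDl ltr01.
have c1 := @cvg_differentiation_under_integral R _ _ mu (fun x u => cos (b + x * u) * g u) setT
  measurableT t _ _ tI (fun x _ => cos_int b x) (fun x u _ _ => @ex_derive _ _ _ _ _ _ _ (df x u))
  (fun u => g u + u ^+ 2 * g u).
have {}c1 : h^-1 *: (H b (h + t) - H b t) @[h --> 0^'] --> H' b t.
  rewrite /H' (@eq_Rintegral _ _ _ mu _ (partial1of2 (fun x u =>
    cos (b + x * u) * g u) t)); last first.
    by move=> u _; rewrite d1.
  apply: c1 => //.
  - by move=> u; apply: addr_ge0; [exact: expR_ge0 | apply: mulr_ge0;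
    [exact: sqr_ge0 | exact: expR_ge0]].
  - by apply: integrableRD => //; [exact: integrable_gauss | exact: integrable_sqr_gauss].
  - move=> x u _ _; have -> : g u + u ^+ 2 * g u = (1 + u ^+ 2) * g u by ring.
    rewrite d1 normrM (ger0_norm (expR_ge0 _)).
    rewrite ler_wpM2r ?expR_ge0 // normrN normrM.
    apply: (@le_trans _ _ `|u|); first by rewrite ler_piMr // sin_max.
    by rewrite -(real_normK (num_real u)); have := sqr_ge0 (`|u| - 1); nra.
have dH : derivable (H b) t 1.
  by apply/cvg_ex; exists (H' b t); under eq_fun do rewrite scaler1.
apply: DeriveDef => //; rewrite -derive1E /derive1.
exact/cvg_lim.
Qed.

(** Integrating the derivative of the sine times the Gaussian weight gives the differential equation
    of a Gaussian in [t]. *)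
Let H'E b t : H' b t = - (t / a) * H b t.
Proof.
have dF (x : R) : is_derive x (1 : R) (fun u => sin (b + t * u) * g u)
    (t * (cos (b + t * x) * g x) - a * (x * sin (b + t * x) * g x)).
  by apply: is_derive_eq; rewrite /GRing.scale /=; field.
have i1 := integrableRZ measurableT t (cos_int b t).
have i2 := integrableRZ measurableT a (sin_int b t).
have : \int[mu]_u (t * (cos (b + t * u) * g u) - a * (u * sin (b + t * u) * g u)) = 0.
  apply: (Rintegral_derive dF).
  - by move=> x; apply: differentiable_continuous; apply/derivable1_diffP; exact: ex_derive.
  - exact: integrableRB.
  - apply: (@gauss_boundary (fun u => sin (b + t * u) * g u)) => u u1.
    rewrite normrM (ger0_norm (expR_ge0 _)) ler_wpM2r ?expR_ge0 //.
    exact: le_trans (sin_max _) u1.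
rewrite RintegralB // !RintegralZl // -/(H b t) => E.
have -> : H' b t = - \int[mu]_u (u * sin (b + t * u) * g u).
  rewrite -mulN1r -RintegralZl //; apply: eq_Rintegral => u _; by rewrite mulN1r mulNr.
apply: (mulfI (lt0r_neq0 a_gt0)); apply/eqP.
rewrite -subr_eq0 -[X in _ == X]E; apply/eqP; field.
by rewrite gt_eqF.
Qed.

(** The differential equation [H' = - (t / a) * H] makes the product of [H b t] and
    [expR (t ^+ 2 / (2 * a))] constant in [t]. *)
Lemma gauss_fourier b t :
  \int[mu]_u (cos (b + t * u) * g u) = cos b * expR (- (t ^+ 2 / (2 * a))) * gauss_mass a.
Proof.
pose K t := H b t * expR (t ^+ 2 / (2 * a)).
have dK (x : R) : is_derive x (1 : R) K 0.
  have := derive_H b x; rewrite H'E => dH.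
  by apply: is_derive_eq; rewrite /GRing.scale /=; field; rewrite gt_eqF.
have K0 := @is_derive_0_is_cst _ K t 0 dK.
have H0 : H b 0 = cos b * gauss_mass a.
  rewrite /H -RintegralZl //; last exact: integrable_gauss.
  by apply: eq_Rintegral => u _; rewrite mul0r addr0.
have : K t = cos b * gauss_mass a by rewrite K0 /K H0 expr0n mul0r expR0 mulr1.
rewrite /K -/(H b t) => E; rewrite mulrAC -E expRN mulfK // gt_eqF //; exact: expR_gt0.
Qed.

End gaussian_integrals.

Section normal_integrals.
Variables (R : realType) (s : R).
Hypothesis s_gt0 : 0 < s.
Local Notation mu := (@lebesgue_measure R).
Local Notation N := (normal_prob 0 s).
Let a : R := (s ^+ 2)^-1.
Local Notation "'g' u" := (expR (- (a / 2 * u ^+ 2))) (at level 10, u at level 9).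

Let a_gt0 : 0 < a. Proof. by rewrite invr_gt0 exprn_gt0. Qed.

Let pdfE (u : R) : normal_pdf 0 s u = normal_peak s * g u.
Proof.
rewrite normal_pdfE ?gt_eqF // /normal_fun subr0; congr (_ * expR _).
by rewrite /a -mulr_natr; field; rewrite gt_eqF.
Qed.

Let peakE : normal_peak s * gauss_mass a = 1.
Proof.
rewrite /gauss_mass -RintegralZl //; last exact: integrable_gauss.
rewrite (@eq_Rintegral _ _ _ mu _ (normal_pdf 0 s)) => [|u _]; last by rewrite pdfE.
by rewrite /Rintegral integral_normal_pdf.
Qed.

(** The abstract Radon-Nikodym derivative has the same integrals as the explicit density, hence
    equals it almost everywhere. *)
Lemma integral_normal_density (f : R -> \bar R) : measurable_fun setT f -> (forall x, 0 <= f x)%E ->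
  (\int[N]_x f x = \int[mu]_x (f x * (normal_pdf 0 s x)%:E))%E.
Proof.
move=> mf f0; have dom := @normal_prob_dominates R 0 s.
rewrite -(Radon_Nikodym_SigmaFinite.change_of_variables dom f0 measurableT mf).
have mpdf : measurable_fun setT (EFin \o normal_pdf 0 s).
  by apply/measurable_EFinP; exact: measurable_normal_pdf.
have mRN := measurable_int _ (Radon_Nikodym_SigmaFinite.f_integrable dom).
apply: ae_eq_integral => //.
- exact: emeasurable_funM.
- exact: emeasurable_funM.
apply: ae_eqe_mul2l; apply: integral_ae_eq => //.
  exact: Radon_Nikodym_SigmaFinite.f_integrable.
by move=> E _ mE; rewrite -Radon_Nikodym_SigmaFinite.f_integral.
Qed.

Lemma integral_normal (f : R -> R) : measurable_fun setT f -> (forall x, 0 <= f x) ->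
  mu.-integrable setT (EFin \o (fun u => f u * g u)) ->
  (\int[N]_x (f x)%:E = (normal_peak s * \int[mu]_u (f u * g u))%:E)%E.
Proof.
move=> mf f0 fi; rewrite integral_normal_density; last 2 first.
- exact/measurable_EFinP.
- by move=> x; rewrite lee_fin.
rewrite -RintegralZl // /Rintegral fineK; last first.
  by apply: integrable_fin_num => //; exact: integrableRZ.
by apply: eq_integral => u _; rewrite pdfE -EFinM mulrCA.
Qed.

Lemma normal_sqr : (\int[N]_x (x ^+ 2)%:E = (s ^+ 2)%:E)%E.
Proof.
rewrite (@integral_normal (fun x => x ^+ 2)) //.
- rewrite gauss_second_moment // mulrA peakE /a invrK mul1r //.
- by move=> x; exact: sqr_ge0.
- exact: integrable_sqr_gauss.
Qed.

Lemma normal_charfun (b t : R) : \int[N]_x cos (b + t * x) = cos b * expR (- ((s * t) ^+ 2 / 2)).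
Proof.
have mc : measurable_fun setT (fun x : R => cos (b + t * x)).
  by apply: continuous_measurable_fun => x; exact: continuous_cos_affine.
have ic : N.-integrable setT (EFin \o (fun x : R => cos (b + t * x))).
  apply: (@integrable_dominated _ _ _ _ _ (cst 1)) => //.
    exact: finite_measure_integrable_cst.
  by move=> x; exact: cos_max.
have i1 := integrable_gauss a_gt0.
have i2 : mu.-integrable setT (EFin \o (fun u : R => cos (b + t * u) * g u)).
  apply: (@integrable_dominated R _ _ mu _ (fun u => g u)) => //.
  - by apply: continuous_measurable_fun; exact: (continuous_trig_gauss a b t).1.
  - by move=> u; rewrite normrM (ger0_norm (expR_ge0 _)) ler_piMl ?expR_ge0 // cos_max.
(* The change of density is stated for nonnegative functions, and [1 + cos] is one. *)
have E : \int[N]_x (1 + cos (b + t * x)) = 1 + \int[N]_x cos (b + t * x).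
  rewrite RintegralD //; last exact: finite_measure_integrable_cst.
  by rewrite Rintegral_prob_cst.
apply: (addrI 1); rewrite -E /Rintegral (@integral_normal (fun x => 1 + cos (b + t * x))).
- rewrite /=; under eq_Rintegral do rewrite mulrDl mul1r.
  rewrite RintegralD // mulrDr -/(gauss_mass a) peakE gauss_fourier // mulrCA peakE mulr1.
  by congr (1 + _ * expR _); rewrite /a; field; rewrite gt_eqF.
- by apply: measurable_funD.
- by move=> x; have := cos_geN1 (b + t * x); lra.
- under eq_fun do rewrite mulrDl mul1r.
  exact: integrableRD.
Qed.

End normal_integrals.

(** * Variables with a Gaussian characteristic function *)

Section gaussian_law.
Variable R : realType.

Lemma eq_law_integral d d' (T : measurableType d) (T' : measurableType d')
    (Pr : probability T R) (Pr' : probability T' R) (Y : T -> R) (Z : T' -> R) (f : R -> \bar R) :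
  measurable_fun setT Y -> measurable_fun setT Z ->
  (forall A, measurable A -> Pr (Y @^-1` A) = Pr' (Z @^-1` A)) ->
  measurable_fun setT f -> (forall x, 0 <= f x)%E ->
  (\int[Pr]_t f (Y t) = \int[Pr']_t f (Z t))%E.
Proof.
move=> mY mZ YZ mf f0.
have H d0 (U : measurableType d0) (P : probability U R) (W : U -> R) (mW : measurable_fun setT W) :
    (\int[P]_t f (W t) = \int[distribution P (mfun_Sub (mem_set mW))]_x f x)%E.
  by rewrite ge0_integral_distribution.
rewrite (H _ _ _ _ mY) (H _ _ _ _ mZ); apply: eq_measure_integral => A mA _.
exact: YZ.
Qed.

Variables (d : measure_display) (T : measurableType d) (Pr : probability T R).
Variables (Y : T -> R) (v : R).
Hypothesis mY : measurable_fun setT Y.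
Hypothesis v_ge0 : 0 <= v.
Hypothesis charfunY : forall b s, \int[Pr]_t cos (b + s * Y t) = cos b * expR (- (v * s ^+ 2 / 2)).

Lemma charfun_gaussian_law (A : set R) : measurable A ->
  Pr (Y @^-1` A) = if Num.sqrt v == 0 then dirac (0 : R) A else normal_prob 0 (Num.sqrt v) A.
Proof.
move=> mA; case: ifPn => [|v0].
  rewrite sqrtr_eq0 => v0; have vE : v = 0 by apply/eqP; rewrite eq_le v0.
  apply: (@law_unique R _ _ T R Pr (dirac (0 : R)) Y id) => // b s.
  rewrite charfunY vE mul0r mul0r oppr0 expR0 mulr1.
  rewrite /Rintegral integral_dirac ?diracT ?mul1e /= ?mulr0 ?addr0 //.
  by apply/measurable_EFinP; apply: continuous_measurable_fun => x; exact: continuous_cos_affine.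
have s0 : 0 < Num.sqrt v by rewrite lt_def v0 sqrtr_ge0.
apply: (@law_unique R _ _ T _ Pr (normal_prob 0 (Num.sqrt v)) Y id) => // b s.
by rewrite charfunY normal_charfun // exprMn sqr_sqrtr.
Qed.

Lemma charfun_gaussian : gaussian Pr Y.
Proof. by exists 0, (Num.sqrt v); exact: charfun_gaussian_law. Qed.

Let msqr : measurable_fun setT (fun x : R => (x ^+ 2)%:E).
Proof. by apply/measurable_EFinP; exact: measurable_funX. Qed.

Lemma charfun_second_moment : (\int[Pr]_t (Y t ^+ 2)%:E = v%:E)%E.
Proof.
have [v0|v0] := eqVneq (Num.sqrt v) 0.
  have law A : measurable A -> Pr (Y @^-1` A) = dirac (0 : R) A.
    by move=> mA; rewrite charfun_gaussian_law // v0 eqxx.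
  rewrite (@eq_law_integral _ _ T R Pr (dirac (0 : R)) Y id (fun x => (x ^+ 2)%:E)) //; last first.
    by move=> x; rewrite lee_fin sqr_ge0.
  rewrite integral_dirac //= diracT mul1e expr0n /=.
  by congr EFin; apply/eqP; rewrite eq_le v_ge0 -sqrtr_eq0 v0 eqxx.
have law A : measurable A -> Pr (Y @^-1` A) = normal_prob 0 (Num.sqrt v) A.
  by move=> mA; rewrite charfun_gaussian_law // (negbTE v0).
have s0 : 0 < Num.sqrt v by rewrite lt_def v0 sqrtr_ge0.
rewrite (@eq_law_integral _ _ T _ Pr (normal_prob 0 (Num.sqrt v)) Y id (fun x =>
  (x ^+ 2)%:E)) //; last first.
  by move=> x; rewrite lee_fin sqr_ge0.
by rewrite normal_sqr // sqr_sqrtr.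
Qed.

Lemma charfun_integrable_sqr : Pr.-integrable setT (EFin \o (fun t => Y t ^+ 2)).
Proof.
apply/integrableP; split; first by apply/measurable_EFinP; exact: measurable_funX.
under eq_integral do rewrite /= ger0_norm ?sqr_ge0 //.
by rewrite charfun_second_moment ltry.
Qed.

(** [Y] and [- Y] have the same characteristic function, hence the same law, so the positive and
    negative parts of [Y] have equal integrals. *)
Lemma charfun_mean : (\int[Pr]_t (Y t)%:E = 0)%E.
Proof.
have iY : Pr.-integrable setT (EFin \o Y).
  apply: (@integrable_dominated _ _ _ _ _ (fun t => 1 + Y t ^+ 2)) => //.
    apply: integrableRD => //; last exact: charfun_integrable_sqr.
    exact: finite_measure_integrable_cst.
  move=> t; rewrite -(real_normK (num_real (Y t))).
  by have := sqr_ge0 (`|Y t| - 1); nra.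
have law A : measurable A -> Pr (Y @^-1` A) = Pr ((fun t => - Y t) @^-1` A).
  move=> mA; apply: law_unique => // [|b s]; first exact: measurableT_comp.
  rewrite charfunY (@eq_Rintegral _ _ _ Pr _ (fun t => cos (b + (- s) * Y t))).
    by rewrite charfunY sqrrN.
  by move=> t _; rewrite mulrN mulNr.
rewrite integralE.
have -> : (\int[Pr]_t ((fun t => (Y t)%:E)^\- t) = \int[Pr]_t ((fun t => (Y t)%:E)^\+ t))%E.
  transitivity (\int[Pr]_t (maxe (- Y t)%:E 0))%E.
    by apply: eq_integral => t _; rewrite funenegE EFinN.
  rewrite -(@eq_law_integral _ _ T T Pr Pr Y (fun t => - Y t) (fun x => maxe x%:E 0%E)) //.
  - by apply: eq_integral => t _; rewrite funeposE.
  - exact: measurableT_comp.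
  - by apply: measurable_maxe => //; exact/measurable_EFinP.
  - by move=> x; rewrite le_max lexx orbT.
rewrite subee //; apply: integrable_pos_fin_num => //.
Qed.

End gaussian_law.

(** * Existence of Gaussian vectors *)

Section gaussian_vector_exists.
Variable R : realType.

Definition quad_form k (G : 'I_k -> 'I_k -> R) (theta : 'I_k -> R) : R :=
  \sum_i \sum_j theta i * theta j * G i j.

Definition schur k (G : 'I_k.+1 -> 'I_k.+1 -> R) (i j : 'I_k) : R :=
  G (lift ord0 i) (lift ord0 j) - G ord0 (lift ord0 i) * G ord0 (lift ord0 j) / G ord0 ord0.

Lemma quad_form_recl k (G : 'I_k.+1 -> 'I_k.+1 -> R) theta : (forall i j, G i j = G j i) ->
  quad_form G theta = theta ord0 ^+ 2 * G ord0 ord0 +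
    2 * theta ord0 * (\sum_i theta (lift ord0 i) * G ord0 (lift ord0 i)) +
    quad_form (fun i j => G (lift ord0 i) (lift ord0 j)) (fun i => theta (lift ord0 i)).
Proof.
move=> symG; rewrite /quad_form big_ord_recl big_ord_recl /=.
under [X in _ + X = _]eq_bigr do rewrite big_ord_recl.
rewrite big_split /= mulr_sumr.
rewrite [X in _ + (X + _) = _](eq_bigr (fun i =>
  theta ord0 * (theta (lift ord0 i) * G ord0 (lift ord0 i)))); last first.
  by move=> i _; rewrite symG; ring.
rewrite [X in _ + X + _ = _](eq_bigr (fun i => theta ord0 * (theta (lift ord0 i) *
  G ord0 (lift ord0 i)))); last first.
  by move=> i _; ring.
rewrite -!mulr_sumr; ring.
Qed.

Lemma quad_form_schur k (G : 'I_k.+1 -> 'I_k.+1 -> R) (theta : 'I_k -> R) :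
  quad_form (schur G) theta = quad_form (fun i j => G (lift ord0 i) (lift ord0 j)) theta -
    (\sum_i theta i * G ord0 (lift ord0 i)) ^+ 2 / G ord0 ord0.
Proof.
rewrite /quad_form expr2 big_distrlr /= mulr_suml -sumrB; apply: eq_bigr => i _.
rewrite mulr_suml -sumrB; apply: eq_bigr => j _; rewrite /schur; ring.
Qed.

Section psd.
Variables (k : nat) (G : 'I_k.+1 -> 'I_k.+1 -> R).
Hypothesis symG : forall i j, G i j = G j i.
Hypothesis psdG : forall theta, 0 <= quad_form G theta.

Let ext (t : R) (theta : 'I_k -> R) (i : 'I_k.+1) : R := oapp theta t (unlift ord0 i).

Let quad_ext t theta : quad_form G (ext t theta) = t ^+ 2 * G ord0 ord0 +
    2 * t * (\sum_i theta i * G ord0 (lift ord0 i)) +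
    quad_form (fun i j => G (lift ord0 i) (lift ord0 j)) theta.
Proof.
rewrite quad_form_recl // /ext unlift_none /=; congr (_ + _ * _ + _).
  by apply: eq_bigr => i _; rewrite liftK.
by rewrite /quad_form; apply: eq_bigr => i _; apply: eq_bigr => j _; rewrite !liftK.
Qed.

Lemma psd_diag0 : 0 <= G ord0 ord0.
Proof.
have := psdG (ext 1 (fun=> 0)); rewrite quad_ext expr1n mul1r big1 => [|i _]; last by rewrite mul0r.
by rewrite mulr0 addr0 /quad_form big1 ?addr0 // => i _; rewrite big1 // => j _; rewrite !mul0r.
Qed.

(** With a zero pivot the form is affine in the first coordinate, so a nonzero slope makes it
    negative somewhere; the chosen point gives the value -1. *)
Lemma psd_row0 i : G ord0 ord0 = 0 -> G ord0 (lift ord0 i) = 0.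
Proof.
move=> a0; apply/eqP/negPn/negP => b0.
pose e (j : 'I_k) : R := (j == i)%:R.
have sumE : \sum_j e j * G ord0 (lift ord0 j) = G ord0 (lift ord0 i).
  by rewrite (bigD1 i) //= /e eqxx mul1r big1 ?addr0 // => j /negbTE ->; rewrite mul0r.
set q := quad_form (fun i j => G (lift ord0 i) (lift ord0 j)) e.
have := psdG (ext (- (q + 1) / (2 * G ord0 (lift ord0 i))) e).
rewrite quad_ext a0 mulr0 add0r sumE -/q.
have -> : 2 * (- (q + 1) / (2 * G ord0 (lift ord0 i))) * G ord0 (lift ord0 i) + q = -1.
  by field.
by rewrite ler0N1.
Qed.

(** For a nonzero pivot the Schur form is the full form at its critical first coordinate
    [- beta / G ord0 ord0]. *)
Lemma psd_schur theta : 0 <= quad_form (schur G) theta.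
Proof.
set beta := \sum_i theta i * G ord0 (lift ord0 i).
have [a0|a0] := eqVneq (G ord0 ord0) 0.
  have := psdG (ext 0 theta); rewrite quad_ext quad_form_schur a0 invr0.
  by rewrite expr0n /= !(mulr0, mul0r, add0r, subr0).
have := psdG (ext (- beta / G ord0 ord0) theta).
rewrite quad_ext quad_form_schur -/beta; congr (_ <= _); field.
exact: a0.
Qed.

(** Completion of the square; the squared linear form is the coefficient of the normal variable
    added in [gaussian_vector_exists]. *)
Lemma sqr_pivot theta : quad_form G theta = quad_form (schur G) (fun i => theta (lift ord0 i)) +
  (theta ord0 * Num.sqrt (G ord0 ord0) +
   \sum_i theta (lift ord0 i) * (G ord0 (lift ord0 i) / Num.sqrt (G ord0 ord0))) ^+ 2.
Proof.
rewrite quad_form_recl // quad_form_schur.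
have -> : \sum_i theta (lift ord0 i) * (G ord0 (lift ord0 i) / Num.sqrt (G ord0 ord0)) =
    (\sum_i theta (lift ord0 i) * G ord0 (lift ord0 i)) / Num.sqrt (G ord0 ord0).
  by rewrite mulr_suml; apply: eq_bigr => i _; rewrite mulrA.
set beta := \sum_i _.
have [a0|a0] := eqVneq (G ord0 ord0) 0.
  have -> : beta = 0 by rewrite /beta big1 // => i _; rewrite psd_row0 ?mulr0.
  rewrite a0 sqrtr0; ring.
have a1 : 0 < G ord0 ord0 by rewrite lt_def a0 psd_diag0.
have s0 : Num.sqrt (G ord0 ord0) != 0 by rewrite gt_eqF // sqrtr_gt0.
have aE : G ord0 ord0 = Num.sqrt (G ord0 ord0) ^+ 2 by rewrite sqr_sqrtr // ltW.
move: aE s0; move: (Num.sqrt _) => r -> r0; field.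
exact: r0.
Qed.

End psd.

(** The hypothesis at all phases [b] says that the characteristic function of [Z] at 1 is the real
    number [v], so that Fubini's theorem factors it out. *)
Lemma product_charfun d d' (T : measurableType d) (S : measurableType d')
    (Pr : probability T R) (Q : probability S R) (f : T -> R) (Z : S -> R) (v : R) :
  measurable_fun setT f -> measurable_fun setT Z ->
  (forall b, \int[Q]_y cos (b + Z y) = cos b * v) ->
  \int[(Pr \x Q)%E]_z cos (f z.1 + Z z.2) = (\int[Pr]_t cos (f t)) * v.
Proof.
move=> mf mZ charZ; pose PQ : probability _ R := (Pr \x Q)%E.
have mcos : measurable_fun setT (@cos R).
  by apply: continuous_measurable_fun; exact: continuous_cos.
have mF : measurable_fun setT (fun z : T * S => cos (f z.1 + Z z.2)).
  by apply: measurableT_comp => //; apply: measurable_funD; exact: measurableT_comp.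
have iF : (Pr \x Q)%E.-integrable setT (EFin \o (fun z => cos (f z.1 + Z z.2))).
  apply: (@integrable_dominated _ _ _ _ _ (cst 1)) => //.
    exact: (@finite_measure_integrable_cst _ _ _ PQ).
  by move=> z; exact: cos_max.
have inner t : (\int[Q]_y (cos (f t + Z y))%:E = (cos (f t) * v)%:E)%E.
  rewrite -charZ /Rintegral fineK //; apply: integrable_fin_num => //.
  apply: (@integrable_dominated _ _ _ _ _ (cst 1)) => //.
  - by apply: measurableT_comp => //; exact: measurable_funD.
  - exact: finite_measure_integrable_cst.
  - by move=> x; exact: cos_max.
rewrite [LHS]/Rintegral -(integral12_prod_meas1 iF) /=.
rewrite (eq_integral (fun t => (cos (f t) * v)%:E)); last by move=> t _; exact: inner.
rewrite -/(Rintegral Pr setT (fun t => cos (f t) * v)).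
rewrite RintegralZr //; apply: (@integrable_dominated _ _ _ _ _ (cst 1)) => //.
- exact: measurableT_comp.
- exact: finite_measure_integrable_cst.
- by move=> x; exact: cos_max.
Qed.

(* One normal variable is added for each coordinate: it carries the first row of
   the covariance matrix, and the other coordinates are left with the Schur
   complement.  When the pivot vanishes so does its row, and division by zero
   gives the right value 0. *)
Lemma gaussian_vector_exists k (G : 'I_k -> 'I_k -> R) :
  (forall i j, G i j = G j i) -> (forall theta, 0 <= quad_form G theta) ->
  exists (d : measure_display) (T : measurableType d) (Pr : probability T R) (X : 'I_k -> T -> R),
    (forall i, measurable_fun setT (X i)) /\
    forall b theta, \int[Pr]_t cos (b + \sum_i theta i * X i t) =
      cos b * expR (- (quad_form G theta / 2)).
Proof.
elim: k G => [|k IH] G symG psdG.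
  exists _, _, (dirac (0 : R)), (fun _ _ => 0); split=> // b theta.
  under eq_Rintegral do rewrite big_ord0 addr0.
  by rewrite Rintegral_prob_cst /quad_form big_ord0 mul0r oppr0 expR0 mulr1.
have symS i j : schur G i j = schur G j i by rewrite /schur symG; ring.
have [d [T [Pr [X [mX charX]]]]] := IH (schur G) symS (psd_schur symG psdG).
pose Q : probability _ R := normal_prob (0 : R) 1.
pose c i := G ord0 (lift ord0 i) / Num.sqrt (G ord0 ord0).
exists _, _, (Pr \x Q)%E.
exists (fun i z => if unlift ord0 i is Some j then X j z.1 + c j * z.2
  else Num.sqrt (G ord0 ord0) * z.2); split.
  move=> i; case: (unlift ord0 i) => [j|].
    apply: measurable_funD; first exact: measurableT_comp.
    by apply: measurable_funM => //; exact: measurable_snd.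
  by apply: measurable_funM => //; exact: measurable_snd.
move=> b theta.
pose m := theta ord0 * Num.sqrt (G ord0 ord0) + \sum_i theta (lift ord0 i) * c i.
have := @product_charfun _ _ _ _ Pr Q (fun t => b + \sum_i theta (lift ord0 i) * X i t)
  (fun y => m * y) (expR (- (m ^+ 2 / 2))).
rewrite charX sqr_pivot // -/m mulrDl opprD expRD mulrA => <-.
- apply: eq_Rintegral => z _; congr cos.
  rewrite big_ord_recl unlift_none.
  under eq_bigr do rewrite liftK mulrDr.
  rewrite big_split /= /m mulrDl mulr_suml.
  rewrite [X in _ = _ + (_ + X)](eq_bigr (fun i => theta (lift ord0 i) * (c i * z.2))); last first.
    by move=> i _; rewrite mulrA.
  ring.
- apply: measurable_funD => //; apply: measurable_sum => i.
  by apply: measurable_funM.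
- exact: measurable_funM.
- by move=> b'; rewrite (@normal_charfun R 1 ltr01) mul1r.
Qed.

End gaussian_vector_exists.

(** * Covariances *)

Section block_sizes.
Variables (R : realType) (p : probability nat R) (sigma2 : R).
Local Notation E g := (\int[p]_r g r).
Local Notation integ g := (p.-integrable setT (EFin \o g)).
Hypothesis p_critical : 'E_p[fun i : nat => i%:R]%E = 1%E.
Hypothesis p_variance : variance p (fun i : nat => i%:R) = sigma2%:E.
Hypothesis sigma2_gt0 : 0 < sigma2.

(** As the mean is 1, the variance is the second moment of the increment. The identity between
    extended reals also yields integrability. *)
Lemma incr_sqr_integral : (\int[p]_r (incr R r ^+ 2)%:E = sigma2%:E)%E.
Proof.
rewrite -p_variance /variance unlock p_critical /= unlock.
by apply: eq_integral => r _; rewrite /incr /= fctE /= expr2.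
Qed.

Lemma incr_sqr_integrable : integ (fun r => incr R r ^+ 2).
Proof.
apply/integrableP; split; first exact/measurable_EFinP.
under eq_integral do rewrite /= ger0_norm ?sqr_ge0 //.
by rewrite incr_sqr_integral ltry.
Qed.

Lemma incr_sqr_expectation : E (fun r => incr R r ^+ 2) = sigma2.
Proof. by rewrite /Rintegral incr_sqr_integral. Qed.

Let incr_int : integ (incr R).
Proof. exact: integ_of_sqr incr_sqr_integrable. Qed.

Lemma incr_expectation : E (incr R) = 0.
Proof.
have i1 : integ (fun=> 1) by exact: finite_measure_integrable_cst.
have := RintegralD measurableT incr_int i1.
rewrite (Rintegral_prob_cst p 1) (@eq_Rintegral _ _ _ p _ (fun r =>
  r%:R)); last by move=> r _; rewrite subrK.
have -> : E (fun r => r%:R) = 1 by move: p_critical; rewrite unlock /Rintegral => ->.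
by move=> H; apply: (addIr 1); rewrite -H add0r.
Qed.

Variables (k : nat) (A : 'I_k -> set nat).

Let ind (B : set nat) (r : nat) : R := (r \in B)%:R.

Let ind_le1 B r : `|ind B r| <= 1.
Proof. by rewrite /ind normr_nat lern1; case: (_ \in _). Qed.

Let ind_int B : integ (ind B). Proof. exact: integ_bounded (ind_le1 B). Qed.

Let ind_incr_int B : integ (fun r => ind B r * incr R r).
Proof.
apply: (@integrable_dominated _ _ _ _ _ (fun r => `|incr R r|)) => //.
  by have := integrable_norm incr_int.
by move=> r; rewrite normrM ler_piMl.
Qed.

Lemma E_ind B : E (ind B) = fine (p B).
Proof.
rewrite (_ : ind B = \1_B); last by apply/funext => r; rewrite indicE.
by rewrite /Rintegral integral_indic // setIT.
Qed.

(** The partial sums are truncated expectations; the limit is the expectation by domination, and in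
    particular it is finite. *)
Lemma drift_sumE B : drift_sum p B = (E (fun r => ind B r * incr R r))%:E.
Proof.
rewrite /drift_sum; apply/cvg_lim => //.
have -> : (fun n => \sum_(0 <= r < n | r \in B) ((r%:R - 1) * mass p r)%:E)%E =
    EFin \o (fun n => E (fun r => (r < n)%N%:R * (ind B r * incr R r))).
  apply/funext => n /=; rewrite -sum_mass big_mkord sumEFin; congr EFin.
  rewrite big_mkcond; apply: eq_bigr => r _; rewrite /ind /incr.
  by case: (_ \in _); rewrite ?mul1r ?mul0r ?mulr0 // mulrC.
apply: cvg_EFin; first exact: nearW.
apply: (@Rintegral_dct R _ _ p _ _ (fun r => `|ind B r * incr R r|)) => //.
- move=> r; apply: cvg_near_cst; exists r.+1 => // n /= rn.
  by rewrite rn mul1r.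
- by have := integrable_norm (ind_incr_int B).
- by move=> n r; rewrite normrM ler_piMl // normr_nat lern1; case: (_ < _)%N.
Qed.

Definition drift i : R := fine (drift_sum p (A i)).

Lemma drift_EFin i : drift_sum p (A i) = (drift i)%:E.
Proof. by rewrite /drift drift_sumE. Qed.

(* The residual of the linear regression of the indicator of A i on incr. *)
Definition residual i (r : nat) : R :=
  ind (A i) r - fine (p (A i)) - drift i / sigma2 * incr R r.

Definition limit_cov i j : R := E (fun r => residual i r * residual j r).

Let res_sqr_int i : integ (fun r => residual i r ^+ 2).
Proof.
apply: (@integrable_dominated _ _ _ _ _ (fun r =>
  2 * 4 + 2 * (drift i / sigma2) ^+ 2 * incr R r ^+ 2)) => //.
  apply: integrableRD => //; first by exact: finite_measure_integrable_cst.
  by apply: integrableRZ => //; exact: incr_sqr_integrable.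
move=> r; rewrite ger0_norm ?sqr_ge0 // /residual.
set u := ind _ _ - _; set x := _ / _; set y := incr R r.
have u2 : `|u| <= 2.
  apply: le_trans (ler_normB _ _) _; rewrite -[leRHS]/(1 + 1) lerD ?ind_le1 //.
  rewrite -E_ind; apply: le_trans (le_normr_Rintegral _ _) _ => //.
  rewrite -(Rintegral_prob_cst p 1); apply: le_Rintegral => //.
  - by have := integrable_norm (ind_int (A i)).
  - exact: finite_measure_integrable_cst.
have u4 : u ^+ 2 <= 4.
  by rewrite -(real_normK (num_real u)) (_ : 4 = 2 ^+ 2) ?ler_sqr ?nnegrE ?normr_ge0 //; ring.
have := sqr_ge0 (u + x * y); have -> : 2 * x ^+ 2 * y ^+ 2 = 2 * (x * y) ^+ 2 by ring.
by move: (x * y) => z; nra.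
Qed.

Let res_int i : integ (residual i).
Proof. exact: integ_of_sqr (res_sqr_int i). Qed.

Let res_mul_int i j : integ (fun r => residual i r * residual j r).
Proof. exact: integ_mul. Qed.

Let res_incr_int i : integ (fun r => residual i r * incr R r).
Proof. by apply: integ_mul => //; exact: incr_sqr_integrable. Qed.

Let E_res i : E (residual i) = 0.
Proof.
have i1 : integ (fun=> fine (p (A i))) by exact: finite_measure_integrable_cst.
have i2 := integrableRZ measurableT (drift i / sigma2) incr_int.
rewrite RintegralB //; last exact: integrableRB.
by rewrite RintegralB // RintegralZl // incr_expectation mulr0 E_ind (Rintegral_prob_cst p) !subrr.
Qed.

Let E_res_incr i : E (fun r => residual i r * incr R r) = 0.
Proof.
rewrite (@eq_Rintegral _ _ _ p _ (fun r => ind (A i) r * incr R r - fine (p (A i)) * incr R r -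
   drift i / sigma2 * incr R r ^+ 2)); last by move=> r _; rewrite /residual; ring.
have i1 := integrableRZ measurableT (fine (p (A i))) incr_int.
have i2 := integrableRZ measurableT (drift i / sigma2) incr_sqr_integrable.
have i3 := ind_incr_int (A i).
rewrite RintegralB //; last exact: integrableRB.
rewrite RintegralB // !RintegralZl ?incr_sqr_expectation ?incr_expectation //;
  last exact: incr_sqr_integrable.
rewrite mulr0 subr0 /drift drift_sumE /=; field.
by rewrite gt_eqF.
Qed.

(** [residual i] is orthogonal to constants and to the increment, so in the expansion of
    [residual j] only its product with the indicator of [A j] contributes. *)
Lemma limit_covE i j : limit_cov i j =
  fine (p (A i `&` A j)) - fine (p (A i)) * fine (p (A j)) - sigma2^-1 * (drift i * drift j).
Proof.
rewrite /limit_cov (@eq_Rintegral _ _ _ p _ (fun r => ind (A i `&` A j) r -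
   fine (p (A i)) * ind (A j) r - drift i / sigma2 * (ind (A j) r * incr R r) -
   fine (p (A j)) * residual i r - drift j / sigma2 * (residual i r * incr R r))); last first.
  move=> r _; rewrite /residual.
  have -> : ind (A i `&` A j) r = ind (A i) r * ind (A j) r.
    by rewrite /ind in_setI -natrM mulnb.
  ring.
have i1 := integrableRZ measurableT (fine (p (A i))) (ind_int (A j)).
have i2 := integrableRZ measurableT (drift i / sigma2) (ind_incr_int (A j)).
have i3 := integrableRZ measurableT (fine (p (A j))) (res_int i).
have i4 := integrableRZ measurableT (drift j / sigma2) (res_incr_int i).
have i5 := ind_int (A i `&` A j); have i6 := ind_incr_int (A j); have i7 := ind_int (A j).
rewrite RintegralB //; last by do 3?[apply: integrableRB => //].
rewrite RintegralB //; last by do 2?[apply: integrableRB => //].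
rewrite RintegralB //; last by apply: integrableRB => //.
rewrite RintegralB // !RintegralZl // E_res E_res_incr !E_ind !mulr0 !subr0.
rewrite [X in _ - _ * X = _](_ : _ = drift j) ?/drift ?drift_sumE //=.
ring.
Qed.

Let tauE theta r : tau_of p A theta (fun i => drift i / sigma2) r = \sum_i theta i * residual i r.
Proof. by []. Qed.

Let tau_sqrE theta r : tau_of p A theta (fun i => drift i / sigma2) r ^+ 2 =
  \sum_i \sum_j theta i * theta j * (residual i r * residual j r).
Proof.
rewrite tauE expr2 big_distrlr /=; apply: eq_bigr => i _; apply: eq_bigr => j _; ring.
Qed.

Lemma tau_sqr_integrable theta : integ (fun r => tau_of p A theta (fun i =>
  drift i / sigma2) r ^+ 2).
Proof.
under eq_fun do rewrite tau_sqrE.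
apply: integrable_sumR => // i; apply: integrable_sumR => // j.
exact: integrableRZ.
Qed.

Lemma tau_expectation theta : E (tau_of p A theta (fun i => drift i / sigma2)) = 0.
Proof.
under eq_Rintegral do rewrite tauE.
rewrite Rintegral_sum //; last by move=> i; exact: integrableRZ.
by rewrite big1 // => i _; rewrite RintegralZl // E_res mulr0.
Qed.

Lemma tau_incr_expectation theta :
  E (fun r => tau_of p A theta (fun i => drift i / sigma2) r * incr R r) = 0.
Proof.
under eq_Rintegral do rewrite tauE mulr_suml.
rewrite Rintegral_sum //; last first.
  by move=> i; under eq_fun do rewrite -mulrA; exact: integrableRZ.
rewrite big1 // => i _; under eq_Rintegral do rewrite -mulrA.
by rewrite RintegralZl // E_res_incr mulr0.
Qed.

Lemma tau_sqr_expectation theta :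
  E (fun r => tau_of p A theta (fun i => drift i / sigma2) r ^+ 2) = quad_form limit_cov theta.
Proof.
under eq_Rintegral do rewrite tau_sqrE.
rewrite Rintegral_sum //; last first.
  by move=> i; apply: integrable_sumR => // j; exact: integrableRZ.
apply: eq_bigr => i _; rewrite Rintegral_sum //; last by move=> j; exact: integrableRZ.
by apply: eq_bigr => j _; rewrite RintegralZl.
Qed.

Lemma limit_cov_sym i j : limit_cov i j = limit_cov j i.
Proof. by apply: eq_Rintegral => r _; rewrite mulrC. Qed.

Lemma limit_cov_psd theta : 0 <= quad_form limit_cov theta.
Proof. by rewrite -tau_sqr_expectation; apply: Rintegral_ge0 => // r _; exact: sqr_ge0. Qed.

End block_sizes.

(** [P] takes finitely many values, so [g \o P] is a finite combination of indicators; values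
    outside [NC R n] have an empty preimage. *)
Lemma expectation_sg_law (R : realType) (w : nat -> R) n d (T : measurableType d)
    (Pr : probability T R) (P : T -> {set {set 'I_n}}) (g : {set {set 'I_n}} -> R) :
  has_sg_law w Pr P -> ('E_Pr[g \o P] = (\sum_(Q in NC R n) sg_prob w Q * g Q)%:E)%E.
Proof.
move=> [PNC lawP].
have mP Q : measurable (P @^-1` [set Q]).
  have [/lawP[]//|Qn] := boolP (Q \in NC R n).
  rewrite (_ : P @^-1` [set Q] = set0) //; apply/seteqP; split=> // t /= PQ.
  by move: (PNC t); rewrite PQ (negbTE Qn).
have iP Q : Pr.-integrable setT (EFin \o (fun t => g Q * \1_(P @^-1` [set Q]) t)).
  by apply: integrableRZ => //; apply: integrable_indic => //; rewrite ltey_eq fin_num_measure.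
have gE : g \o P = fun t => \sum_(Q in NC R n) g Q * \1_(P @^-1` [set Q]) t.
  apply/funext => t /=; rewrite (bigD1 (P t)) //= indicE mem_set // mulr1 big1 ?addr0 // =>
    Q /andP[_ QP].
  by rewrite indicE memNset ?mulr0 //= => E; move: QP; rewrite E eqxx.
rewrite unlock gE -(@fineK _ (\int[Pr]_t _)%E); last first.
  by apply: integrable_fin_num => //; exact: integrable_sumR.
rewrite -/(Rintegral Pr setT _) Rintegral_sum //; congr EFin; apply: eq_bigr => Q /lawP[mQ PQ].
rewrite RintegralZl //; last by apply: integrable_indic => //; rewrite ltey_eq fin_num_measure.
by rewrite mulrC; congr (_ * _); rewrite /Rintegral integral_indic // setIT;
  exact: (congr1 fine PQ).
Qed.

(** * Moments of the coordinates of a Gaussian vector *)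

Section gaussian_coordinates.
Variables (R : realType) (k : nat) (G : 'I_k -> 'I_k -> R).
Hypothesis psdG : forall theta, 0 <= quad_form G theta.
Variables (d : measure_display) (T : measurableType d) (Pr : probability T R).
Variable X : 'I_k -> T -> R.
Hypothesis mX : forall i, measurable_fun setT (X i).
Hypothesis charfunX : forall b theta, \int[Pr]_t cos (b + \sum_i theta i * X i t) =
  cos b * expR (- (quad_form G theta / 2)).

Let lin (c : 'I_k -> R) (t : T) : R := \sum_i c i * X i t.

Let mlin c : measurable_fun setT (lin c).
Proof. by apply: measurable_sum => i; exact: measurable_funM. Qed.

Let charfun_lin c b s : \int[Pr]_t cos (b + s * lin c t) = cos b * expR (- (quad_form G c *
  s ^+ 2 / 2)).
Proof.
have <- : quad_form G (fun i => s * c i) = quad_form G c * s ^+ 2.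
  rewrite /quad_form mulr_suml; apply: eq_bigr => i _.
  by rewrite mulr_suml; apply: eq_bigr => j _; ring.
rewrite -charfunX; apply: eq_Rintegral => t _; rewrite /lin mulr_sumr.
by congr (cos (_ + _)); apply: eq_bigr => i _; rewrite mulrA.
Qed.

Let sel (i : 'I_k) (j : 'I_k) : R := (j == i)%:R.

Let sum_sel i (F : 'I_k -> R) : \sum_j sel i j * F j = F i.
Proof.
by rewrite (bigD1 i) //= /sel eqxx mul1r big1 ?addr0 // => j /negbTE ->; rewrite mul0r.
Qed.

Let lin_sel i : lin (sel i) = X i.
Proof. by apply/funext => t; exact: sum_sel. Qed.

Let quad_sel i : quad_form G (sel i) = G i i.
Proof.
transitivity (\sum_j sel i j * \sum_l sel i l * G j l); last by rewrite !sum_sel.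
by apply: eq_bigr => j _; rewrite mulr_sumr; apply: eq_bigr => l _; rewrite mulrA.
Qed.

Lemma charfun_coord i b s : \int[Pr]_t cos (b + s * X i t) = cos b * expR (- (G i i * s ^+ 2 / 2)).
Proof. by rewrite -quad_sel -charfun_lin lin_sel. Qed.

Lemma cov_diag_ge0 i : 0 <= G i i.
Proof. by rewrite -quad_sel. Qed.

Lemma gaussian_vector_lin : gaussian_vector Pr X.
Proof. by move=> c; exact: (charfun_gaussian (mlin c) (psdG c) (charfun_lin c)). Qed.

Lemma coord_mean i : (\int[Pr]_t (X i t)%:E = 0)%E.
Proof. exact: (charfun_mean (mX i) (cov_diag_ge0 i) (charfun_coord i)). Qed.

Lemma coord_sqr i : (\int[Pr]_t (X i t ^+ 2)%:E = (G i i)%:E)%E.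
Proof. exact: (charfun_second_moment (mX i) (cov_diag_ge0 i) (charfun_coord i)). Qed.

(** Supplies the constant of the tightness estimate; the sum of the variances serves all coordinates
    at once. *)
Lemma charfun_coord_quad : exists2 C : R, 0 <= C &
  forall i s, 1 - \int[Pr]_t cos (s * X i t) <= C * s ^+ 2.
Proof.
exists (\sum_i G i i); first by apply: sumr_ge0 => i _; exact: cov_diag_ge0.
move=> i s.
rewrite (@eq_Rintegral _ _ _ Pr _ (fun t => cos (0 + s * X i t))) => [|t _]; last by rewrite add0r.
rewrite charfun_coord cos0 mul1r.
have h := expR_ge1Dx (- (G i i * s ^+ 2 / 2)).
have g0 : 0 <= G i i * s ^+ 2 by rewrite mulr_ge0 ?sqr_ge0 ?cov_diag_ge0.
apply: (@le_trans _ _ (G i i * s ^+ 2)); first lra.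
rewrite ler_wpM2r ?sqr_ge0 // (bigD1 i) //= lerDl.
by apply: sumr_ge0 => j _; exact: cov_diag_ge0.
Qed.

Hypothesis symG : forall i j, G i j = G j i.

(** Polarization: the second moment of [X i + X j] is known because this is a linear form in the
    vector. *)
Lemma coord_mul i j : (\int[Pr]_t (X i t * X j t)%:E = (G i j)%:E)%E.
Proof.
pose c l : R := sel i l + sel j l.
have linE t : lin c t = X i t + X j t.
  by rewrite /lin /c; under eq_bigr do rewrite mulrDl; rewrite big_split /= !sum_sel.
have qE : quad_form G c = G i i + G j j + 2 * G i j.
  transitivity (\sum_l c l * \sum_m c m * G l m).
    by apply: eq_bigr => l _; rewrite mulr_sumr; apply: eq_bigr => m _; rewrite mulrA.
  have cE (F : 'I_k -> R) : \sum_l c l * F l = F i + F j.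
    by rewrite /c; under eq_bigr do rewrite mulrDl; rewrite big_split /= !sum_sel.
  by rewrite !cE (symG j i); ring.
have s2 l := charfun_integrable_sqr (mX l) (cov_diag_ge0 l) (charfun_coord l).
have sc := charfun_integrable_sqr (mlin c) (psdG c) (charfun_lin c).
have E2 l : \int[Pr]_t (X l t ^+ 2) = G l l by rewrite /Rintegral coord_sqr.
have Ec : \int[Pr]_t (lin c t ^+ 2) = quad_form G c.
  by rewrite /Rintegral (charfun_second_moment (mlin c) (psdG c) (charfun_lin c)).
have XE : (fun t => X i t * X j t) = (fun t => 2^-1 * (lin c t ^+ 2 - X i t ^+ 2 - X j t ^+ 2)).
  by apply/funext => t; rewrite linE; field.
have i1 : Pr.-integrable setT (EFin \o (fun t => lin c t ^+ 2 - X i t ^+ 2)) by exact: integrableRB.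
have i2 : Pr.-integrable setT (EFin \o (fun t =>
  lin c t ^+ 2 - X i t ^+ 2 - X j t ^+ 2)) by exact: integrableRB.
have i3 : Pr.-integrable setT (EFin \o (fun t => X i t * X j t)) by rewrite XE; exact: integrableRZ.
rewrite -(@fineK _ (\int[Pr]_t _)%E); last exact: integrable_fin_num i3.
congr EFin; rewrite -/(Rintegral Pr setT (fun t => X i t * X j t)) XE RintegralZl //.
by rewrite RintegralB // RintegralB // Ec !E2 qE; field.
Qed.

End gaussian_coordinates.

Theorem theorem16 (R : realType) (w : nat -> R) (p : probability nat R)
  (sigma2 : R)
  (w_ge0 : forall i, (0 < i)%N -> 0 <= w i)
  (w_gt0 : exists2 i, (2 <= i)%N & 0 < w i)
  (w0 : w 0%N = 1)
  (w_equiv : equivalent_seq w (mass p))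
  (p_critical : 'E_p[fun i : nat => i%:R]%E = 1%E)
  (p_variance : variance p (fun i : nat => i%:R) = sigma2%:E)
  (sigma2_gt0 : 0 < sigma2)
  (d : nat -> measure_display) (T : forall n, measurableType (d n))
  (Pr : forall n, probability (T n) R)
  (P : forall n, T n -> {set {set 'I_n}})
  (P_law : forall n, well_defined w n -> has_sg_law w (Pr n) (P n))
  (k : nat) (k_gt0 : (0 < k)%N)
  (A : 'I_k -> set nat)
  (A_sub : forall i, A i `<=` [set r | (0 < r)%N])
  (A_neq0 : forall i, A i !=set0) :
  exists (d' : measure_display) (T' : measurableType d')
    (Pr' : probability T' R) (X : 'I_k -> {RV Pr' >-> R}),
    [/\ centered_gaussian_vector Pr' X,
        cvg_in_law (within (well_defined w) \oo)
          Pr (fun n t => scaled_counts p A (P n t))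
          Pr' (fun t => \row_i X i t),
        forall i, ('E_Pr'[(fun t => X i t ^+ 2)%R] =
          p (A i) * (1 - p (A i)) - sigma2^-1%:E * drift_sum p (A i) ^+ 2)%E
      & forall i j, i != j -> A i `&` A j = set0 ->
          (covariance Pr' (X i) (X j) =
          - (p (A i) * p (A j))
          - sigma2^-1%:E * (drift_sum p (A i) * drift_sum p (A j)))%E].
Proof.
pose G := limit_cov p sigma2 A.
have sG : forall i j, G i j = G j i by exact: limit_cov_sym.
have pG : forall theta, 0 <= quad_form G theta by exact: limit_cov_psd.
have [d' [T' [Pr' [X [mX charX]]]]] := gaussian_vector_exists sG pG.
exists d', T', Pr', (fun i => mfun_Sub (mem_set (mX i))).
have [C C0 CX] := charfun_coord_quad pG charX.
have mean i : 'E_Pr'[X i]%E = 0%E by rewrite unlock; exact: (coord_mean pG mX charX).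
have GE i j : (G i j)%:E = (p (A i `&` A j) - p (A i) * p (A j) -
    sigma2^-1%:E * (drift_sum p (A i) * drift_sum p (A j)))%E.
  have pE B : p B = (fine (p B))%:E by rewrite fineK //; exact: fin_num_measure.
  rewrite (pE (A i `&` A j)) (pE (A i)) (pE (A j)) !(drift_EFin p_critical p_variance).
  by rewrite /G (limit_covE p_critical p_variance sigma2_gt0).
split.
- split; last exact: mean.
  exact: (gaussian_vector_lin pG mX charX).
- move=> f cf [M fM].
  have q0 n (Q : {set {set 'I_n}}) : well_defined w n -> 0 <= sg_prob w Q.
    move=> [_ Z0]; rewrite /sg_prob divr_ge0 ?(ltW Z0) //; apply: prodr_ge0 => B _.
    by have [->|B0] := posnP #|B|; [rewrite w0 | exact: w_ge0].
  have q1 n : well_defined w n -> \sum_(Q in NC R n) sg_prob w Q = 1.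
    by move=> [_ Z0]; rewrite -mulr_suml mulfV // gt_eqF.
  pose Y t : 'rV[R]_k := \row_i X i t.
  have mY i : measurable_fun setT (fun t => Y t 0 i).
    by under eq_fun do rewrite mxE; exact: mX.
  have lim := @levy_cvg R k (well_defined w) (fun n => {set {set 'I_n}}) (fun n => NC R n)
    (fun n Q => sg_prob w Q) (fun n Q => scaled_counts p A Q) q0 q1 _ _ Pr' Y mY _ C C0 _ f M cf fM.
  have {}lim : \sum_(Q in NC R n) sg_prob w Q * f (scaled_counts p A Q)
      @[n --> within (well_defined w) \oo] --> \int[Pr']_t f (Y t).
    apply: lim => [b theta|i s].
      rewrite (@eq_Rintegral _ _ _ Pr' _ (fun t => cos (b + \sum_i theta i * X i t))); last first.
        by move=> t _; congr (cos (_ + _)); apply: eq_bigr => i _; rewrite mxE.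
      rewrite charX; apply: (@NC_charfun_cvg R w p w0 w_equiv k A A_sub w_gt0 sigma2
        (incr_sqr_integrable p_critical p_variance) (incr_expectation p_critical p_variance)
        (incr_sqr_expectation p_critical p_variance) sigma2_gt0 theta (fun i =>
          drift p A i / sigma2)).
      - exact: (tau_sqr_integrable p_critical p_variance).
      - exact: (tau_expectation p_critical p_variance).
      - exact: (tau_incr_expectation p_critical p_variance sigma2_gt0).
      - exact: (tau_sqr_expectation p_critical p_variance).
    by under eq_Rintegral do rewrite mxE; exact: CX.
  have -> : 'E_Pr'[f \o (fun t => \row_i mfun_Sub (mem_set (mX i)) t)]%E = (\int[Pr']_t f (Y t))%:E.
    rewrite unlock /Rintegral fineK //; apply: integrable_fin_num => //.
    apply: (@bounded_integrable _ _ _ _ _ M) => //.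
    exact: (measurable_continuous_comp mY cf fM).
  have limE : (\sum_(Q in NC R n) sg_prob w Q * f (scaled_counts p A Q))%:E
      @[n --> within (well_defined w) \oo] --> (\int[Pr']_t f (Y t))%:E.
    by apply: cvg_EFin => //; exact: nearW.
  apply: cvg_trans limE.
  (* The law of [P n] is known for well-defined [n] only, so the expectations are identified along
     that filter. *)
  apply: near_eq_cvg; rewrite near_withinE; apply: nearW => n Wn.
  exact: esym (expectation_sg_law (fun Q => f (scaled_counts p A Q)) (P_law n Wn)).
- move=> i; rewrite unlock (coord_sqr pG mX charX) GE setIid.
  by rewrite muleBr ?fin_num_measure //= mule1.
(* Disjointness removes the joint mass from [GE]; centring makes the covariance the mixed second
   moment. *)
- move=> i j _ Aij; rewrite unlock !mean /=.
  rewrite (_ : _ * _ = fun t => X i t * X j t); last first.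
    by apply/funext => t; rewrite fctE /= !subr0.
  rewrite unlock (coord_mul pG mX charX sG) GE Aij measure0.
  by rewrite add0e.
Qed.
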